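(* Let $N\ge 20$ be an integer, $M\in\mathbb N$, $c_1,\dots,c_M\in\mathbb R$, and let $\mathcal C=\{x_1,\dots,x_M\}\subset SO(3)$ consist of pairwise distinct rotations with separation distance $$\rho(\mathcal C):=\min_{x_i\neq x_j}\omega(x_j^{-1}x_i)\ \ge\ \frac{36}{N+1}.$$ Let $\mu^*=\sum_{i=1}^M c_i\delta_{x_i}$. Then $\mu^*$ is the unique solution of $$\min_{\mu\in\mathcal M(SO(3))}\|\mu\|_{TV}\quad\text{subject to}\quad \langle \mu,D^l_{k,m}\rangle=\langle\mu^*,D^l_{k,m}\rangle\ \text{ for all } 0\le l\le N,\ -l\le k,m\le l .$$
   Context: $SO(3)=\{x\in\mathbb R^{3\times 3}: x^Tx=I,\ \det x=1\}$. For $x\in SO(3)$, $\omega(x)=\arccos\big((\operatorname{tr}(x)-1)/2\big)\in[0,\pi]$ is its rotation angle; $d(x,y)=\omega(y^{-1}x)$ is a bi-invariant metric on $SO(3)$. The Wigner D-functions $D^l_{k,m}$ ($l\in\mathbb N_0$, $-l\le k,m\le l$) are the matrix coefficients of the irreducible unitary representations of $SO(3)$ (of dimension $2l+1$), normalized so that $\{\sqrt{2l+1}D^l_{k,m}\}$ is an orthonormal basis of $L^2(SO(3))$ with respect to the normalized Haar measure; in Euler angles $x=R_Z(\alpha)R_X(\beta)R_Z(\gamma)$ one has $D^l_{k,m}(x)=e^{-ik\alpha}P^l_{k,m}(\cos\beta)e^{-im\gamma}$ with the standard Wigner $d$-functions $P^l_{k,m}$. $\mathcal M(SO(3))$ denotes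 the real (signed) finite regular Borel measures on $SO(3)$, $\langle\mu,f\rangle=\int_{SO(3)}f\,d\mu$, and $\|\mu\|_{TV}=|\mu|(SO(3))=\sup\sum_j|\mu(B_j)|$, the supremum over all finite Borel partitions $(B_j)$ of $SO(3)$. $\delta_x$ is the Dirac measure at $x$. *)

(* Defs.v *)
From HB Require Import structures.
From mathcomp Require Import all_boot all_order all_algebra.
From mathcomp Require Import all_classical all_reals all_analysis.
Set Implicit Arguments.
Unset Strict Implicit.
Unset Printing Implicit Defensive.
Import Order.TTheory GRing.Theory Num.Theory.
Import numFieldNormedType.Exports.
Local Open Scope classical_set_scope.
Local Open Scope ring_scope.

Section SO3.
Variable R : realType.

Definition is_SO3 (x : 'M[R]_3) : bool := (x^T *m x == 1%:M) && (\det x == 1).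

Definition SO3 := {x : 'M[R]_3 | is_SO3 x}.

Lemma is_SO3_1 : is_SO3 1%:M.
Proof. by rewrite /is_SO3 trmx1 mul1mx det1 !eqxx. Qed.

HB.instance Definition _ := Choice.on SO3.
HB.instance Definition _ := isPointed.Build SO3 (exist _ 1%:M is_SO3_1).

Definition SO3_open : set (set SO3) :=
  [set (@sval _ _) @^-1` U | U in [set U : set 'M[R]_3 | open U]].

Definition SO3B := g_sigma_algebraType SO3_open.

Definition rot_angle (x : 'M[R]_3) : R := acos ((\tr x - 1) / 2).
Definition so3_dist (x y : SO3) : R := rot_angle (invmx (sval y) *m sval x).

Definition mx3 (a b c d e f g h i : R) : 'M[R]_3 :=
  \matrix_(r < 3, s < 3)
    nth 0 (nth [::] [:: [:: a; b; c]; [:: d; e; f]; [:: g; h; i]] r) s.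

Definition RotZ (t : R) : 'M[R]_3 :=
  mx3 (cos t) (- sin t) 0 (sin t) (cos t) 0 0 0 1.
Definition RotX (t : R) : 'M[R]_3 :=
  mx3 1 0 0 0 (cos t) (- sin t) 0 (sin t) (cos t).

Definition euler_mx (abg : R * R * R) : 'M[R]_3 :=
  RotZ abg.1.1 *m RotX abg.1.2 *m RotZ abg.2.

Definition euler_angles (x : SO3) : R * R * R :=
  get [set abg | euler_mx abg = sval x].

Definition factz (z : int) : R := ((absz z)`!)%:R.

Definition wigner_d (l : nat) (k m : int) (b : R) : R :=
  \sum_(s < (2 * l).+1)
    (if [&& (0 <= l%:Z + m - s%:Z)%R, (0 <= k - m + s%:Z)%R
          & (0 <= l%:Z - k - s%:Z)%R]
     then (-1) ^+ (absz (k - m + s%:Z)%R)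
          * Num.sqrt (factz (l%:Z + k) * factz (l%:Z - k)
                      * factz (l%:Z + m) * factz (l%:Z - m))
          / (factz (l%:Z + m - s%:Z) * factz s%:Z
             * factz (k - m + s%:Z) * factz (l%:Z - k - s%:Z))
          * cos (b / 2) ^+ absz (2 * l%:Z + m - k - 2 * s%:Z)%R
          * sin (b / 2) ^+ absz (k - m + 2 * s%:Z)%R
     else 0).

(** Wigner D-function D^l_{k,m}(x) = e^{-ik alpha} d^l_{k,m}(beta) e^{-im gamma},
    split into real and imaginary parts *)
Definition wignerD_re (l : nat) (k m : int) (x : SO3) : R :=
  let: (a, b, g) := euler_angles x in
  cos (k%:~R * a + m%:~R * g) * wigner_d l k m b.
Definition wignerD_im (l : nat) (k m : int) (x : SO3) : R :=
  let: (a, b, g) := euler_angles x in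
  - sin (k%:~R * a + m%:~R * g) * wigner_d l k m b.

End SO3.

Section charges.
Context d (T : measurableType d) (R : realType).

Lemma hahn_ex (nu : {charge set T -> \bar R}) :
  exists PN : set T * set T, hahn_decomposition nu PN.1 PN.2.
Proof. by have [P [N h]] := Hahn_decomposition nu; exists (P, N). Qed.

Definition hahn_sets (nu : {charge set T -> \bar R}) : set T * set T :=
  proj1_sig (cid (hahn_ex nu)).

Lemma hahn_setsP (nu : {charge set T -> \bar R}) :
  hahn_decomposition nu (hahn_sets nu).1 (hahn_sets nu).2.
Proof. exact: (proj2_sig (cid (hahn_ex nu))). Qed.

Definition charge_pairing (nu : {charge set T -> \bar R}) (f : T -> R) : R :=
  (\int[jordan_pos (hahn_setsP nu)]_(x in [set: T]) f x
   - \int[jordan_neg (hahn_setsP nu)]_(x in [set: T]) f x)%R.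

Definition TV_norm (nu : {charge set T -> \bar R}) : \bar R :=
  ereal_sup [set r | exists n (B : 'I_n -> set T),
    [/\ (forall j, measurable (B j)),
        (forall i j, i != j -> B i `&` B j = set0),
        \bigcup_j B j = [set: T] &
        r = (\sum_(j < n) `|nu (B j)|)%E]].

End charges.

(* Main.v *)
(* Write a rotation as a unit quaternion p, determined up to sign: the angle between
   two rotations is 2 arccos |<p, q>|, so the nodes p_i satisfy
   |<p_i, p_j>| <= cos Delta with Delta = 18 / (N + 1).  The dual certificate is
     Q(p) = sum_j <p_j, p> <g_j, p> W(<p_j, p>),   W(cos t) = (sin(n t) / (n sin t))^8,
   with n about N / 4 and g_j in R^4.  It is an even polynomial of degree at most 2 N in
   p, hence a combination of Wigner functions of degree at most N.  Stereographic
   projection turns the separation into a cube packing in R^3, which bounds the sums of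
   W and its derivatives over the nodes away from p.  So the 4 M linear conditions
   "Q(p_i) = v_i and the tangential gradient vanishes at p_i" are diagonally dominant and
   solvable for every v; and if all v_i are 1 or -1, then |Q| < 1 off the nodes, by a
   second-order expansion near a node and by direct estimation elsewhere.
   Taking v_i to be the sign of c_i, integration of Q gives
   ||mu*|| = <mu*, Q> = <mu, Q> <= ||mu||, and in the case of equality mu is carried by
   the nodes; the certificates for arbitrary v then identify its weights as the c_i. *)
Require Import Defs.
From HB Require Import structures.
From mathcomp Require Import all_boot all_order all_algebra.
From mathcomp Require Import all_classical all_reals all_analysis.
From mathcomp Require Import measurable_realfun.
From mathcomp Require Import ring lra zify.
Set Implicit Arguments.
Unset Strict Implicit.
Unset Printing Implicit Defensive.
Import Order.TTheory GRing.Theory Num.Theory.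
Import numFieldNormedType.Exports.
Local Open Scope ring_scope.

(** * Taylor bounds for sine and cosine *)

(** Everything is measured by [y_j = 1 / (n sin t_j)], where [t_j] is the angle between [p] and the
    line of [p_j]. The kernel contributes [y_j ^ 8]; the tangential part of [g_j], which may be of
    size [n], costs one factor, so a term is of size [y_j ^ 7]. The packing puts at most
    [24 k ^ 2 + 2] nodes where [y_j] is of order [1 / k], so the sums converge fast. A higher power
    of the kernel would decay faster, but the degree [8 (n - 1) + 2 <= 2 N] shows the price: the
    exponent divides [n], and the separation matters through [n Delta]. The estimates know [N] only
    through [n >= 5], [Delta <= 6 / 7] and [n Delta >= 30 / 7], with equality in all three at
    [N = 20]. Three derived bounds on [y_j] then organise the constants: [133 / 500] as seen from
    another node, [8 / 25] from within [7 / (10 n)] of another node, and [301 / 625] from any point,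
    for all nodes but the nearest. *)

Section RealAnalysis.
Variable R : realType.
Implicit Types (f g : R -> R) (t x K : R).

Lemma is_derive_ge0_ge0 f g t :
  (forall s : R, is_derive s (1:R) f (g s)) -> f 0 = 0 -> 0 <= t ->
  (forall s : R, 0 <= s <= t -> 0 <= g s) -> 0 <= f t.
Proof.
move=> fg f0 t0 g0.
have [|c cab] := @MVT_segment R f g 0 t t0 (fun x _ => fg x).
  apply: derivable_within_continuous => x _; by case: (fg x).
rewrite f0 !subr0 => ->; rewrite mulr_ge0// g0//.
Qed.

Lemma taylor2_bound f f' f'' K t : 0 <= t ->
  (forall s : R, is_derive s (1:R) f (f' s)) -> (forall s : R, is_derive s (1:R) f' (f'' s)) ->
  (forall s : R, 0 <= s <= t -> `|f'' s| <= K) ->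
  `|f t - f 0 - f' 0 * t| <= K * t ^+ 2 / 2.
Proof.
move=> t0 df df' K''.
(* Used with [e = -1] and [e = 1] for the two sides of the absolute value. *)
have H (e : R) : (forall s : R, 0 <= s <= t -> e * f'' s <= K) ->
    e * (f t - f 0 - f' 0 * t) <= K * t ^+ 2 / 2.
  move=> He; rewrite -subr_ge0.
  apply: (@is_derive_ge0_ge0
    (fun s => K * s ^+ 2 / 2 - e * (f s - f 0 - f' 0 * s))
    (fun s => K * s - e * (f' s - f' 0)) t) => //.
  - move=> s; have := df s => dfs; apply: is_derive_eq.
    rewrite /GRing.scale/=; by field.
  - by rewrite expr0n/=; ring.
  - move=> s /andP[s0 st].
    apply: (@is_derive_ge0_ge0
      (fun s => K * s - e * (f' s - f' 0)) (fun s => K - e * f'' s) s) => //.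
    + move=> r; have := df' r => dfs; apply: is_derive_eq.
      rewrite /GRing.scale/=; by ring.
    + by ring.
    + by move=> r /andP[r0 rs]; rewrite subr_ge0 He// r0 (le_trans rs).
rewrite ler_norml; apply/andP; split.
  rewrite lerNl -mulN1r; apply: H => s st.
  by rewrite mulN1r; move: (K'' _ st); rewrite ler_norml; lra.
rewrite -[X in X <= _]mul1r; apply: H => s st.
by rewrite mul1r; move: (K'' _ st); rewrite ler_norml; lra.
Qed.

Lemma sin_le_id x : 0 <= x -> sin x <= x.
Proof.
move=> x0; rewrite -subr_ge0.
apply: (@is_derive_ge0_ge0 (fun x => x - sin x) (fun x => 1 - cos x)) => //.
by rewrite /= sin0 subr0.
Qed.

Lemma cos_ge_taylor2 x : 0 <= x -> 1 - x ^+ 2 / 2 <= cos x.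
Proof.
move=> x0; rewrite -subr_ge0.
apply: (@is_derive_ge0_ge0 (fun x => cos x - (1 - x ^+ 2 / 2)) (fun x => x - sin x)) => //.
- by move=> s; apply: is_derive_eq; rewrite /GRing.scale/=; by field.
- by rewrite /= cos0 expr0n/=; ring.
- by move=> s /andP[s0 _]; rewrite subr_ge0 sin_le_id.
Qed.

Lemma sin_ge_taylor3 x : 0 <= x -> x - x ^+ 3 / 6 <= sin x.
Proof.
move=> x0; rewrite -subr_ge0.
apply: (@is_derive_ge0_ge0 (fun x => sin x - (x - x ^+ 3 / 6))
  (fun x => cos x - (1 - x ^+ 2 / 2))) => //.
- by move=> s; apply: is_derive_eq; rewrite /GRing.scale/=; by field.
- by rewrite /= sin0 expr0n/=; ring.
- by move=> s /andP[s0 _]; rewrite subr_ge0 cos_ge_taylor2.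
Qed.

Lemma cos_le_taylor4 x : 0 <= x -> cos x <= 1 - x ^+ 2 / 2 + x ^+ 4 / 24.
Proof.
move=> x0; rewrite -subr_ge0.
apply: (@is_derive_ge0_ge0 (fun x => 1 - x ^+ 2 / 2 + x ^+ 4 / 24 - cos x)
  (fun x => sin x - (x - x ^+ 3 / 6))) => //.
- by move=> s; apply: is_derive_eq; rewrite /GRing.scale/=; by field.
- by rewrite /= cos0 !expr0n/=; ring.
- by move=> s /andP[s0 _]; rewrite subr_ge0 sin_ge_taylor3.
Qed.

Lemma sin_le_taylor5 x : 0 <= x -> sin x <= x - x ^+ 3 / 6 + x ^+ 5 / 120.
Proof.
move=> x0; rewrite -subr_ge0.
apply: (@is_derive_ge0_ge0 (fun x => x - x ^+ 3 / 6 + x ^+ 5 / 120 - sin x)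
  (fun x => 1 - x ^+ 2 / 2 + x ^+ 4 / 24 - cos x)) => //.
- by move=> s; apply: is_derive_eq; rewrite /GRing.scale/=; by field.
- by rewrite /= sin0 !expr0n/=; ring.
- by move=> s /andP[s0 _]; rewrite subr_ge0 cos_le_taylor4.
Qed.

End RealAnalysis.

(** * The Chebyshev kernel *)

Section Chebyshev.
Variable R : realType.
Implicit Types (n : nat) (t c d y : R).

(* [(T_n, U_n)] with [U_n (cos t) = sin (n t) / sin t]: the index of the second
   component is shifted by one from the usual Chebyshev polynomials. *)
Fixpoint cheb n : {poly R} * {poly R} :=
  if n is n'.+1 then
    let: (T, U) := cheb n' in ('X * T - (1 - 'X ^+ 2) * U, 'X * U + T)
  else (1, 0).

Definition chebT n := (cheb n).1.
Definition chebU n := (cheb n).2.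

Lemma chebTS n : chebT n.+1 = 'X * chebT n - (1 - 'X ^+ 2) * chebU n.
Proof. by rewrite /chebT /chebU /=; case: (cheb n). Qed.

Lemma chebUS n : chebU n.+1 = 'X * chebU n + chebT n.
Proof. by rewrite /chebT /chebU /=; case: (cheb n). Qed.

Lemma cheb_pythagoras n : chebT n ^+ 2 + (1 - 'X ^+ 2) * chebU n ^+ 2 = 1.
Proof.
elim: n => [|n IH]; first by rewrite /chebT /chebU /=; ring.
by rewrite chebTS chebUS -[RHS]IH; ring.
Qed.

(** The derivative of [sin (n t) / sin t] is kept multiplied by [1 - 'X ^ 2]: as polynomial
    identities both formulas also hold at 1 and -1, where the trigonometric form divides by zero. *)
Lemma deriv_cheb n : (chebT n)^`() = n%:R * chebU n /\
  (1 - 'X ^+ 2) * (chebU n)^`() = 'X * chebU n - n%:R * chebT n.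
Proof.
elim: n => [|n [IHT IHU]].
  by rewrite /chebT /chebU /= deriv0 -polyC1 derivC; split; ring.
have IHU' : (chebU n)^`() - 'X ^+ 2 * (chebU n)^`() =
  'X * chebU n - n%:R * chebT n by rewrite -IHU; ring.
rewrite chebTS chebUS; split.
  rewrite !poly.derivE IHT /= -natr1 (_ : _ + _ - _ = chebT n + 'X * (n%:R * chebU n) +
    (2 * 'X * chebU n) - ((1 - 'X^2) * (chebU n)^`())); last by ring.
  by rewrite IHU; ring.
rewrite !poly.derivE IHT /= -natr1 (_ : _ * _ = (1 - 'X^2) * (chebU n + n%:R * chebU n) +
  'X * ((1 - 'X^2) * (chebU n)^`())); last by ring.
by rewrite IHU; ring.
Qed.

(** Derivative of the second identity of [deriv_cheb]; it eliminates the second derivative of the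
    kernel in [kernel_bounds]. *)
Lemma chebU_ode n : (1 - 'X ^+ 2) * (chebU n)^`()^`() =
  3 * 'X * (chebU n)^`() - (n%:R ^+ 2 - 1) * chebU n.
Proof.
have [hT hU] := deriv_cheb n.
have := congr1 (fun p => p^`()) hU.
rewrite !poly.derivE hT /= => /eqP; rewrite -subr_eq0 => /eqP e.
by apply/eqP; rewrite -subr_eq0 -[X in _ == X]e; apply/eqP; ring.
Qed.

Lemma cheb_cos n t : (chebT n).[cos t] = cos (n%:R * t) /\
  (chebU n).[cos t] * sin t = sin (n%:R * t).
Proof.
elim: n => [|n [IHT IHU]].
  by rewrite /chebT /chebU /= hornerE horner0 !mul0r cos0 sin0.
rewrite -natr1 mulrDl mul1r cosD sinD chebTS chebUS !hornerE IHT.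
rewrite -sin2cos2; split; last by rewrite -IHU; ring.
by rewrite -IHU; ring.
Qed.

Lemma cheb1 n : (chebT n).[1] = 1 /\ (chebU n).[1] = n%:R.
Proof.
elim: n => [|n [IHT IHU]]; first by rewrite /chebT /chebU /= hornerE horner0.
by rewrite chebTS chebUS !hornerE IHT IHU -natr1; split; ring.
Qed.

Definition kerS n : {poly R} := n%:R^-1 *: chebU n.
Definition kerW n : {poly R} := kerS n ^+ 8.

Lemma kerW1 n : (0 < n)%N -> (kerW n).[1] = 1.
Proof.
move=> n0; rewrite /kerW /kerS !hornerE (cheb1 n).2 mulVf ?expr1n//.
by rewrite pnatr_eq0 -lt0n.
Qed.

Lemma pow6_bound (s C : R) : C ^+ 2 + s ^+ 2 = 1 -> s ^+ 6 * C ^+ 2 <= 27 / 256.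
Proof.
move=> e; have -> : C ^+ 2 = 1 - s ^+ 2 by lra.
have -> : s ^+ 6 = (s ^+ 2) ^+ 3 by rewrite -exprM.
set t := s ^+ 2; rewrite -subr_ge0.
(* The maximum of [t ^ 3 (1 - t)] is at [t = 3 / 4], hence the squared factor. *)
have -> : 27 / 256 - t ^+ 3 * (1 - t) = (t - 3 / 4) ^+ 2 * (t ^+ 2 + t / 2 + 3 / 16).
  by field.
by rewrite mulr_ge0 ?sqr_ge0//; rewrite /t; nra.
Qed.

(** With [e = C ^ 2] the claim is [16 e (1 - e) ^ 7 <= 1]. It follows from [(1 - e ^ 2) ^ 7 <= 1]
    and [16 e <= (1 + e) ^ 7], for which three terms of the binomial expansion suffice. *)
Lemma pow7_bound (s C : R) : C ^+ 2 + s ^+ 2 = 1 -> `|s ^+ 7 * C| <= 1 / 4.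
Proof.
move=> h; have h4 : (0 : R) <= 1 / 4 by lra.
rewrite -(@ler_sqr _ _ (1/4)) ?nnegrE//.
rewrite real_normK ?num_real// exprMn -exprM (_ : (7 * 2 = 2 * 7)%N)// exprM.
set e := C ^+ 2; have -> : s ^+ 2 = 1 - e by rewrite /e; lra.
have e0 : 0 <= e by rewrite sqr_ge0.
have e1 : e <= 1 by rewrite /e -h lerDl sqr_ge0.
have p1 : (1 - e) ^+ 7 * (1 + e) ^+ 7 <= 1.
  rewrite -exprMn; have -> : (1 - e) * (1 + e) = 1 - e ^+ 2 by ring.
  have := mulr_ge0 e0 e0; have : e * e <= 1 by nra.
  by move=> ? ?; apply: exprn_ile1; lra.
have p2 : 1 + 7 * e + 21 * e ^+ 2 <= (1 + e) ^+ 7.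
  rewrite -subr_ge0.
  have -> : (1 + e) ^+ 7 - (1 + 7 * e + 21 * e ^+ 2) =
    35 * e ^+ 3 + 35 * e ^+ 4 + 21 * e ^+ 5 + 7 * e ^+ 6 + e ^+ 7 by ring.
  by have := (exprn_ge0 3 e0, exprn_ge0 4 e0, exprn_ge0 5 e0, exprn_ge0 6 e0, exprn_ge0 7 e0) => -[[[[]]]]; lra.
have q0 : 0 <= (1 - e) ^+ 7 by rewrite exprn_ge0 // subr_ge0.
set Z := (1 - e) ^+ 7 in p1 q0 *.
have p3 : Z * (1 + 7 * e + 21 * e ^+ 2) <= 1.
  by apply: le_trans p1; rewrite ler_wpM2l.
have p4 : 16 * e <= 1 + 7 * e + 21 * e ^+ 2 by have := sqr_ge0 (e - 3 / 14); nra.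
have p5 : Z * (16 * e) <= 1 by apply: le_trans p3; rewrite ler_wpM2l.
have -> : (1 / 4 : R) ^+ 2 = 1 / 16 by field.
by lra.
Qed.

End Chebyshev.

Section KernelBounds.
Variable R : realType.
Implicit Types (n : nat) (t c d y a b : R).

Lemma horner_one c : (1 : {poly R}).[c] = 1.
Proof. by rewrite -polyC1 hornerC. Qed.

Let hE := (hornerD, hornerN, hornerX, hornerXn, horner_one, horner_exp, hornerZ,
  hornerM, hornerMn, hornerC).

Lemma sqr_le1_norm a : a ^+ 2 <= 1 -> `|a| <= 1.
Proof. by move=> h; rewrite -(@expr_le1 _ 2)// real_normK ?num_real. Qed.

(* With [rho = sqrt (1 - c ^ 2)], [y = 1 / (n rho)], [U n] evaluates to
   [sigma / rho], where [T ^ 2 + sigma ^ 2 = 1]. *)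
Lemma kernel_bounds n c d y : (0 < n)%N -> 0 < y ->
  n%:R ^+ 2 * y ^+ 2 * (1 - c ^+ 2) = 1 -> d ^+ 2 <= 1 - c ^+ 2 ->
  [/\ `|(kerW R n).[c]| <= y ^+ 8,
      `|(kerW R n)^`().[c] * d| <= n%:R * (8 * y + 2) * y ^+ 8 &
      `|(kerW R n)^`()^`().[c] * d ^+ 2 - (kerW R n)^`().[c] * c|
        <= n%:R ^+ 2 * (72 * y ^+ 2 + 32 * y + 14) * y ^+ 8].
Proof.
move=> n0 y0 hy hd; set N : R := n%:R in hy *.
have N0 : 0 < N by rewrite ltr0n.
pose S := (kerS R n).[c]; pose C := (chebT R n).[c].
pose s1 := (kerS R n)^`().[c]; pose s2 := (kerS R n)^`()^`().[c].
have W0 : (kerW R n).[c] = S ^+ 8 by rewrite /kerW horner_exp.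
have W1 : (kerW R n)^`().[c] = 8 * S ^+ 7 * s1.
  by rewrite /kerW deriv_exp /= hornerMn hornerM horner_exp -/S -/s1; ring.
have W2 : (kerW R n)^`()^`().[c] = 56 * S ^+ 6 * s1 ^+ 2 + 8 * S ^+ 7 * s2.
  rewrite /kerW deriv_exp /= derivMn derivM deriv_exp /= hornerMn hornerD !hornerM.
  by rewrite hornerMn hornerM !horner_exp -/S -/s1 -/s2; ring.
have US : (chebU R n).[c] = N * S by rewrite /S /kerS hE mulrA mulfV ?mul1r ?gt_eqF.
have Us1 : (chebU R n)^`().[c] = N * s1.
  by rewrite /s1 /kerS derivZ hE mulrA mulfV ?mul1r ?gt_eqF.
have Us2 : (chebU R n)^`()^`().[c] = N * s2.
  by rewrite /s2 /kerS !derivZ hE mulrA mulfV ?mul1r ?gt_eqF.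
have pyt : C ^+ 2 + (1 - c ^+ 2) * (N * S) ^+ 2 = 1.
  by have := congr1 (horner^~ c) (cheb_pythagoras R n); rewrite !hE US.
have ds1 : (1 - c ^+ 2) * s1 = c * S - C.
  have := congr1 (horner^~ c) (deriv_cheb R n).2.
  rewrite !hE Us1 US -/C -/N => h.
  by apply: (mulfI (lt0r_neq0 N0)); rewrite mulrCA h; ring.
have ds2 : (1 - c ^+ 2) * s2 = 3 * c * s1 - (N ^+ 2 - 1) * S.
  have := congr1 (horner^~ c) (chebU_ode R n).
  rewrite !hE Us1 US Us2 -/N => h.
  by apply: (mulfI (lt0r_neq0 N0)); rewrite mulrCA h; ring.
have [sg Sy] : {sg | S = sg * y} by exists (S / y); rewrite mulfVK ?gt_eqF.
have C2sg : C ^+ 2 + sg ^+ 2 = 1.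
  rewrite -[RHS]pyt Sy; congr (_ + _).
  by transitivity (N ^+ 2 * y ^+ 2 * (1 - c ^+ 2) * sg ^+ 2); [rewrite hy mul1r|ring].
(* Normalised quantities, with [|q| <= y] and [|k| <= 1]: in terms of [q], [k], [sg] and [C], the
   common powers of [N] and [y] come out as a factor. *)
have [q qE] : {q | q = c * y} by exists (c * y).
have [k kE] : {k | k = N * y * d} by exists (N * y * d).
have es1 : s1 = N ^+ 2 * y ^+ 2 * (q * sg - C).
  by rewrite qE (_ : c * y * sg = c * S) ?Sy; [|ring]; rewrite -Sy -ds1 mulrA hy mul1r.
have es2 : s2 = N ^+ 2 * y ^+ 2 * (3 * c * s1 - (N ^+ 2 - 1) * S).
  by rewrite -ds2 mulrA hy mul1r.
have k1 : k ^+ 2 <= 1.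
  rewrite -hy kE exprMn exprMn ler_wpM2l// mulr_ge0// exprn_ge0 ?(ltW y0, ltW N0)//.
have k0 : 0 <= k ^+ 2 by rewrite sqr_ge0.
have c1 : c ^+ 2 <= 1 by rewrite -subr_ge0; apply: le_trans hd; rewrite sqr_ge0.
have q1 : `|q| <= y.
  by rewrite qE normrM (gtr0_norm y0) ler_piMl ?(ltW y0) ?sqr_le1_norm.
have sg1 : `|sg| <= 1 by apply: sqr_le1_norm; rewrite -C2sg lerDr sqr_ge0.
have sgm m : `|sg ^+ m| <= 1 by rewrite normrX exprn_ile1.
have b7 := pow7_bound C2sg; have b6 := pow6_bound C2sg.
have y8 : 0 <= y ^+ 8 by rewrite exprn_ge0 ?ltW.
split.
- rewrite W0 Sy exprMn normrM (ger0_norm y8) ler_piMl//.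
- have -> : (kerW R n)^`().[c] * d = N * (8 * (k * (sg ^+ 8 * q - sg ^+ 7 * C))) * y ^+ 8.
    by rewrite W1 es1 Sy kE; ring.
  rewrite normrM (ger0_norm y8) ler_wpM2r//.
  rewrite normrM (gtr0_norm N0) ler_wpM2l ?(ltW N0)// !normrM.
  rewrite (@ger0_norm _ 8)//; have ak : `|k| <= 1 by exact: sqr_le1_norm.
  have : `|sg ^+ 8 * q - sg ^+ 7 * C| <= y + 1 / 4.
    rewrite (le_trans (ler_normB _ _))// lerD// normrM.
    by rewrite -[y]mul1r ler_pM.
  move: (normr_ge0 (sg ^+ 8 * q - sg ^+ 7 * C)) (normr_ge0 k) ak.
  move: `|_ - _| `|k| => z k' z0 k'0 ak zy.
  have : k' * z <= z by rewrite ler_piMl.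
  lra.
(* Second derivative of [W] along a unit-speed geodesic, with [s2] eliminated by the differential
   equation. The four groups contribute at most [6] (from [27 / 256]), [32 y], [72 y ^ 2] and
   [8]. *)
have -> : (kerW R n)^`()^`().[c] * d ^+ 2 - (kerW R n)^`().[c] * c =
  N ^+ 2 * (56 * k ^+ 2 * (sg ^+ 6 * C ^+ 2) + (- (112 * k ^+ 2) - 8 * (3 * k ^+ 2 - 1))
    * (q * (sg ^+ 7 * C))
   + (56 * k ^+ 2 + 8 * (3 * k ^+ 2 - 1)) * (q ^+ 2 * sg ^+ 8)
   - 8 * (k ^+ 2 * (1 - N ^- 2)) * sg ^+ 8) * y ^+ 8.
  rewrite W1 W2 es2 es1 Sy kE qE; field.
  by rewrite gt_eqF.
rewrite normrM (ger0_norm y8) ler_wpM2r//.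
rewrite normrM (ger0_norm (sqr_ge0 N)) ler_wpM2l ?sqr_ge0//.
have iN : 0 <= 1 - N ^- 2 <= 1.
  rewrite subr_ge0 lerBlDr lerDl invr_ge0 sqr_ge0 andbT invf_le1 ?exprn_gt0//.
  by rewrite -natrX ler1n expn_gt0 n0.
set e7 := q * (sg ^+ 7 * C); set e8 := q ^+ 2 * sg ^+ 8.
have he7 : `|e7| <= y / 4.
  by rewrite /e7 normrM (_ : y / 4 = y * (1 / 4)) ?ler_pM//; field.
have q2 : q ^+ 2 <= y ^+ 2 by rewrite -real_normK ?num_real// lerXn2r ?nnegrE ?(ltW y0).
have g8 : 0 <= sg ^+ 8 <= 1.
  rewrite (_ : 8 = 2 * 4)%N// exprM exprn_ge0 ?sqr_ge0//= exprn_ile1 ?sqr_ge0//.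
  by rewrite -C2sg lerDr sqr_ge0.
have he8 : 0 <= e8 <= y ^+ 2.
  have := sqr_ge0 q; have := sqr_ge0 y; rewrite /e8; nra.
have h6 : 0 <= sg ^+ 6 * C ^+ 2.
  by rewrite mulr_ge0 ?sqr_ge0// (_ : 6 = 2 * 3)%N// exprM exprn_ge0 ?sqr_ge0.
set f6 := sg ^+ 6 * C ^+ 2 in b6 h6 *; set K := k ^+ 2 in k0 k1 *.
set g := sg ^+ 8 in g8 *.
have t1 : 0 <= 56 * K * f6 <= 6 by nra.
have t2 : `|(- (112 * K) - 8 * (3 * K - 1)) * e7| <= 128 * (y / 4).
  rewrite normrM ler_pM// ler_norml; apply/andP; split; lra.
have t3 : `|(56 * K + 8 * (3 * K - 1)) * e8| <= 72 * y ^+ 2.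
  rewrite normrM ler_pM//; first by rewrite ler_norml; apply/andP; split; lra.
  by rewrite ger0_norm; case/andP: he8.
have t4 : 0 <= 8 * (K * (1 - N ^- 2)) * g <= 8.
  have : 0 <= K * (1 - N ^- 2) <= 1 by set z := 1 - _ in iN *; nra.
  set z := K * _; nra.
move: t2 t3; set u := _ * e7; set v := _ * e8; set w := 56 * K * f6 in t1 *.
move: t4; set x := 8 * _ * g.
rewrite !ler_norml; set y2 := y ^+ 2; lra.
Qed.

End KernelBounds.

(** * Terms of the certificate along geodesics *)

Section Geodesic.
Variable R : realType.
Implicit Types (n : nat) (t c d y a b : R).

Definition geo a b t : R := a * cos t + b * sin t.

Lemma is_derive_geo a b t : is_derive t (1 : R) (geo a b) (geo b (- a) t).
Proof. by apply: is_derive_eq; rewrite /geo /GRing.scale/=; ring. Qed.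

Lemma geo0 a b : geo a b 0 = a.
Proof. by rewrite /geo cos0 sin0 mulr1 mulr0 addr0. Qed.

Lemma geoNN a b t : geo (- a) (- b) t = - geo a b t.
Proof. by rewrite /geo; ring. Qed.

Lemma is_derive_poly_geo (p : {poly R}) a b t :
  is_derive t (1 : R) (fun s => p.[geo a b s]) (p^`().[geo a b t] * geo b (- a) t).
Proof.
have h1 := is_derive_geo a b t; have h2 := is_derive_poly p (geo a b t).
exact: (@is_derive1_comp R (horner p) (geo a b)).
Qed.

(* A term of the certificate, as a function of [c = <P j, p>] and [l = <g j, p>].
   In [kterm'] and [kterm''], [d] and [m] are the derivatives of [c] and [l] along
   a unit-speed geodesic, whose own derivatives are then [- c] and [- l]. *)
Definition kterm n (c l : R) : R := c * l * (kerW R n).[c].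

Definition kterm' n (c d l m : R) : R :=
  (d * l + c * m) * (kerW R n).[c] + c * l * ((kerW R n)^`().[c] * d).

Definition kterm'' n (c d l m : R) : R :=
  2 * (d * m - c * l) * (kerW R n).[c] + 2 * (d * l + c * m) * ((kerW R n)^`().[c] * d)
  + c * l * ((kerW R n)^`()^`().[c] * d ^+ 2 - (kerW R n)^`().[c] * c).

Lemma is_derive_kterm n c d l m t :
  is_derive t (1 : R) (fun s => kterm n (geo c d s) (geo l m s))
    (kterm' n (geo c d t) (geo d (- c) t) (geo l m t) (geo m (- l) t)).
Proof.
rewrite /kterm; have hc := is_derive_geo c d t; have hl := is_derive_geo l m t.
have hW := is_derive_poly_geo (kerW R n) c d t.
by apply: is_derive_eq; rewrite /kterm' /GRing.scale/=; ring.
Qed.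

Lemma is_derive_kterm' n c d l m t :
  is_derive t (1 : R)
    (fun s => kterm' n (geo c d s) (geo d (- c) s) (geo l m s) (geo m (- l) s))
    (kterm'' n (geo c d t) (geo d (- c) t) (geo l m t) (geo m (- l) t)).
Proof.
rewrite /kterm'; have hc := is_derive_geo c d t; have hl := is_derive_geo l m t.
have hd := is_derive_geo d (- c) t; have hm := is_derive_geo m (- l) t.
have hW := is_derive_poly_geo (kerW R n) c d t.
have hW' := is_derive_poly_geo (kerW R n)^`() c d t.
by apply: is_derive_eq; rewrite /kterm'' !geoNN /GRing.scale/=; ring.
Qed.

Section Bounds.
Variables (n : nat) (A B y c d a b b' : R).
Hypotheses (n5 : (5 <= n)%N) (y0 : 0 < y)
  (hy : n%:R ^+ 2 * y ^+ 2 * (1 - c ^+ 2) = 1) (hd : d ^+ 2 <= 1 - c ^+ 2)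
  (ha : `|a| <= A) (hb : `|b| * y <= B) (hb' : `|b'| <= n%:R * B).

Let A0 : 0 <= A. Proof. exact: le_trans ha. Qed.
Let B0 : 0 <= B. Proof. by apply: le_trans hb; rewrite mulr_ge0 ?(ltW y0). Qed.
Let N5 : 5 <= n%:R :> R. Proof. by rewrite ler_nat. Qed.
Let c1 : `|c| <= 1.
Proof. by apply: sqr_le1_norm; rewrite -subr_ge0; apply: le_trans hd; rewrite sqr_ge0. Qed.
Let rho := (n%:R * y)^-1.
Let Ny : n%:R * y != 0.
Proof. by rewrite gt_eqF// mulr_gt0// (lt_le_trans _ N5). Qed.
Let rho0 : 0 <= rho.
Proof. by rewrite invr_ge0 mulr_ge0 ?(ltW y0). Qed.
Let rho2 : rho ^+ 2 = 1 - c ^+ 2.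
Proof.
by apply: (mulfI (expf_neq0 2 Ny)); rewrite -exprMn /rho mulfV// expr1n exprMn hy.
Qed.
Let rho1 : rho <= 1.
Proof.
by rewrite -[rho]ger0_norm ?rho0//; apply: sqr_le1_norm; rewrite rho2 gerBl sqr_ge0.
Qed.
Let Nyr : n%:R * y * rho = 1. Proof. exact: mulfV. Qed.
Let dr : `|d| <= rho.
Proof. by rewrite -[leRHS]ger0_norm// -ler_sqr ?nnegrE// !real_normK ?num_real// rho2. Qed.
Let br : `|b| <= n%:R * B * rho.
Proof.
have -> : `|b| = `|b| * y * (n%:R * rho).
  by transitivity (`|b| * (n%:R * y * rho)); [rewrite Nyr mulr1|ring].
rewrite (_ : n%:R * B * rho = B * (n%:R * rho)); last by ring.
by rewrite ler_wpM2r// mulr_ge0.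
Qed.
Let l1 : `|a * c + b| <= A + n%:R * B * rho.
Proof.
rewrite (le_trans (ler_normD _ _))// lerD// normrM.
by rewrite -[A]mulr1 ler_pM.
Qed.
Let m1 : `|a * d + b'| <= A * rho + n%:R * B.
Proof. by rewrite (le_trans (ler_normD _ _))// lerD// normrM ler_pM. Qed.
Let nB0 : 0 <= n%:R * B. Proof. by rewrite mulr_ge0. Qed.
Let cl1 : `|c * (a * c + b)| <= A + n%:R * B * rho.
Proof.
rewrite normrM; apply: le_trans l1; exact: ler_piMl.
Qed.
Let p1 : `|d * (a * c + b) + c * (a * d + b')| <= 2 * A * rho + 2 * (n%:R * B).
Proof.
rewrite (le_trans (ler_normD _ _))// !normrM.
have h1 : `|d| * `|a * c + b| <= rho * (A + n%:R * B * rho) by apply: ler_pM.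
have h2 : `|c| * `|a * d + b'| <= A * rho + n%:R * B.
  by apply: le_trans m1; exact: ler_piMl.
have h3 : n%:R * B * (rho * rho) <= n%:R * B.
  by rewrite ler_piMr// mulr_ile1.
by apply: le_trans (lerD h1 h2) _; lra.
Qed.
Let p2 : `|2 * (d * (a * d + b') - c * (a * c + b))| <= 4 * (A + n%:R * B * rho).
Proof.
rewrite normrM (@ger0_norm _ 2)//.
have h : `|d * (a * d + b') - c * (a * c + b)| <=
    rho * (A * rho + n%:R * B) + (A + n%:R * B * rho).
  by rewrite (le_trans (ler_normB _ _))// lerD// normrM ler_pM.
have h3 : A * (rho * rho) <= A by rewrite ler_piMr// mulr_ile1.
lra.
Qed.

Let KB := kernel_bounds (leq_trans (isT : 0 < 5)%N n5) y0 hy hd.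
Let y7 : 0 <= y ^+ 7. Proof. by rewrite exprn_ge0 ?(ltW y0). Qed.
Let y8 : 0 <= y ^+ 8. Proof. by rewrite exprn_ge0 ?(ltW y0). Qed.
Let yy := ltW y0.

(** [a] and [b] come from the radial and tangential parts of the coefficient. The latter is at most
    [n B rho = B / y], so that only [y ^ 7] is left of the kernel's [y ^ 8]. *)
Lemma kterm_bound : `|kterm n c (a * c + b)| <= (A * y + B) * y ^+ 7.
Proof.
rewrite /kterm normrM; have [h _ _] := KB.
apply: le_trans (ler_pM _ _ cl1 h) _ => //.
rewrite (_ : _ * y ^+ 8 = (A * y + B * (n%:R * y * rho)) * y ^+ 7); last by ring.
by rewrite Nyr mulr1.
Qed.

Lemma kterm'_bound : `|kterm' n c d (a * c + b) (a * d + b')| <=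
  n%:R * (A * (2 / 25 + (8 * y + 2) * y) + B * (2 * y + (8 * y + 2))) * y ^+ 7.
Proof.
have [h h1 _] := KB.
rewrite /kterm' (le_trans (ler_normD _ _))//.
rewrite 2!normrM; apply: le_trans (lerD (ler_pM _ _ p1 h) (ler_pM _ _ cl1 h1)) _ => //.
have -> : (2 * A * rho + 2 * (n%:R * B)) * y ^+ 8 +
  (A + n%:R * B * rho) * (n%:R * (8 * y + 2) * y ^+ 8) =
  (2 * A * (rho * y) + 2 * n%:R * B * y + n%:R * (8 * y + 2) *
     (A * y + B * (n%:R * y * rho))) * y ^+ 7 by ring.
rewrite ler_wpM2r// Nyr mulr1.
(* [rho * y] is [1 / n]; by [n >= 5] it is at most [n / 25], which makes the whole bound
   proportional to [n]. The fractions [4 / 25] in the bound of the second derivative arise in the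
   same way. *)
have h2 : rho * y <= n%:R / 25.
  rewrite -(@ler_pM2l _ (n%:R)) ?(lt_le_trans _ N5)//.
  have -> : n%:R * (rho * y) = 1 by transitivity (n%:R * y * rho); [ring|].
  have -> : n%:R * (n%:R / 25) = (n%:R / 5) * (n%:R / 5) :> R by field.
  by have := N5; nra.
have h3 : A * (rho * y) <= A * (n%:R / 25) by rewrite ler_wpM2l.
lra.
Qed.

Lemma kterm''_bound : `|kterm'' n c d (a * c + b) (a * d + b')| <=
  n%:R ^+ 2 * (A * ((4 / 25 + (72 * y ^+ 2 + 32 * y + 14)) * y + 4 / 25 * (8 * y + 2))
    + B * (4 / 25 + (72 * y ^+ 2 + 32 * y + 14) + 4 * (8 * y + 2) * y)) * y ^+ 7.
Proof.
have [h h1 h2] := KB.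
have n25 : 25 <= n%:R ^+ 2 :> R by have := N5; nra.
rewrite /kterm'' (le_trans (ler_normD _ _))//.
set C1 := 8 * y + 2 in h1 *; set C2 := 72 * y ^+ 2 + 32 * y + 14 in h2 *.
have C10 : 0 <= C1 by rewrite /C1; have := yy; lra.
apply: (@le_trans _ _ (4 * (A + n%:R * B * rho) * y ^+ 8 +
    2 * (2 * A * rho + 2 * (n%:R * B)) * (n%:R * C1 * y ^+ 8) +
    (A + n%:R * B * rho) * (n%:R ^+ 2 * C2 * y ^+ 8))).
  rewrite lerD//; last by rewrite normrM; apply: ler_pM.
  rewrite (le_trans (ler_normD _ _))// lerD//; first by rewrite normrM; apply: ler_pM.
  rewrite normrM; apply: ler_pM => //.
  by rewrite normrM (@ger0_norm _ 2)// ler_wpM2l.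
have -> : 4 * (A + n%:R * B * rho) * y ^+ 8 +
    2 * (2 * A * rho + 2 * (n%:R * B)) * (n%:R * C1 * y ^+ 8) +
    (A + n%:R * B * rho) * (n%:R ^+ 2 * C2 * y ^+ 8) =
   (4 * (A * y + B * (n%:R * y * rho)) + 4 * C1 * (A * (n%:R * y * rho) + n%:R ^+ 2 * B * y)
    + n%:R ^+ 2 * C2 * (A * y + B * (n%:R * y * rho))) * y ^+ 7 by ring.
rewrite ler_wpM2r// Nyr !mulr1.
have Ay : 0 <= A * y + B by rewrite addr_ge0 ?mulr_ge0.
have CA : 0 <= C1 * A by rewrite mulr_ge0.
have g1 : 4 * (A * y + B) <= n%:R ^+ 2 * (4 / 25 * (A * y + B)).
  rewrite -subr_ge0 (_ : _ - _ = (n%:R ^+ 2 - 25) * (4 / 25 * (A * y + B))); last by field.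
  by rewrite mulr_ge0 ?subr_ge0// mulr_ge0.
have g2 : 4 * (C1 * A) <= n%:R ^+ 2 * (4 / 25 * (C1 * A)).
  rewrite -subr_ge0 (_ : _ - _ = (n%:R ^+ 2 - 25) * (4 / 25 * (C1 * A))); last by field.
  by rewrite mulr_ge0 ?subr_ge0// mulr_ge0.
have -> : n%:R ^+ 2 * (A * ((4 / 25 + C2) * y + 4 / 25 * C1) +
    B * (4 / 25 + C2 + 4 * C1 * y)) =
  n%:R ^+ 2 * (4 / 25 * (A * y + B)) + n%:R ^+ 2 * (4 / 25 * (C1 * A))
  + 4 * C1 * n%:R ^+ 2 * B * y + n%:R ^+ 2 * C2 * (A * y + B) by ring.
lra.
Qed.

End Bounds.
End Geodesic.

(** * Cube packing *)

Lemma card_interior m : #|[set k : 'I_(2 * m.+1).+1 | (0 < k < 2 * m.+1)%N]| = (2 * m + 1)%N.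
Proof.
have -> : [set k : 'I_(2 * m.+1).+1 | (0 < k < 2 * m.+1)%N] = ~: [set ord0; ord_max].
  by apply/finset.setP => k; rewrite !inE -!val_eqE /=; have := ltn_ord k; lia.
by rewrite cardsCs finset.setCK cards2 card_ord -val_eqE /=; lia.
Qed.

(** Cubes at sup-distance exactly [m] from the centre, their coordinates shifted by [m] into
    [0 .. 2 m]: at least one coordinate is extreme. *)
Definition cube_shell m : {set 'I_(2 * m).+1 * 'I_(2 * m).+1 * 'I_(2 * m).+1} :=
  let A := [set k : 'I_(2 * m).+1 | (0 < k < 2 * m)%N] in ~: finset.setX (finset.setX A A) A.

(** With [k = m.+1] this is [(2 k + 1) ^ 3 - (2 k - 1) ^ 3]. *)
Lemma card_cube_shell m : #|cube_shell m.+1| = (24 * m.+1 ^ 2 + 2)%N.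
Proof.
rewrite /cube_shell cardsCs finset.setCK !cardsX card_interior !card_prod card_ord.
by rewrite !expnS expn0; nia.
Qed.

Section Levels.
Variable I : finType.

Definition level3 (z : I -> int * int * int) (i : I) : nat :=
  maxn (maxn `|(z i).1.1| `|(z i).1.2|) `|(z i).2|.

Lemma level_bound (a b c : int) m : maxn (maxn (absz a) (absz b)) (absz c) = m.+1 ->
  [/\ 0 <= a + m.+1%:Z /\ (absz (a + m.+1%:Z)%R < (2 * m.+1).+1)%N,
      0 <= b + m.+1%:Z /\ (absz (b + m.+1%:Z)%R < (2 * m.+1).+1)%N &
      0 <= c + m.+1%:Z /\ (absz (c + m.+1%:Z)%R < (2 * m.+1).+1)%N].
Proof. by move=> h; split; lia. Qed.

(** A shift of the coordinates embeds each level into a shell. Level 0 is kept apart because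
    [24 * 0 ^ 2 + 2] would count two cubes instead of one. *)
Lemma level3_card (P : pred I) (z : I -> int * int * int) m :
  {in P &, injective z} ->
  (#|[set i in P | level3 z i == m]| <= if m is 0 then 1 else 24 * m ^ 2 + 2)%N.
Proof.
case: m => [|m] zinj.
  rewrite leqNgt; apply/negP => /card_gt1P[i [j [+ + ij]]].
  rewrite !inE => /andP[iP /eqP i0] /andP[jP /eqP j0].
  case/eqP: ij; apply: zinj => //; move: i0 j0; rewrite /level3.
  case: (z i) => -[a b] c; case: (z j) => -[a' b'] c' /=.
  move=> h h'; have -> : a = a' by lia.
  have -> : b = b' by lia.
  by have -> : c = c' by lia.
rewrite -card_cube_shell.
pose h i : 'I_(2 * m.+1).+1 * 'I_(2 * m.+1).+1 * 'I_(2 * m.+1).+1 :=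
  (inord `|(z i).1.1 + m.+1%:Z|, inord `|(z i).1.2 + m.+1%:Z|, inord `|(z i).2 + m.+1%:Z|).
have inj : {in [set i in P | level3 z i == m.+1] &, injective h}.
  move=> i j; rewrite !inE => /andP[iP /eqP i0] /andP[jP /eqP j0] hij.
  apply: zinj => //; move: i0 j0 hij; rewrite /level3 /h.
  case: (z i) => -[a b] c; case: (z j) => -[a' b'] c' /= h1 h2.
  move: h1 h2 => /[dup] /level_bound[[a0 al] [b0 bl] [c0 cl]] _ /[dup] /level_bound[[a0' al'] [b0' bl'] [c0' cl']] _.
  have shiftI (x x' : int) : 0 <= x + m.+1%:Z -> 0 <= x' + m.+1%:Z ->
      absz (x + m.+1%:Z) = absz (x' + m.+1%:Z) -> x = x'.
    by move=> x0 x0' e; apply: (addIr m.+1%:Z); rewrite -(gez0_abs x0) -(gez0_abs x0') e.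
  move=> -[/(congr1 (@nat_of_ord _)) e1 /(congr1 (@nat_of_ord _)) e2 /(congr1 (@nat_of_ord _)) e3].
  rewrite !inordK// in e1 e2 e3.
  by rewrite (shiftI _ _ a0 a0' e1) (shiftI _ _ b0 b0' e2) (shiftI _ _ c0 c0' e3).
rewrite -(card_in_imset inj); apply: subset_leq_card.
apply/fintype.subsetP => _ /imsetP[i + ->]; rewrite !inE => /andP[iP /eqP].
rewrite /level3 /h; case: (z i) => -[a b] c /= h1.
by rewrite !inordK; lia.
Qed.

(** [K] only has to exceed the largest level that occurs; the right-hand side is later bounded
    uniformly in [K]. *)
Lemma sum_by_level (R : realFieldType) (P : pred I) (f : I -> R) (lv : I -> nat)
    (phi : nat -> R) (N : nat -> nat) :
  (forall i, P i -> f i <= phi (lv i)) -> (forall k, 0 <= phi k) ->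
  (forall k, (#|[set i in P | lv i == k]| <= N k)%N) ->
  exists K, \sum_(i | P i) f i <= \sum_(k < K) (N k)%:R * phi k.
Proof.
move=> fphi phi0 cN.
exists (\max_(i | P i) lv i).+1.
rewrite (partition_big (fun i => inord (lv i) : 'I_(\max_(i | P i) lv i).+1) xpredT)//=.
apply: ler_sum => k _.
have lvE i : P i -> (inord (lv i) == k) = (lv i == k).
  move=> Pi; rewrite -val_eqE /= inordK// ltnS.
  exact: (leq_bigmax_cond (F := lv)).
apply: (@le_trans _ _ (\sum_(i in [set i in P | lv i == k]) phi k)).
  rewrite [leLHS](eq_bigl (mem [set i in P | lv i == k])).
    by apply: ler_sum => i; rewrite !inE => /andP[Pi /eqP <-]; exact: fphi.
  move=> i /=; rewrite inE; case Pi : (P i) => /=; last by rewrite unfold_in Pi.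
  by rewrite lvE// unfold_in Pi.
rewrite sumr_const -[leLHS]mulr_natl ler_wpM2r// ler_nat; exact: cN.
Qed.

End Levels.

Section Tail.
Variable R : realType.

(** Comparison with a telescoping series. For [h = k - 1 / 2], the midpoint of [[k - 1, k]], the
    difference on the right is [h (4 h ^ 2 + 1) / (h ^ 2 - 1 / 4) ^ 4], close to [4 / h ^ 5]. The
    constant [39 / 5] lies just above [386 / 50], the ratio of [24 k ^ 2 + 2] to [4 h ^ 2 + 1] at
    [k = 4]. *)
Lemma shell_tail_step (k : nat) : (4 <= k)%N ->
  (24 * k%:R ^+ 2 + 2) / (k%:R - 1 / 2) ^+ 7 <=
    39 / 5 * ((k%:R - 1) ^- 4 - k%:R ^- 4) :> R.
Proof.
move=> k4; pose h : R := k%:R - 1 / 2.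
have h0 : 7 / 2 <= h by rewrite /h; have : 4 <= k%:R :> R; [rewrite ler_nat|lra].
have -> : k%:R = h + 1 / 2 :> R by rewrite /h; ring.
have -> : h + 1 / 2 - 1 / 2 = h by ring.
have -> : h + 1 / 2 - 1 = h - 1 / 2 by field.
have p1 : 0 < h ^+ 7 by rewrite exprn_gt0//; lra.
have p2 : 0 < (h ^+ 2 - 1 / 4) ^+ 4 by rewrite exprn_gt0//; nra.
have hp : h + 1 / 2 != 0 by rewrite lt0r_neq0//; lra.
have hm : h - 1 / 2 != 0 by rewrite lt0r_neq0//; lra.
rewrite ler_pdivrMr//.
have -> : 39 / 5 * ((h - 1 / 2) ^- 4 - (h + 1 / 2) ^- 4) * h ^+ 7 =
  39 / 5 * (4 * h ^+ 2 + 1) * h ^+ 8 / (h ^+ 2 - 1 / 4) ^+ 4.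
  have -> : h ^+ 2 - 1 / 4 = (h - 1 / 2) * (h + 1 / 2) by field.
  by field; apply/andP; split; rewrite lt0r_neq0//; lra.
rewrite ler_pdivlMr//.
apply: ler_pM; [nra|exact: ltW|nra|].
rewrite (exprM h 2 4) lerXn2r ?nnegrE ?sqr_ge0//; nra.
Qed.

(** The seventh power yields [128 / s ^ 7], and the telescoping sum from [k = 4] leaves at most
    [1 / 3 ^ 4 = 1 / 81]. *)
Lemma shell_tail (K : nat) (s : R) : 0 < s ->
  \sum_(4 <= k < K) (24 * k ^ 2 + 2)%N%:R * (2 / (s * (k%:R - 1 / 2))) ^+ 7
    <= 128 / s ^+ 7 * (39 / 5 / 81).
Proof.
move=> s0; have [K4|/ltnW K4] := leqP K 4.
  by rewrite big_geq// !mulr_ge0 ?invr_ge0 ?exprn_ge0 ?(ltW s0).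
apply: (@le_trans _ _ (128 / s ^+ 7 * (39 / 5 * (3 ^- 4 - (K%:R - 1) ^- 4)))); last first.
  rewrite ler_wpM2l ?mulr_ge0 ?invr_ge0 ?exprn_ge0 ?(ltW s0)//.
  have : 0 <= (K%:R - 1 : R) ^- 4.
    by rewrite invr_ge0 exprn_ge0// subr_ge0 ler1n; lia.
  lra.
elim: K K4 => // K IH; rewrite leq_eqVlt => /orP[/eqP <-|].
  rewrite big_geq// (_ : 4%:R - 1 = 3)//; last by ring.
  by rewrite subrr !mulr0.
rewrite ltnS => K4; rewrite big_nat_recr//=.
have := lerD (IH K4) (lexx ((24 * K ^ 2 + 2)%:R * (2 / (s * (K%:R - 1 / 2))) ^+ 7)).
move=> /le_trans; apply.
have -> : (24 * K ^ 2 + 2)%:R * (2 / (s * (K%:R - 1 / 2))) ^+ 7 =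
   128 / s ^+ 7 * ((24 * K%:R ^+ 2 + 2) / (K%:R - 1 / 2) ^+ 7) :> R.
  have k4 : 4 <= K%:R :> R by rewrite ler_nat.
  have k0 : K%:R * 2 - 1 != 0 :> R by rewrite lt0r_neq0//; lra.
  by rewrite natrD natrM natrX; field; rewrite ?k0 ?gt_eqF.
rewrite -mulrDr ler_wpM2l ?mulr_ge0 ?invr_ge0 ?exprn_ge0 ?(ltW s0)//.
have := shell_tail_step K4; rewrite -[K.+1%:R]natr1 addrK; lra.
Qed.

End Tail.

(** * Quaternions and stereographic projection *)

Section Quaternions.
Variable R : realType.
Implicit Types (u v p q : 'rV[R]_4).

Definition v4 (a b c d : R) : 'rV[R]_4 := \row_i nth 0 [:: a; b; c; d] i.

Definition dot u v : R := \sum_i u 0 i * v 0 i.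

Lemma v4_ind (P : 'rV[R]_4 -> Prop) : (forall a b c d, P (v4 a b c d)) -> forall u, P u.
Proof.
move=> H u; have -> // : u = v4 (u 0 0) (u 0 (lift 0 0)) (u 0 (lift 0 (lift 0 0)))
   (u 0 (lift 0 (lift 0 (lift 0 0)))).
apply/rowP => i; rewrite mxE; case: i => -[|[|[|[|//]]]] h /=; congr (u 0 _);
  exact: val_inj.
Qed.

Lemma dot_v4 a b c d a' b' c' d' :
  dot (v4 a b c d) (v4 a' b' c' d') = a * a' + b * b' + c * c' + d * d'.
Proof. by rewrite /dot !big_ord_recr big_ord0 /= !mxE /= add0r. Qed.

Lemma dotC u v : dot u v = dot v u.
Proof. by apply: eq_bigr => i _; rewrite mulrC. Qed.

Lemma dotDl u v w : dot (u + v) w = dot u w + dot v w.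
Proof. by rewrite -big_split; apply: eq_bigr => i _; rewrite mxE mulrDl. Qed.

Lemma dotZl a u v : dot (a *: u) v = a * dot u v.
Proof. by rewrite mulr_sumr; apply: eq_bigr => i _; rewrite mxE mulrA. Qed.

Lemma dotNl u v : dot (- u) v = - dot u v.
Proof. by rewrite -scaleN1r dotZl mulN1r. Qed.

Lemma dotDr u v w : dot w (u + v) = dot w u + dot w v.
Proof. by rewrite !(dotC w) dotDl. Qed.

Lemma dotZr a u v : dot v (a *: u) = a * dot v u.
Proof. by rewrite !(dotC v) dotZl. Qed.

Lemma dotNr u v : dot v (- u) = - dot v u.
Proof. by rewrite !(dotC v) dotNl. Qed.

Lemma dot_ge0 u : 0 <= dot u u.
Proof. by apply: sumr_ge0 => i _; rewrite -expr2 sqr_ge0. Qed.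

Lemma dot_eq0 u : dot u u = 0 -> u = 0.
Proof.
move=> /eqP; rewrite psumr_eq0 => [/allP h|i _]; last by rewrite -expr2 sqr_ge0.
apply/rowP => i; rewrite mxE; apply/eqP.
by have := h i (mem_index_enum i); rewrite /= mulf_eq0 orbb.
Qed.

Lemma dot_cauchy u v : dot u v ^+ 2 <= dot u u * dot v v.
Proof.
elim/v4_ind: u => a b c d; elim/v4_ind: v => a' b' c' d'; rewrite !dot_v4 -subr_ge0.
have -> : (a * a + b * b + c * c + d * d) * (a' * a' + b' * b' + c' * c' + d' * d') -
  (a * a' + b * b' + c * c' + d * d') ^+ 2 = (a * b' - b * a') ^+ 2 +
  (a * c' - c * a') ^+ 2 + (a * d' - d * a') ^+ 2 + (b * c' - c * b') ^+ 2 +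
  (b * d' - d * b') ^+ 2 + (c * d' - d * c') ^+ 2 by ring.
by rewrite !addr_ge0// sqr_ge0.
Qed.

(* [p], [frame 0 p], [frame 1 p], [frame 2 p] are the quaternions p, ip, jp, kp. *)
Definition frame (k : 'I_3) p : 'rV[R]_4 :=
  let: (a, b, c, d) := (p 0 0, p 0 (lift 0 0), p 0 (lift 0 (lift 0 0)),
    p 0 (lift 0 (lift 0 (lift 0 0)))) in
  match val k with 0 => v4 (- b) a (- d) c | 1 => v4 (- c) d a (- b)
  | _ => v4 (- d) (- c) b a end.

(** Parseval's identity in the orthogonal basis p, ip, jp, kp, whose members all have the norm of
    [p]. *)
Lemma frame_parseval p u v : dot p p * dot u v =
  dot p u * dot p v + \sum_k dot (frame k p) u * dot (frame k p) v.
Proof.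
elim/v4_ind: u => a b c d; elim/v4_ind: v => a' b' c' d'.
elim/v4_ind: p => p0 p1 p2 p3.
rewrite !big_ord_recr big_ord0 /= /frame /= !mxE /= !dot_v4; ring.
Qed.

End Quaternions.

Section Packing.
Variables (R : realType) (n : nat).
Hypothesis n5 : (5 <= n)%N.
Implicit Types (u v p : 'rV[R]_4).

(** Stereographic projection from the antipode [- p], in units of [1 / n]: a point at angle [t] from
    [p] goes to distance [2 n tan (t / 2)] from the origin. *)
Definition stereo p u (k : 'I_3) : R := 2 * n%:R * dot (frame k p) u / (1 + dot p u).

(** By conformality the squared distance is [n ^ 2] times the squared chord [2 (1 - dot u v)] times
    [4 / ((1 + dot p u) (1 + dot p v))], and the last factor is at least 1. So the nodes stay
    separated, whatever the centre [p]. *)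
Lemma stereo_dist p u v : dot p p = 1 -> dot u u = 1 -> dot v v = 1 ->
  0 <= dot p u -> 0 <= dot p v ->
  2 * n%:R ^+ 2 * (1 - dot u v) <= \sum_k (stereo p u k - stereo p v k) ^+ 2.
Proof.
move=> p1 u1 v1 pu pv.
have U := frame_parseval p u u; have V := frame_parseval p v v.
have UV := frame_parseval p u v; rewrite p1 !mul1r in U V UV.
have uv1 : dot u v <= 1.
  have := dot_cauchy u v; rewrite u1 v1 mulr1 => /sqr_le1_norm.
  by rewrite ler_norml => /andP[].
have -> : \sum_k (stereo p u k - stereo p v k) ^+ 2 = 4 * n%:R ^+ 2 *
  ((\sum_k dot (frame k p) u * dot (frame k p) u) / (1 + dot p u) ^+ 2 +
   (\sum_k dot (frame k p) v * dot (frame k p) v) / (1 + dot p v) ^+ 2 -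
   2 * (\sum_k dot (frame k p) u * dot (frame k p) v) / ((1 + dot p u) * (1 + dot p v))).
  rewrite !big_ord_recr !big_ord0 /= /stereo; field.
  by rewrite !gt_eqF// ltr_pwDl.
have {U}-> : \sum_k dot (frame k p) u * dot (frame k p) u = dot u u - dot p u * dot p u.
  by rewrite U addrAC subrr add0r.
have {V}-> : \sum_k dot (frame k p) v * dot (frame k p) v = dot v v - dot p v * dot p v.
  by rewrite V addrAC subrr add0r.
have {UV}-> : \sum_k dot (frame k p) u * dot (frame k p) v = dot u v - dot p u * dot p v.
  by rewrite UV addrAC subrr add0r.
rewrite u1 v1.
set a := dot p u in pu *; set b := dot p v in pv *; set g := dot u v in uv1 *.
have -> : 4 * n%:R ^+ 2 * ((1 - a * a) / (1 + a) ^+ 2 + (1 - b * b) / (1 + b) ^+ 2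
  - 2 * (g - a * b) / ((1 + a) * (1 + b))) =
  2 * n%:R ^+ 2 * (1 - g) * (4 / ((1 + a) * (1 + b))).
  by field; rewrite !gt_eqF// ltr_pwDl.
have a1 : a <= 1.
  have := dot_cauchy p u; rewrite p1 u1 mulr1 => /sqr_le1_norm.
  by rewrite ler_norml => /andP[].
have b1 : b <= 1.
  have := dot_cauchy p v; rewrite p1 v1 mulr1 => /sqr_le1_norm.
  by rewrite ler_norml => /andP[].
rewrite ler_peMr ?mulr_ge0 ?subr_ge0// ler_pdivlMr ?mulr_gt0 ?ltr_pwDl//.
nra.
Qed.

Lemma stereo_norm p u y : dot p p = 1 -> dot u u = 1 -> 0 <= dot p u -> 0 < y ->
  n%:R ^+ 2 * y ^+ 2 * (1 - dot p u ^+ 2) = 1 ->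
  \sum_k stereo p u k ^+ 2 = (2 / (y * (1 + dot p u))) ^+ 2.
Proof.
move=> p1 u1 pu y0 hy.
have U := frame_parseval p u u; rewrite p1 !mul1r in U.
have -> : \sum_k stereo p u k ^+ 2 = 4 * n%:R ^+ 2 *
  ((\sum_k dot (frame k p) u * dot (frame k p) u) / (1 + dot p u) ^+ 2).
  rewrite !big_ord_recr !big_ord0 /= /stereo; field.
  by rewrite !gt_eqF// ltr_pwDl.
have {U}-> : \sum_k dot (frame k p) u * dot (frame k p) u = dot u u - dot p u * dot p u.
  by rewrite U addrAC subrr add0r.
rewrite u1; have -> : (2 / (y * (1 + dot p u))) ^+ 2 = 4 *
    (n%:R ^+ 2 * y ^+ 2 * (1 - dot p u ^+ 2)) / (y ^+ 2 * (1 + dot p u) ^+ 2).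
  by rewrite hy; field; rewrite !gt_eqF// ltr_pwDl.
by field; rewrite !gt_eqF// ltr_pwDl.
Qed.

(** [Z = 2 n tan (t / 2)] is the norm of the projected point, and [y = 1 / (n sin t) = 1 / Z + Z /
    (4 n ^ 2)] decreases in [Z] up to [2 n], that is, on the whole hemisphere. The cruder second
    bound only uses [1 + a >= 1]. *)
Lemma stereo_tail (a y X : R) : 0 <= a -> a < 1 -> 0 < y ->
  n%:R ^+ 2 * y ^+ 2 * (1 - a ^+ 2) = 1 -> 0 < X -> X <= 2 / (y * (1 + a)) ->
  y <= X^-1 + X / (4 * n%:R ^+ 2) /\ y <= 2 / X.
Proof.
move=> a0 a1 y0 hy X0 XZ; set Z := 2 / _ in XZ.
have n0 : 0 < n%:R :> R by rewrite ltr0n (leq_trans _ n5).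
have a10 : 0 < 1 + a by rewrite ltr_pwDl.
have Z0 : 0 < Z by apply: lt_le_trans XZ.
have iZ : Z^-1 = y * (1 + a) / 2 by rewrite /Z; field; rewrite !gt_eqF.
have Zn : Z / (4 * n%:R ^+ 2) = y * (1 - a) / 2.
  transitivity (Z / (4 * n%:R ^+ 2) * (n%:R ^+ 2 * y ^+ 2 * (1 - a ^+ 2))).
    by rewrite hy mulr1.
  by rewrite /Z; field; rewrite !gt_eqF.
have yE : y = Z^-1 + Z / (4 * n%:R ^+ 2) by rewrite iZ Zn; field.
have iX : Z^-1 <= X^-1 by rewrite lef_pV2 ?posrE.
split; last by rewrite -[2 / X]/(2 * _); have : 2 * Z^-1 <= 2 * X^-1; [lra|rewrite iZ; nra].
rewrite yE.
have Z2n : Z * Z <= 4 * n%:R ^+ 2.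
  have : Z <= 4 * n%:R ^+ 2 * Z^-1.
    rewrite mulrC -ler_pdivrMr ?mulr_gt0 ?exprn_gt0// iZ Zn; nra.
  by rewrite ler_pdivlMr.
have ZXn : Z * X <= 4 * n%:R ^+ 2 by apply: le_trans Z2n; rewrite ler_wpM2l// ltW.
have -> : X^-1 + X / (4 * n%:R ^+ 2) = Z^-1 + Z / (4 * n%:R ^+ 2) +
   (Z - X) * ((Z * X)^-1 - (4 * n%:R ^+ 2)^-1).
  by field; rewrite !gt_eqF.
by rewrite lerDl mulr_ge0 ?subr_ge0// lef_pV2 ?posrE ?(mulr_gt0 Z0 X0) ?mulr_gt0 ?exprn_gt0.
Qed.

End Packing.

Section Cells.
Variable R : realType.
Implicit Types x s : R.

Definition cell s x : int := Num.floor (x / s + 1 / 2).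

Lemma cell_bounds s x : 0 < s ->
  s * ((cell s x)%:~R - 1 / 2) <= x < s * ((cell s x)%:~R + 1 / 2).
Proof.
move=> s0; have := floor_itv (x / s + 1 / 2); rewrite -/(cell s x) intrD.
set z : R := (cell s x)%:~R => /andP[h1 h2].
have xE : x = s * (x / s) by rewrite mulrC divfK// gt_eqF.
rewrite xE ler_pM2l// ltr_pM2l//; apply/andP; split; lra.
Qed.

Lemma cell_eq s x x' : 0 < s -> cell s x = cell s x' -> `|x - x'| < s.
Proof.
move=> s0 e; have := cell_bounds x s0; have := cell_bounds x' s0; rewrite e.
by rewrite ltr_norml => /andP[h1 h2] /andP[h3 h4]; apply/andP; split; lra.
Qed.

Lemma cell_ge s x (m : nat) : 0 < s -> (m <= `|cell s x|)%N -> s * (m%:R - 1 / 2) <= `|x|.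
Proof.
move=> s0 hm; have /andP[h1 h2] := cell_bounds x s0; rewrite ler_normr.
have [c0|c0] := leP 0 (cell s x).
  apply/orP; left; apply: le_trans h1; rewrite ler_pM2l// lerD2r.
  by rewrite -[leLHS]/((Posz m)%:~R) ler_int; lia.
apply/orP; right; rewrite lerNr ltW// (lt_le_trans h2)//.
rewrite -mulrN ler_pM2l// opprB addrC lerD2l.
by rewrite -[X in - X]/((Posz m)%:~R) -intrN ler_int; lia.
Qed.

End Cells.

Section PackingSum.
Variables (R : realType) (n : nat).
Hypothesis n5 : (5 <= n)%N.
Implicit Types (p : 'rV[R]_4).

(** Side of the cubes, just below the largest value that the estimate behind [separation_cells]
    allows: two points in one cube are less than [s] times the square root of 3 apart. *)
Let s : R := 239 / 100.
Let s0 : 0 < s. Proof. by rewrite /s; lra. Qed.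

(* Bounds for [y ^+ 7] at a point whose cell is at sup-distance [k] from the
   origin; the constants for [k = 2, 3] evaluate the first bound of [stereo_tail]
   at [X = s * (k - 1 / 2)], and the last case is the second bound. *)
Definition shell_weight (y0 : R) (k : nat) : R :=
  match k with
  | 0 | 1 => y0 ^+ 7
  | 2 => (63 / 200) ^+ 7
  | 3 => (57 / 250) ^+ 7
  | _ => (2 / (s * (k%:R - 1 / 2))) ^+ 7
  end.

Lemma shell_weight_ge0 y0 k : 0 <= y0 -> 0 <= shell_weight y0 k.
Proof.
move=> y00; case: k => [|[|[|[|k]]]] /=; apply: exprn_ge0 => //; try lra.
rewrite mulr_ge0// invr_ge0 mulr_ge0 ?(ltW s0)// subr_ge0.
have : 1 <= k.+4%:R :> R by rewrite ler1n.
lra.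
Qed.

(** [27] counts the central cube and the 26 around it. Shells 2 and 3, with 98 and 218 cubes, and
    the tail together stay below [13 / 200]. *)
Lemma shell_weight_sum y0 K : 0 <= y0 ->
  \sum_(k < K) (if val k is 0 then 1 else 24 * k ^ 2 + 2)%N%:R * shell_weight y0 k
  <= 27 * y0 ^+ 7 + 13 / 200.
Proof.
move=> y00; pose F k : R := (if k is 0 then 1 else 24 * k ^ 2 + 2)%N%:R * shell_weight y0 k.
have F0 k : 0 <= F k by rewrite mulr_ge0// shell_weight_ge0.
apply: (@le_trans _ _ (\sum_(0 <= k < K.+4) F k)).
  rewrite -(big_mkord xpredT F) [leRHS](@big_cat_nat _ _ _ K)//=; last by lia.
  by rewrite lerDl sumr_ge0.
rewrite big_ltn// big_ltn// big_ltn// big_ltn//.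
have -> : \sum_(4 <= k < K.+4) F k =
    \sum_(4 <= k < K.+4) (24 * k ^ 2 + 2)%N%:R * (2 / (s * (k%:R - 1 / 2))) ^+ 7.
  by apply: eq_big_nat => -[|[|[|[|k]]]].
have := shell_tail K.+4 s0; set S := \sum_(_ <= _ < _) _.
have s7 : 128 / s ^+ 7 * (39 / 5 / 81) <= 139 / 5000.
  rewrite (_ : _ * _ = 128 * (39 / 5 / 81) / s ^+ 7); last by ring.
  by rewrite ler_pdivrMr ?exprn_gt0// /s; lra.
have n2 : (63 / 200) ^+ 7 <= 3078 / (10 * 1000 * 1000) :> R by lra.
have n3 : (57 / 250) ^+ 7 <= 3204 / (100 * 1000 * 1000) :> R by lra.
rewrite /F /= !mul1r => h.
rewrite (_ : (24 * 1 ^ 2 + 2)%N = 26%N)// (_ : (24 * 2 ^ 2 + 2)%N = 98%N)//.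
rewrite (_ : (24 * 3 ^ 2 + 2)%N = 218%N)//.
move: n2 n3 s7 h; set a := (63 / 200) ^+ 7; set b := (57 / 250) ^+ 7; set c := 128 / _ * _.
lra.
Qed.

(* Choosing the sign of each [u i] so that it lies in the hemisphere around [p], the
   stereographic images are so far apart that each cube of side [s] contains at
   most one of them, and there are [24 * k ^ 2 + 2] cubes at sup-distance [k]. *)
Lemma packing_sum (I : finType) (P : pred I) (u : I -> 'rV[R]_4) p (y : I -> R) (y0 kappa : R) :
  dot p p = 1 -> (forall i, P i -> dot (u i) (u i) = 1) ->
  (forall i j, P i -> P j -> i != j -> `|dot (u i) (u j)| <= kappa) ->
  3 * (239 / 100) ^+ 2 <= 2 * n%:R ^+ 2 * (1 - kappa) -> 0 <= y0 ->
  (forall i, P i -> [/\ 0 < y i, n%:R ^+ 2 * y i ^+ 2 * (1 - dot p (u i) ^+ 2) = 1 & y i <= y0]) ->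
  \sum_(i | P i) y i ^+ 7 <= 27 * y0 ^+ 7 + 13 / 200.
Proof.
move=> p1 u1 sep hs y00 hy.
pose v i := if 0 <= dot p (u i) then u i else - u i.
have v0 i : 0 <= dot p (v i).
  by rewrite /v; case: ifPn => //; rewrite -ltNge dotNr oppr_ge0 => /ltW.
have v1 i : P i -> dot (v i) (v i) = 1.
  by move=> Pi; rewrite /v; case: ifP => _; rewrite ?dotNr ?dotNl ?opprK u1.
have v2 i : dot p (v i) ^+ 2 = dot p (u i) ^+ 2.
  by rewrite /v; case: ifP => _; rewrite ?dotNr ?sqrrN.
have v3 i j : `|dot (v i) (v j)| = `|dot (u i) (u j)|.
  by rewrite /v; case: ifP => _; case: ifP => _; rewrite ?dotNr ?dotNl ?normrN.
pose X i := stereo n p (v i).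
pose z i := (cell s (X i 0), cell s (X i 1), cell s (X i 2)).
have hyv i : P i -> n%:R ^+ 2 * y i ^+ 2 * (1 - dot p (v i) ^+ 2) = 1.
  by move=> Pi; rewrite v2; case: (hy i Pi).
(* Two nodes in one cube would be at squared distance below [3 * s ^ 2], against [stereo_dist] and
   the separation. *)
have zinj : {in P &, injective z}.
  move=> i j Pi Pj [e0 e1 e2]; apply/eqP; apply: contraT => ij.
  have := stereo_dist n p1 (v1 i Pi) (v1 j Pj) (v0 i) (v0 j).
  have := sep i j Pi Pj ij; rewrite -v3 ler_norml => /andP[_ hk].
  have c0 := cell_eq s0 e0; have c1 := cell_eq s0 e1; have c2 := cell_eq s0 e2.
  have sq (a : R) : `|a| < s -> a ^+ 2 < s ^+ 2.
    by move=> ha; rewrite -[a ^+ 2]real_normK ?num_real// ltrXn2r ?nnegrE ?(ltW s0).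
  rewrite !big_ord_recr big_ord0 /= add0r.
  have -> : widen_ord (leqnSn 2) (widen_ord (leqnSn 1) ord_max) = 0 by exact: val_inj.
  have -> : widen_ord (leqnSn 2) ord_max = 1 by exact: val_inj.
  have -> : @ord_max 2 = 2 by exact: val_inj.
  have := sq _ c0; have := sq _ c1; have := sq _ c2; rewrite -/s in hs.
  have : 2 * n%:R ^+ 2 * (1 - kappa) <= 2 * n%:R ^+ 2 * (1 - dot (v i) (v j)).
    by rewrite ler_wpM2l ?mulr_ge0 ?sqr_ge0//; lra.
  rewrite /X; lra.
have fphi i : P i -> y i ^+ 7 <= shell_weight y0 (level3 z i).
  move=> Pi; have [yi0 _ yiy] := hy i Pi.
  have mono a : y i <= a -> y i ^+ 7 <= a ^+ 7.
    by move=> ya; rewrite lerXn2r ?nnegrE ?(ltW yi0)// (le_trans (ltW yi0)).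
  have up := mono _ yiy.
  have [lv2|//] := leqP 2 (level3 z i); last by case: (level3 z i) => [|[|]].
  have dist m : (m <= level3 z i)%N -> (1 <= m)%N -> s * (m%:R - 1 / 2) <= 2 / (y i * (1 + dot p (v i))).
    move=> mz m1; have Z0 : 0 <= 2 / (y i * (1 + dot p (v i))).
      by rewrite mulr_ge0// invr_ge0 mulr_ge0 ?(ltW yi0)// addr_ge0.
    have sm0 : 0 <= s * (m%:R - 1 / 2).
      rewrite mulr_ge0 ?(ltW s0)//; have : 1 <= m%:R :> R by rewrite ler1n.
      lra.
    rewrite -ler_sqr ?nnegrE// -(stereo_norm p1 (v1 i Pi) (v0 i) yi0 (hyv i Pi)).
    have [k mk] : exists k, (m <= `|cell s (X i k)|)%N.
      move: mz; rewrite /level3 /z /= !leq_max => /orP[/orP[]|] ?;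
      [by exists 0|by exists 1|by exists 2].
    apply: (@le_trans _ _ (X i k ^+ 2)).
      by rewrite -[leRHS]real_normK ?num_real// ler_sqr ?nnegrE// cell_ge.
    by rewrite (bigD1 k)//= lerDl sumr_ge0// => ? _; rewrite sqr_ge0.
  have v11 : dot p (v i) < 1.
    have := hyv i Pi; have := v0 i; move: (dot p (v i)) => a a0 e.
    rewrite ltNge; apply/negP => a1; suff : n%:R ^+ 2 * y i ^+ 2 * (1 - a ^+ 2) <= 0 by rewrite e; lra.
    rewrite mulr_ge0_le0 ?mulr_ge0 ?sqr_ge0//; nra.
  have n25 : 25 <= n%:R ^+ 2 :> R.
    have : 5 <= n%:R :> R by rewrite ler_nat.
    nra.
  (* As [n >= 5], the term [X / (4 n ^ 2)] of [stereo_tail] is at most [X / 100], which is how it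
     enters [63 / 200] and [57 / 250]. *)
  have n100 : (4 * n%:R ^+ 2)^-1 <= 100^-1 :> R.
    have n0 : 0 < 4 * n%:R ^+ 2 :> R by lra.
    by rewrite lef_pV2 ?posrE//; lra.
  have tail m : (2 <= m)%N -> (m <= level3 z i)%N ->
      y i <= (s * (m%:R - 1 / 2))^-1 + s * (m%:R - 1 / 2) / 100 /\ y i <= 2 / (s * (m%:R - 1 / 2)).
    move=> m2 ml; have X0 : 0 < s * (m%:R - 1 / 2).
      rewrite mulr_gt0//; have : 1 <= m%:R :> R by rewrite ler1n ltnW.
      lra.
    have [t1 t2] := stereo_tail n5 (v0 i) v11 yi0 (hyv i Pi) X0 (dist m ml (ltnW m2)).
    split => //; apply: le_trans t1 _; rewrite lerD2l ler_wpM2l// ltW//.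
  case E : (level3 z i) => [|[|[|[|k]]]]; try by rewrite E in lv2.
  - have [t _] := tail 2 isT lv2.
    apply: mono; apply: le_trans t _.
    rewrite (_ : s * (2%:R - 1 / 2) = 717 / 200); [rewrite invf_div; lra|by rewrite /s; field].
  - have [t _] := tail 3 isT (eq_leq (esym E)).
    apply: mono; apply: le_trans t _.
    rewrite (_ : s * (3%:R - 1 / 2) = 239 / 40); [rewrite invf_div; lra|by rewrite /s; field].
  have [_ t] := tail k.+4 isT (eq_leq (esym E)).
  exact: mono.
have [K] := sum_by_level fphi (fun k => shell_weight_ge0 k y00) (fun k => level3_card k zinj).
by move=> /le_trans; apply; apply: shell_weight_sum.
Qed.

End PackingSum.

(** * The dual certificate *)

Section FarSums.
Variables (R : realType) (M n : nat) (P : 'I_M -> 'rV[R]_4) (Delta : R).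
Hypotheses (n5 : (5 <= n)%N) (P1 : forall i, dot (P i) (P i) = 1)
  (D0 : 0 < Delta) (D1 : Delta <= 6 / 7) (nD : 30 / 7 <= n%:R * Delta)
  (sep : forall i j, i != j -> `|dot (P i) (P j)| <= cos Delta).
Implicit Types (p u e : 'rV[R]_4) (g : 'M[R]_(M, 4)).

Let N0 : 0 < n%:R :> R. Proof. by rewrite ltr0n (leq_trans _ n5). Qed.
Let N5 : 5 <= n%:R :> R. Proof. by rewrite ler_nat. Qed.

Lemma sin_lb (phi : R) : 0 <= phi -> phi <= 6 / 7 -> 43 / 49 * phi <= sin phi.
Proof.
move=> p0 p1; apply: le_trans (sin_ge_taylor3 p0).
have h : phi ^+ 2 <= 36 / 49 by nra.
have : phi * phi ^+ 2 <= phi * (36 / 49) by rewrite ler_wpM2l.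
by rewrite (exprS phi 2); lra.
Qed.

Lemma half_sin_lb : (1 - 3 / 98) * (15 / 7) <= n%:R * sin (Delta / 2).
Proof.
move: (D0) (D1) (nD) => D0' D1' nD'; have h0 : 0 <= Delta / 2 by lra.
have h : (1 - 3 / 98) * (Delta / 2) <= sin (Delta / 2).
  apply: le_trans (sin_ge_taylor3 h0).
  have h2 : (Delta / 2) ^+ 2 <= 9 / 49 by nra.
  have : Delta / 2 * (Delta / 2) ^+ 2 <= Delta / 2 * (9 / 49) by rewrite ler_wpM2l.
  by rewrite (exprS (Delta / 2) 2); lra.
have : n%:R * ((1 - 3 / 98) * (Delta / 2)) <= n%:R * sin (Delta / 2) by rewrite ler_pM2l.
lra.
Qed.

Lemma separation_cells : 3 * (239 / 100) ^+ 2 <= 2 * n%:R ^+ 2 * (1 - cos Delta).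
Proof.
have -> : 1 - cos Delta = 2 * sin (Delta / 2) ^+ 2.
  by rewrite {1}(splitr Delta) cosD -!expr2 cos2sin2; ring.
have h1 := half_sin_lb.
have -> : 2 * n%:R ^+ 2 * (2 * sin (Delta / 2) ^+ 2) = 4 * (n%:R * sin (Delta / 2)) ^+ 2.
  by ring.
set z := n%:R * _ in h1 *; nra.
Qed.

(** Cauchy-Schwarz for the part of [v] orthogonal to [p]. For a node [v] it bounds the derivative of
    [dot v p] in the direction [u] by the sine of the angle to that node. *)
Lemma bessel2 p u v : dot p p = 1 -> dot u u = 1 -> dot p u = 0 -> dot v v = 1 ->
  dot v u ^+ 2 <= 1 - dot v p ^+ 2.
Proof.
move=> p1 u1 pu v1; have := dot_cauchy (v - dot v p *: p) u.
rewrite !(dotDl, dotDr, dotNl, dotNr, dotZl, dotZr) p1 u1 pu v1 (dotC p v).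
by rewrite !mulr0 subr0 !mulr1 => /le_trans; apply; rewrite expr2; lra.
Qed.

Lemma dot_tangent p u e : dot p p = 1 -> dot u u = 1 -> dot e p = 0 ->
  dot e u ^+ 2 <= dot e e * (1 - dot p u ^+ 2).
Proof.
move=> p1 u1 ep; have := dot_cauchy e (u - dot p u *: p).
rewrite !(dotDl, dotDr, dotNl, dotNr, dotZl, dotZr) p1 u1 ep (dotC u p).
by rewrite mulr0 subr0 mulr1 => /le_trans; apply; rewrite ler_wpM2l ?dot_ge0// expr2; lra.
Qed.

(** At its own node the term of [j] has value [coefA] and tangential gradient [coefE], which is why
    these two parts of [row j g] are bounded separately. *)
Definition coefA g j : R := dot (row j g) (P j).
Definition coefE g j : 'rV[R]_4 := row j g - coefA g j *: P j.

Lemma coefE_orth g j : dot (coefE g j) (P j) = 0.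
Proof. by rewrite /coefE dotDl dotNl dotZl P1 mulr1 subrr. Qed.

Lemma coef_dot g j p : dot (row j g) p = coefA g j * dot (P j) p + dot (coefE g j) p.
Proof. by rewrite /coefE dotDl dotNl dotZl addrC subrK. Qed.

(** The hypothesis on [J] says [y j <= y0] without division. Each bound on a term is an increasing
    function of [y j] times [y j ^ 7]: the function is replaced by its value at [y0], and the powers
    are summed by [packing_sum]. *)
Lemma far_sums (J : pred 'I_M) g p u (A B y0 : R) :
  dot p p = 1 -> dot u u = 1 -> dot p u = 0 -> 0 < y0 ->
  0 <= A -> (forall j, `|coefA g j| <= A) -> 0 <= B ->
  (forall j, dot (coefE g j) (coefE g j) <= (n%:R * B) ^+ 2) ->
  (forall j, J j -> 1 <= n%:R ^+ 2 * y0 ^+ 2 * (1 - dot (P j) p ^+ 2)) ->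
  [/\ \sum_(j | J j) `|kterm n (dot (P j) p) (dot (row j g) p)| <=
        (A * y0 + B) * (27 * y0 ^+ 7 + 13 / 200),
      \sum_(j | J j) `|kterm' n (dot (P j) p) (dot (P j) u) (dot (row j g) p) (dot (row j g) u)|
        <= n%:R * (A * (2 / 25 + (8 * y0 + 2) * y0) + B * (2 * y0 + (8 * y0 + 2)))
           * (27 * y0 ^+ 7 + 13 / 200) &
      \sum_(j | J j) `|kterm'' n (dot (P j) p) (dot (P j) u) (dot (row j g) p) (dot (row j g) u)|
        <= n%:R ^+ 2 * (A * ((4 / 25 + (72 * y0 ^+ 2 + 32 * y0 + 14)) * y0
              + 4 / 25 * (8 * y0 + 2))
          + B * (4 / 25 + (72 * y0 ^+ 2 + 32 * y0 + 14) + 4 * (8 * y0 + 2) * y0))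
          * (27 * y0 ^+ 7 + 13 / 200)].
Proof.
move=> p1 u1 pu y00 A0 hA B0 hE hJ.
pose y j := (n%:R * Num.sqrt (1 - dot (P j) p ^+ 2))^-1.
have c2 j : J j -> 0 < 1 - dot (P j) p ^+ 2.
  move=> /hJ h; have : 0 < n%:R ^+ 2 * y0 ^+ 2 by rewrite mulr_gt0// exprn_gt0.
  move: h; set a := _ * y0 ^+ 2; move=> h a0; rewrite -(pmulr_rgt0 _ a0).
  by apply: lt_le_trans h.
have yp j : J j -> 0 < y j by move=> Jj; rewrite invr_gt0 mulr_gt0// sqrtr_gt0 c2.
have hy j : J j -> n%:R ^+ 2 * y j ^+ 2 * (1 - dot (P j) p ^+ 2) = 1.
  move=> Jj; rewrite /y exprVn exprMn sqr_sqrtr ?ltW ?c2//.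
  by rewrite mulrAC mulfV// gt_eqF// mulr_gt0 ?exprn_gt0 ?c2.
have yy0 j : J j -> y j <= y0.
  move=> Jj; have : n%:R ^+ 2 * y j ^+ 2 * (1 - dot (P j) p ^+ 2) <=
      n%:R ^+ 2 * y0 ^+ 2 * (1 - dot (P j) p ^+ 2) by rewrite hy// hJ.
  rewrite ler_pM2r ?c2// ler_pM2l ?exprn_gt0//.
  by rewrite ler_sqr ?nnegrE ?(ltW y00) ?(ltW (yp j Jj)).
have S7 : \sum_(j | J j) y j ^+ 7 <= 27 * y0 ^+ 7 + 13 / 200.
  apply: (packing_sum n5 p1 (fun j _ => P1 j) (fun i j _ _ => @sep i j) separation_cells (ltW y00)).
  by move=> j Jj; rewrite dotC; split; [exact: yp|exact: hy|exact: yy0].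
have key j : J j -> [/\ dot (P j) u ^+ 2 <= 1 - dot (P j) p ^+ 2,
    `|dot (coefE g j) p| * y j <= B & `|dot (coefE g j) u| <= n%:R * B].
  move=> Jj; have nB : 0 <= n%:R * B by rewrite mulr_ge0// ltW.
  split; first exact: bessel2.
    rewrite -ler_sqr ?nnegrE ?mulr_ge0 ?(ltW (yp _ Jj))//.
    rewrite exprMn real_normK ?num_real//.
    have := dot_tangent (P1 j) p1 (coefE_orth g j).
    set z := dot (coefE g j) p ^+ 2 => hz.
    have hz2 : z <= (n%:R * B) ^+ 2 * (1 - dot (P j) p ^+ 2).
      by apply: le_trans hz _; rewrite ler_wpM2r// ltW// c2.
    have -> : B ^+ 2 = (n%:R * B) ^+ 2 * (1 - dot (P j) p ^+ 2) * y j ^+ 2.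
      transitivity (B ^+ 2 * (n%:R ^+ 2 * y j ^+ 2 * (1 - dot (P j) p ^+ 2))); last by ring.
      by rewrite hy// mulr1.
    by rewrite ler_wpM2r// sqr_ge0.
  rewrite -ler_sqr ?nnegrE// real_normK ?num_real//.
  by have := dot_cauchy (coefE g j) u; rewrite u1 mulr1 => /le_trans; apply.
have toS (F : 'I_M -> R) (C : R) : 0 <= C -> (forall j, J j -> F j <= C * y j ^+ 7) ->
    \sum_(j | J j) F j <= C * (27 * y0 ^+ 7 + 13 / 200).
  move=> C0 FC; apply: (@le_trans _ _ (\sum_(j | J j) C * y j ^+ 7)); first exact: ler_sum.
  by rewrite -mulr_sumr ler_wpM2l.
have y0' := ltW y00.
have q0 : 0 <= 72 * y0 ^+ 2 + 32 * y0 + 14 by rewrite !addr_ge0 ?mulr_ge0 ?exprn_ge0.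
have q1 : 0 <= 8 * y0 + 2 by lra.
have mono j : J j -> 72 * y j ^+ 2 + 32 * y j + 14 <= 72 * y0 ^+ 2 + 32 * y0 + 14.
  move=> Jj; have y1 := yy0 j Jj; have y2 : y j ^+ 2 <= y0 ^+ 2.
    by rewrite ler_sqr ?nnegrE ?(ltW (yp _ Jj)).
  lra.
have y7 j : J j -> 0 <= y j ^+ 7 by move=> Jj; rewrite exprn_ge0 ?ltW ?yp.
split; apply: toS => [|j Jj].
- by rewrite addr_ge0 ?mulr_ge0.
- have [h1 h2 h3] := key j Jj; rewrite (coef_dot g j p).
  apply: le_trans (kterm_bound n5 (yp j Jj) (hy j Jj) h1 (hA j) h2) _.
  by rewrite ler_wpM2r ?y7// lerD2r ler_wpM2l// yy0.
- by rewrite mulr_ge0 ?(ltW N0)// addr_ge0// mulr_ge0// !addr_ge0 ?mulr_ge0.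
- have [h1 h2 h3] := key j Jj; rewrite (coef_dot g j p) (coef_dot g j u).
  apply: le_trans (kterm'_bound n5 (yp j Jj) (hy j Jj) h1 (hA j) h2 h3) _.
  have y1 := yy0 j Jj; have yj := ltW (yp j Jj).
  rewrite ler_wpM2r ?y7// ler_wpM2l ?(ltW N0)// lerD// ler_wpM2l//; last by lra.
  by rewrite lerD2l ler_pM//; lra.
- rewrite mulr_ge0 ?exprn_ge0 ?(ltW N0)// addr_ge0// mulr_ge0//.
    by rewrite addr_ge0// mulr_ge0// addr_ge0.
  by rewrite !addr_ge0// !mulr_ge0.
have [h1 h2 h3] := key j Jj; rewrite (coef_dot g j p) (coef_dot g j u).
apply: le_trans (kterm''_bound n5 (yp j Jj) (hy j Jj) h1 (hA j) h2 h3) _.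
have y1 := yy0 j Jj; have yj := ltW (yp j Jj); have m1 := mono j Jj.
have q0j : 0 <= 72 * y j ^+ 2 + 32 * y j + 14 by rewrite !addr_ge0 ?mulr_ge0 ?exprn_ge0.
rewrite ler_wpM2r ?y7// ler_wpM2l ?exprn_ge0 ?(ltW N0)// lerD// ler_wpM2l//.
  rewrite lerD//; last by lra.
  by apply: ler_pM => //; lra.
rewrite lerD//; first by lra.
by apply: ler_pM => //; lra.
Qed.

End FarSums.

(** * The interpolation system *)

Section System.
Variables (R : realType) (M n : nat) (P : 'I_M -> 'rV[R]_4).
Implicit Types (p u e : 'rV[R]_4) (g : 'M[R]_(M, 4)).

(* Even in every [P j] and in [p], so it only depends on rotations; the vector
   [row j g] leaves four degrees of freedom at [P j], as many as the value and the
   tangential gradient to be prescribed there. *)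
Definition certificate g p : R :=
  \sum_j kterm n (dot (P j) p) (dot (row j g) p).

Definition certificate' g p u : R :=
  \sum_j kterm' n (dot (P j) p) (dot (P j) u) (dot (row j g) p) (dot (row j g) u).

Lemma kterm_lin c a l l' : kterm n c (a * l + l') = a * kterm n c l + kterm n c l' :> R.
Proof. by rewrite /kterm; ring. Qed.

Lemma kterm'_lin c d a l l' m m' :
  kterm' n c d (a * l + l') (a * m + m') = a * kterm' n c d l m + kterm' n c d l' m' :> R.
Proof. by rewrite /kterm'; ring. Qed.

Definition interp g : 'M[R]_(M, 4) :=
  \matrix_(i, k) if unlift ord0 k is Some k' then certificate' g (P i) (frame k' (P i))
                 else certificate g (P i).

Lemma dot_rowP a g h j u : dot (row j (a *: g + h)) u = a * dot (row j g) u + dot (row j h) u.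
Proof. by rewrite linearP /= dotDl dotZl. Qed.

Lemma interp_linear : linear interp.
Proof.
move=> a g h; apply/matrixP => i k; rewrite !mxE; case: unliftP => [k'|] _.
  rewrite /certificate' mulr_sumr -big_split; apply: eq_bigr => j _.
  by rewrite !dot_rowP kterm'_lin.
rewrite /certificate mulr_sumr -big_split; apply: eq_bigr => j _.
by rewrite !dot_rowP kterm_lin.
Qed.

HB.instance Definition _ := GRing.isLinear.Build R _ _ _ interp interp_linear.

Lemma frame_expand p u : dot p p = 1 -> dot u p = 0 ->
  u = \sum_k dot (frame k p) u *: frame k p.
Proof.
move=> p1 up.
suff : dot p p *: u = dot u p *: p + \sum_k dot (frame k p) u *: frame k p.
  by rewrite p1 up scale1r scale0r add0r.
elim/v4_ind: u {up} => a b c d; elim/v4_ind: p {p1} => p0 p1 p2 p3.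
rewrite !big_ord_recr big_ord0 /= /frame /= !mxE /= !dot_v4.
by apply/rowP => i; rewrite !mxE; case: i => -[|[|[|[|//]]]] h /=; ring.
Qed.

Lemma certificate'_frame g p : dot p p = 1 ->
  (forall k, certificate' g p (frame k p) = 0) -> forall u, dot u p = 0 -> certificate' g p u = 0.
Proof.
move=> p1 h u up.
have -> : certificate' g p u = \sum_k dot (frame k p) u * certificate' g p (frame k p).
  rewrite /certificate'.
  under [RHS]eq_bigr do rewrite mulr_sumr.
  rewrite exchange_big; apply: eq_bigr => j _ /=.
  rewrite [in LHS](frame_expand p1 up) !big_ord_recr !big_ord0 /= !add0r.
  by rewrite !dotDr !dotZr /kterm'; ring.
by rewrite big1// => k _; rewrite h mulr0.
Qed.

Lemma frame_orth k p : dot (frame k p) p = 0.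
Proof.
elim/v4_ind: p => a b c d; rewrite /frame !mxE /=.
by case: k => -[|[|[|//]]] h /=; rewrite dot_v4; ring.
Qed.

Lemma frame_unit k p : dot (frame k p) (frame k p) = dot p p.
Proof.
elim/v4_ind: p => a b c d; rewrite /frame !mxE /=.
by case: k => -[|[|[|//]]] h /=; rewrite !dot_v4; ring.
Qed.

(** The system is square, [4 M] equations in the [4 M] entries of [g], so injectivity gives
    solvability. The three frame derivatives at a node determine the derivative in every tangent
    direction. *)
Lemma interp_solve : injective interp -> forall v : 'I_M -> R,
  exists g, forall i, certificate g (P i) = v i /\
    (dot (P i) (P i) = 1 -> forall u, dot u (P i) = 0 -> certificate' g (P i) u = 0).
Proof.
move=> inj v; pose A := lin_mx interp.
have uA : A \in unitmx.
  rewrite -row_free_unit; apply: inj_row_free => w; rewrite mul_rV_lin => w0.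
  have : interp (vec_mx w) = interp 0.
    by rewrite linear0; apply: (can_inj mxvecK); rewrite w0 linear0.
  by move=> /inj e; rewrite -[w]vec_mxK e linear0.
pose b := \matrix_(i < M, k < 4) if unlift ord0 k is Some _ then 0 else v i.
exists (vec_mx (mxvec b *m invmx A)).
have e : interp (vec_mx (mxvec b *m invmx A)) = b.
  by apply: (can_inj mxvecK); rewrite -mul_rV_lin mulmxKV.
move=> i; split.
  by have := congr1 (fun m : 'M[R]_(M, 4) => m i ord0) e; rewrite !mxE unlift_none.
move=> p1; apply: certificate'_frame => // k.
by have := congr1 (fun m : 'M[R]_(M, 4) => m i (lift ord0 k)) e; rewrite !mxE liftK.
Qed.

End System.

(** * Spherical triangle inequalities *)

Section Separation.
Variable R : realType.

Lemma ler_cos_pi (a b : R) : 0 <= a -> a <= b -> b <= pi -> cos b <= cos a.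
Proof.
move=> a0 ab bpi; have b0 := le_trans a0 ab; have api := le_trans ab bpi.
by rewrite leNgt; apply/negP; rewrite ltr_cos ?in_itv/= ?a0 ?api ?b0 ?bpi// ltNge ab.
Qed.

(** Write [|C| = cos psi] with [psi >= D]; then [|t| <= sin psi], so the left-hand side is at most
    [cos (psi - tau) ^ 2]. Geometrically, a move by [tau] away from a node stays at least [D - tau]
    away from any other. *)
Lemma cos_addition_bound (C t D tau : R) : 0 <= D -> D <= 1 -> `|C| <= cos D -> t ^+ 2 <= 1 - C ^+ 2 ->
  0 <= tau -> tau <= D -> (C * cos tau + t * sin tau) ^+ 2 <= cos (D - tau) ^+ 2.
Proof.
move=> D0 D1 hC ht t0 tD; have p1 := @pihalf_ge1 R.
have C1 : -1 <= `|C| <= 1.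
  by rewrite (le_trans hC) ?cos_le1// andbT (le_trans (lerN10 _)).
pose psi := acos `|C|.
have cpsi : cos psi = `|C| by rewrite acosK// in_itv.
have spsi : sin psi = Num.sqrt (1 - C ^+ 2) by rewrite sin_acos// real_normK ?num_real.
have psipi : psi <= pi by exact: acos_lepi.
have psi0 : 0 <= psi by exact: acos_ge0.
have Dpsi : D <= psi.
  rewrite leNgt; apply/negP => psiD; move: hC; rewrite -cpsi leNgt.
  rewrite ltr_cos ?psiD// in_itv/= ?psi0 ?D0//=; lra.
have st : 0 <= sin tau by apply: sin_ge0_pi; lra.
have ct : 0 <= cos tau by apply: cos_ge0_pihalf; lra.
have h : `|C * cos tau + t * sin tau| <= cos (D - tau).
  apply: (@le_trans _ _ (cos (psi - tau))); last by apply: ler_cos_pi; lra.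
  rewrite cosB cpsi spsi (le_trans (ler_normD _ _))// !normrM (ger0_norm st) (ger0_norm ct).
  rewrite lerD2l ler_wpM2r// -sqrtr_sqr ler_wsqrtr//.
by rewrite -[X in X <= _]real_normK ?num_real// lerXn2r ?nnegrE// (le_trans _ h).
Qed.

(** No point is closer than [D / 2] to two nodes, up to sign. Otherwise, with [k = cos (D / 2) ^ 2],
    both squared products with [p] exceed [k], and [|dot u v| <= 2 k - 1] contradicts Cauchy-Schwarz
    for the parts of [u] and [v] orthogonal to [p]. *)
Lemma pair_far (p u v : 'rV[R]_4) (D : R) : dot p p = 1 -> dot u u = 1 -> dot v v = 1 ->
  0 <= D -> D <= 1 -> `|dot u v| <= cos D -> `|dot v p| <= `|dot u p| ->
  dot v p ^+ 2 <= cos (D / 2) ^+ 2.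
Proof.
move=> p1 u1 v1 D0 D1 huv hvu; rewrite leNgt; apply/negP => hv.
have hu : cos (D / 2) ^+ 2 < dot u p ^+ 2.
  by apply: lt_le_trans hv _; rewrite -[X in X <= _]real_normK ?num_real//
    -[leRHS]real_normK ?num_real// lerXn2r ?nnegrE.
have := dot_cauchy (u - dot u p *: p) (v - dot v p *: p).
rewrite !(dotDl, dotDr, dotNl, dotNr, dotZl, dotZr) p1 u1 v1 (dotC p u) (dotC p v).
set a := dot u p in hu *; set b := dot v p in hv *; set g := dot u v in huv *.
have -> : g - b * a + (- (a * b) - a * - (b * 1)) = g - a * b by ring.
have -> : 1 - a * a + (- (a * a) - a * - (a * 1)) = 1 - a ^+ 2 by ring.
have -> : 1 - b * b + (- (b * b) - b * - (b * 1)) = 1 - b ^+ 2 by ring.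
have cD : cos D = 2 * cos (D / 2) ^+ 2 - 1.
  by rewrite {1}(splitr D) cosD -!expr2 sin2cos2; ring.
have c0 : 0 < cos D.
  have p2 := @pihalf_ge1 R; apply: cos_gt0_pihalf; apply/andP; split; [lra|].
  apply: le_lt_trans D1 _.
  have := @pihalf_ge1 R; rewrite le_eqVlt => /orP[/eqP e|//]; exfalso.
  have := cos1_gt0 R; rewrite e cos_pihalf; lra.
set k := cos (D / 2) ^+ 2 in hv hu cD.
have k0 : 0 <= k by rewrite /k sqr_ge0.
have ab : k < `|a * b|.
  by rewrite -ltr_sqr ?nnegrE// real_normK ?num_real// (exprMn 2 a b) (expr2 k) ltr_pM.
have gab : 1 - k <= `|g - a * b|.
  have : `|a * b| <= `|g| + `|g - a * b|.
    rewrite (_ : a * b = g - (g - a * b)); last by ring.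
    by rewrite (le_trans (ler_normB _ _))// (_ : g - (g - (g - a * b)) = g - a * b)//; ring.
  lra.
rewrite leNgt => /negP; apply.
have a2 : a ^+ 2 <= 1 by have := dot_cauchy u p; rewrite u1 p1 mulr1.
have b2 : b ^+ 2 <= 1 by have := dot_cauchy v p; rewrite v1 p1 mulr1.
have : (1 - k) ^+ 2 <= (g - a * b) ^+ 2.
  by rewrite -[leRHS]real_normK ?num_real// lerXn2r ?nnegrE//; lra.
nra.
Qed.

End Separation.

(** Diagonal dominance in numbers, [E] being the bound for the packing sum at [y0]. The factor of
    [B] on the right of the second inequality is about 0.32, so [B] is absorbed and is at most
    [0.1163 A]; the first inequality then bounds [A]. *)
Lemma system_arith (R : realType) (A B E V y0 : R) : y0 = 133 / 500 ->
  0 <= A -> 0 <= B -> 0 <= E <= 169 / 2500 -> A <= V + (A * y0 + B) * E ->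
  B <= (A * (2 / 25 + (8 * y0 + 2) * y0) + B * (2 * y0 + (8 * y0 + 2))) * E ->
  [/\ A <= 1027 / 1000 * V, B <= 3 / 25 * V & (A * y0 + B) * E <= 27 / 1000 * V].
Proof.
move=> y0E A0 B0 /andP[E0 El] hA hB.
have AE1 : A * E <= A * (169 / 2500) by rewrite ler_wpM2l.
have BE1 : B * E <= B * (169 / 2500) by rewrite ler_wpM2l.
have AE0 : 0 <= A * E by rewrite mulr_ge0.
have BE0 : 0 <= B * E by rewrite mulr_ge0.
rewrite y0E in hA hB *; clear y0E El E0.
have AB : B <= 1163 / (10 * 1000) * A by move: hB B0 A0 AE1 BE1 AE0 BE0; clear; lra.
have AV : A <= 1027 / 1000 * V by move: hA AB A0 AE1 BE1; clear; lra.
by split=> //; [move: A0 AB AV; clear; lra|move: A0 AB AV AE1 BE1; clear; lra].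
Qed.

Section Certificate.
Variables (R : realType) (M n : nat) (P : 'I_M -> 'rV[R]_4) (Delta : R).
Hypotheses (n5 : (5 <= n)%N) (P1 : forall i, dot (P i) (P i) = 1)
  (D0 : 0 < Delta) (D1 : Delta <= 6 / 7) (nD : 30 / 7 <= n%:R * Delta)
  (sep : forall i j, i != j -> `|dot (P i) (P j)| <= cos Delta).
Implicit Types (p u e : 'rV[R]_4) (g : 'M[R]_(M, 4)).

Let N0 : 0 < n%:R :> R. Proof. by rewrite ltr0n (leq_trans _ n5). Qed.

(** Every other node is at angle at least [Delta - tau], whose sine is at least [43 / 49] of it by
    [sin_lb]. The two uses are [tau = 0], at a node, and [n tau <= 7 / 10], near one. *)
Lemma geodesic_sep i j u (tau y0 : R) : i != j -> dot u u = 1 -> dot (P i) u = 0 ->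
  0 <= tau -> tau <= Delta -> 0 <= y0 ->
  1 <= 43 / 49 * (n%:R * Delta - n%:R * tau) * y0 ->
  1 <= n%:R ^+ 2 * y0 ^+ 2 *
    (1 - dot (P j) (cos tau *: P i + sin tau *: u) ^+ 2).
Proof.
move=> ij u1 iu t0 tD y00 hy; move: (D0) (D1) => D0' D1'.
have hC : `|dot (P j) (P i)| <= cos Delta by apply: sep; rewrite eq_sym.
have ht := bessel2 (P1 i) u1 iu (P1 j).
have D1'' : Delta <= 1 by lra.
have := cos_addition_bound (ltW D0) D1'' hC ht t0 tD.
rewrite dotDr !dotZr ![_ * dot _ _]mulrC cos2sin2 => h.
have hs : 43 / 49 * (Delta - tau) <= sin (Delta - tau) by apply: sin_lb; lra.
have s1 : 1 <= n%:R * sin (Delta - tau) * y0.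
  apply: le_trans hy _; rewrite ler_wpM2r//.
  have : n%:R * (43 / 49 * (Delta - tau)) <= n%:R * sin (Delta - tau) by rewrite ler_pM2l.
  lra.
apply: (@le_trans _ _ (n%:R ^+ 2 * y0 ^+ 2 * sin (Delta - tau) ^+ 2)).
  have -> : n%:R ^+ 2 * y0 ^+ 2 * sin (Delta - tau) ^+ 2 = (n%:R * sin (Delta - tau) * y0) ^+ 2.
    by ring.
  by rewrite exprn_ege1.
by rewrite ler_wpM2l ?mulr_ge0 ?sqr_ge0//; lra.
Qed.

Lemma kterm_own (l : R) : kterm n 1 l = l.
Proof. by rewrite /kterm kerW1 ?(leq_trans _ n5)// mul1r mulr1. Qed.

Lemma kterm'_own (l m : R) : kterm' n 1 0 l m = m.
Proof. by rewrite /kterm' kerW1 ?(leq_trans _ n5)//; ring. Qed.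

(** The alternative [A = 0] covers an empty index set. *)
Lemma max_attained (F : 'I_M -> R) : (forall i, 0 <= F i) ->
  exists2 A, 0 <= A /\ (forall i, F i <= A) & (A = 0 \/ exists i, A = F i).
Proof.
move=> F0; exists (\big[Num.max/0]_i F i).
  split; first exact: bigmax_ge_id.
  by move=> i; apply: le_bigmax.
elim/big_ind: _ => [|x y hx hy|i _]; [by left| |by right; exists i].
by rewrite /Num.max; case: ifP.
Qed.

(* In each interpolation condition the term of [P i] itself dominates, so the
   maxima [A] and [B] of the radial and tangential parts of the coefficients are
   bounded in terms of each other. *)
Lemma system_bound g (v : 'I_M -> R) (V : R) : 0 <= V -> (forall i, `|v i| <= V) ->
  (forall i, certificate n P g (P i) = v i) ->
  (forall i u, dot u (P i) = 0 -> certificate' n P g (P i) u = 0) ->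
  forall i, [/\ `|coefA P g i| <= 1027 / 1000 * V, `|coefA P g i - v i| <= 27 / 1000 * V &
    dot (coefE P g i) (coefE P g i) <= (n%:R * (3 / 25 * V)) ^+ 2].
Proof.
move=> V0 hv Qv Q'0.
have [A [A0 hA] AE] := @max_attained (fun i => `|coefA P g i|) (fun i => normr_ge0 _).
pose ne i := Num.sqrt (dot (coefE P g i) (coefE P g i)).
have [B [B0 hB] BE] := @max_attained (fun i => ne i / n%:R)
  (fun i => divr_ge0 (sqrtr_ge0 _) (ltW N0)).
have neB i : dot (coefE P g i) (coefE P g i) <= (n%:R * B) ^+ 2.
  have := hB i; rewrite ler_pdivrMr// => h.
  rewrite -(sqr_sqrtr (dot_ge0 (coefE P g i))) -/(ne i).
  by rewrite [n%:R * B]mulrC lerXn2r ?nnegrE ?sqrtr_ge0// mulr_ge0// ltW.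
(* [133 / 500] is just above the inverse of [43 / 49 * 30 / 7]. *)
have [y0 y0E] : {y0 : R | y0 = 133 / 500} by exists (133 / 500).
have y00 : 0 < y0 by rewrite y0E; lra.
have sepi i j : j != i -> 1 <= n%:R ^+ 2 * y0 ^+ 2 * (1 - dot (P j) (P i) ^+ 2).
  move=> ji; have := @geodesic_sep i j (frame 0 (P i)) 0 y0.
  rewrite cos0 sin0 scale1r scale0r addr0; apply => //.
  - by rewrite eq_sym.
  - by rewrite frame_unit P1.
  - by rewrite dotC frame_orth.
  - exact: ltW.
  - exact: ltW.
  - by rewrite mulr0 subr0; move: (nD); rewrite y0E; lra.
have [E EE] : {E : R | E = 27 * y0 ^+ 7 + 13 / 200} by exists (27 * y0 ^+ 7 + 13 / 200).
have E1 : 0 <= E <= 169 / 2500 by rewrite EE y0E; apply/andP; split; lra.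
have hval i : `|coefA P g i - v i| <= (A * y0 + B) * E.
  have [h _ _] := far_sums n5 P1 D0 D1 nD sep (P1 i) (etrans (frame_unit 0 (P i)) (P1 i))
    (etrans (dotC _ _) (frame_orth 0 (P i))) y00 A0 hA B0 neB (sepi i).
  rewrite -EE in h; apply: le_trans h; rewrite -(Qv i) /certificate (bigD1 i)//= P1 kterm_own.
  by rewrite opprD addNKr normrN ler_norm_sum.
have htan i : ne i <= n%:R * (A * (2 / 25 + (8 * y0 + 2) * y0) + B * (2 * y0 + (8 * y0 + 2))) * E.
  have [e0|en0] := eqVneq (ne i) 0.
    rewrite e0; case/andP: E1 => E0 _; rewrite !mulr_ge0 ?(ltW N0)// addr_ge0// mulr_ge0//.
      by rewrite y0E; lra.
    by rewrite y0E; lra.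
  have nep : 0 < ne i by rewrite lt_def en0 sqrtr_ge0.
  (* Tested in the direction of its own tangential part, the term of [P i] contributes the full norm
     [ne i]. *)
  pose u := (ne i)^-1 *: coefE P g i.
  have ne2 : dot (coefE P g i) (coefE P g i) = ne i ^+ 2.
    by rewrite /ne sqr_sqrtr// dot_ge0.
  have u1 : dot u u = 1.
    by rewrite /u dotZl dotZr ne2; field.
  have uP : dot u (P i) = 0 by rewrite /u dotZl coefE_orth ?mulr0.
  have [_ h _] := far_sums n5 P1 D0 D1 nD sep (P1 i) u1 (etrans (dotC _ _) uP) y00 A0 hA B0 neB
    (sepi i).
  rewrite -EE in h; apply: le_trans h; have := Q'0 i u uP.
  rewrite /certificate' (bigD1 i)//= P1 (dotC (P i) u) uP kterm'_own.
  have -> : dot (row i g) u = ne i.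
    rewrite (coef_dot P) (dotC (P i)) uP mulr0 add0r /u dotZr ne2; field.
    exact: en0.
  move=> /eqP; rewrite addr_eq0 => /eqP ->.
  by rewrite (le_trans (ler_norm _))// normrN ler_norm_sum.
have hA1 : A <= V + (A * y0 + B) * E.
  case: AE => [A00|[i Ai]].
    rewrite {1}A00 addr_ge0// mulr_ge0 ?addr_ge0 ?mulr_ge0 ?(ltW y00)//.
    by case/andP: E1.
  rewrite {1}Ai (_ : coefA P g i = v i + (coefA P g i - v i)); last by ring.
  by rewrite (le_trans (ler_normD _ _))// lerD.
have hB1 : B <= (A * (2 / 25 + (8 * y0 + 2) * y0) + B * (2 * y0 + (8 * y0 + 2))) * E.
  case: BE => [B00|[i Bi]].
    rewrite {1}B00; case/andP: E1 => E0 _; rewrite mulr_ge0// addr_ge0// mulr_ge0//.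
      by rewrite y0E; lra.
    by rewrite y0E; lra.
  by rewrite {1}Bi ler_pdivrMr//; have := htan i; lra.
have [AV BV hABV] := system_arith y0E A0 B0 E1 hA1 hB1.
move=> i; split; [exact: le_trans (hA i) AV|exact: le_trans (hval i) hABV|].
apply: le_trans (neB i) _; have NB : n%:R * B <= n%:R * (3 / 25 * V) by rewrite ler_pM2l.
by rewrite lerXn2r ?nnegrE// ?(le_trans _ NB)// mulr_ge0 ?(ltW N0).
Qed.

End Certificate.

(** * The kernel near its peak, and numerical inequalities *)

Section Kernel.
Variables (R : realType) (n : nat).
Hypothesis n5 : (5 <= n)%N.
Implicit Types (t x c : R).

Let N0 : 0 < n%:R :> R. Proof. by rewrite ltr0n (leq_trans _ n5). Qed.
Let N5 : 5 <= n%:R :> R. Proof. by rewrite ler_nat. Qed.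

Lemma cheb_parity k c : (chebT R k).[- c] = (-1) ^+ k * (chebT R k).[c] /\
  (chebU R k).[- c] = - (-1) ^+ k * (chebU R k).[c].
Proof.
elim: k => [|k [IHT IHU]].
  by rewrite /chebT /chebU /= !horner_one !horner0; split; ring.
rewrite chebTS chebUS !(hornerD, hornerN, hornerX, hornerXn, horner_one, hornerM).
by rewrite IHT IHU !exprS; split; ring.
Qed.

Lemma kerW_even c : (kerW R n).[- c] = (kerW R n).[c].
Proof.
rewrite /kerW /kerS !horner_exp !hornerZ (cheb_parity n c).2.
by rewrite mulrCA exprMn (exprM _ 2 4) sqrrN sqrr_sign expr1n mul1r.
Qed.

Lemma kerW_norm c : (kerW R n).[`|c|] = (kerW R n).[c].
Proof. by case: (ger0P c) => // _; rewrite kerW_even. Qed.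

Lemma kerS_sin t : (kerS R n).[cos t] * (n%:R * sin t) = sin (n%:R * t).
Proof.
by rewrite /kerS hornerZ mulrACA mulVf ?gt_eqF// mul1r (cheb_cos n t).2.
Qed.

Lemma kerS_pythagoras c : (n%:R * (kerS R n).[c]) ^+ 2 * (1 - c ^+ 2) <= 1.
Proof.
have := congr1 (horner^~ c) (cheb_pythagoras R n).
rewrite !(hornerD, hornerN, hornerX, hornerXn, horner_one, hornerM, horner_exp).
have -> : n%:R * (kerS R n).[c] = (chebU R n).[c].
  by rewrite /kerS hornerZ mulrA mulfV ?mul1r ?gt_eqF.
by have := sqr_ge0 (chebT R n).[c]; lra.
Qed.

(** Quotient of Taylor bounds for [sin x / (n sin t)] with [x = n t]. As [n >= 5], the denominator
    is at least [x (1 - x ^ 2 / 150)]; [29 / 200] is what this loss and the term [x ^ 4 / 120] leave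
    of [1 / 6] for [x <= 13 / 10]. *)
Lemma kerS_bounds t : 0 < t -> n%:R * t <= 13 / 10 ->
  [/\ 0 <= (kerS R n).[cos t],
      (kerS R n).[cos t] <= 1 - 29 / 200 * (n%:R * t) ^+ 2 &
      1 - (n%:R * t) ^+ 2 / 6 <= (kerS R n).[cos t]].
Proof.
move=> t0 x1; have := kerS_sin t; set S := (kerS R n).[cos t]; set x := n%:R * t in x1 *.
have x0 : 0 < x by rewrite mulr_gt0.
have xt2 : t ^+ 2 <= x ^+ 2 / 25.
  rewrite /x exprMn; have n25 : 25 <= n%:R ^+ 2 :> R by move: (N5) => N5'; nra.
  have : 25 * t ^+ 2 <= n%:R ^+ 2 * t ^+ 2 by rewrite ler_wpM2r// sqr_ge0.
  lra.
have x2 : x ^+ 2 <= 169 / 100 by nra.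
have st1 := sin_ge_taylor3 (ltW t0); have st2 := sin_le_id (ltW t0).
have st3 : t * (1 - x ^+ 2 / 150) <= sin t.
  apply: le_trans st1; rewrite (exprS t 2).
  have : t * t ^+ 2 <= t * (x ^+ 2 / 25) by rewrite ler_wpM2l// ltW.
  lra.
have ns1 : x * (1 - x ^+ 2 / 150) <= n%:R * sin t.
  by rewrite /x -mulrA ler_pM2l.
have ns2 : n%:R * sin t <= x by rewrite /x ler_pM2l.
have ns0 : 0 < n%:R * sin t by apply: lt_le_trans ns1; rewrite mulr_gt0//; lra.
have sx1 := sin_ge_taylor3 (ltW x0); have sx2 := sin_le_taylor5 (ltW x0).
move=> Ssx; have S0 : 0 <= S.
  rewrite -(@pmulr_lge0 _ (n%:R * sin t))// Ssx; apply: le_trans sx1.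
  rewrite (_ : _ - _ = x * (1 - x ^+ 2 / 6)); last by field.
  by rewrite mulr_ge0//; [exact: ltW|lra].
split=> //.
  have h1 : S * (1 - x ^+ 2 / 150) <= 1 - x ^+ 2 / 6 + x ^+ 4 / 120.
    rewrite -(ler_pM2l x0).
    have : S * (x * (1 - x ^+ 2 / 150)) <= S * (n%:R * sin t) by rewrite ler_wpM2l.
    rewrite Ssx; move: sx2; rewrite (exprS x 4) (exprS x 2) => h2 h3.
    by lra.
  have d0 : 0 < 1 - x ^+ 2 / 150 by lra.
  rewrite -(ler_pM2r d0); apply: le_trans h1 _.
  rewrite (exprM x 2 2); set w := x ^+ 2 in x2 *.
  have w0 : 0 <= w by rewrite /w sqr_ge0.
  nra.
rewrite -(ler_pM2l x0).
have : S * (n%:R * sin t) <= S * x by rewrite ler_wpM2l.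
by rewrite Ssx; move: sx1; rewrite (exprS x 2); lra.
Qed.

Lemma pow8_ub (z : R) : 0 <= z -> z <= 1 -> (1 - z) ^+ 8 <= 1 - 8 * z + 28 * z ^+ 2.
Proof.
move=> z0 z1; rewrite (exprM _ 4 2).
have h4 : (1 - z) ^+ 4 <= 1 - 4 * z + 6 * z ^+ 2.
  rewrite -subr_ge0 (_ : _ - _ = z ^+ 3 * (4 - z)); last by ring.
  by rewrite mulr_ge0 ?exprn_ge0//; lra.
have h0 : 0 <= (1 - z) ^+ 4 by rewrite exprn_ge0//; lra.
apply: (@le_trans _ _ ((1 - 4 * z + 6 * z ^+ 2) ^+ 2)).
  by rewrite lerXn2r ?nnegrE// (le_trans h0).
rewrite -subr_ge0 (_ : _ - _ = z ^+ 3 * (48 - 36 * z)); last by ring.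
by rewrite mulr_ge0 ?exprn_ge0//; lra.
Qed.

Lemma pow8_lb (z S : R) : 0 <= z -> z <= 1 / 4 -> 1 - z <= S -> 1 - 8 * z <= S ^+ 8.
Proof.
move=> z0 z1 zS; rewrite (exprM _ 2 4) (exprM _ 2 2).
have h2 : 1 - 2 * z <= S ^+ 2 by nra.
have h4 : 1 - 4 * z <= (S ^+ 2) ^+ 2 by nra.
have : 0 <= 1 - 4 * z by lra.
by nra.
Qed.

End Kernel.

Lemma near_const (R : realType) : (1027 / 1000 * ((4 / 25 + (72 * (8 / 25) ^+ 2 + 32 * (8 / 25) + 14)) * (8 / 25)
              + 4 / 25 * (8 * (8 / 25) + 2))
          + 3 / 25 * (4 / 25 + (72 * (8 / 25) ^+ 2 + 32 * (8 / 25) + 14) + 4 * (8 * (8 / 25) + 2) * (8 / 25)))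
          * (27 * (8 / 25) ^+ 7 + 13 / 200) <= 117 / 100 :> R.
Proof. lra. Qed.

(** The term of the nearest node plus the first bound of [far_sums] at [y0 = 301 / 625].
    [929 / 1000] is just above [1 - 29 / 200 * (7 / 10) ^ 2], the bound of [kerS_bounds] at
    [n t = 7 / 10]. *)
Lemma far_const (R : realType) (a b : R) : a <= (929 / 1000) ^+ 8 -> b <= (929 / 1000) ^+ 7 ->
  1027 / 1000 * a + 3 / 25 * b +
    (1027 / 1000 * (301 / 625) + 3 / 25) * (27 * (301 / 625) ^+ 7 + 13 / 200) < 1.
Proof.
move=> ha hb; have h8 : (929 / 1000) ^+ 8 <= 14 / 25 :> R by lra.
have h7 : (929 / 1000) ^+ 7 <= 3 / 5 :> R by lra.
have h : (1027 / 1000 * (301 / 625) + 3 / 25) * (27 * (301 / 625) ^+ 7 + 13 / 200) <= 7 / 50 :> R.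
  by lra.
have := le_trans ha h8; have := le_trans hb h7; move: h; clear.
by set z := _ * (_ + _); lra.
Qed.

(** With [w = (n t) ^ 2], the loss from [al * G] is at least [0.973 * 0.87 w], more than the
    [0.115 w + 0.585 w] that the tangential error and the Taylor remainder can restore. *)
Lemma near_final (R : realType) (s al G mh Rm w : R) : (s = 1 \/ s = -1) -> `|al - s| <= 27 / 1000 ->
  87 / 100 * w <= G -> G <= 1 -> 0 < w -> w <= 49 / 100 -> `|mh| <= 23 / 200 * w ->
  `|Rm| <= 117 / 200 * w -> `|s - al * G - mh + Rm| < 1.
Proof.
move=> hs hal wG G1 w0 w1.
have G0 : 0 <= G by clear -wG w0; lra.
have : `|al * G - s * G| <= 27 / 1000 * G.
  by rewrite -mulrBl normrM (ger0_norm G0) ler_wpM2r.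
rewrite !ler_norml ltr_norml => /andP[a1 a2] /andP[m1 m2] /andP[r1 r2].
move: a1 a2; clear hal; set z := al * G => a1 a2.
by case: hs => se; rewrite se in a1 a2 *; clear se; apply/andP; split; lra.
Qed.

(** The tangential part of the own term is [m sn c W], up to the factor [m], and the other terms
    contribute [- m t] at first order, so only a third-order difference remains. [34 / 25] is
    [4 / 3] from the kernel plus [2 / 3 * 1 / 25] from [sn c = sin (2 t) / 2]. *)
Lemma near_tangent (R : realType) (W c x t sn : R) : 0 < x -> x ^+ 2 <= 49 / 100 ->
  1 - 4 / 3 * x ^+ 2 <= W -> W <= 1 -> 0 <= W -> 0 <= c -> c <= 1 -> 0 < t ->
  t ^+ 2 <= x ^+ 2 / 25 -> 0 <= sn -> sn <= t -> t * (1 - 2 / 3 * t ^+ 2) <= sn * c ->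
  0 <= t - sn * c * W <= t * (34 / 25 * x ^+ 2).
Proof.
move=> x0 x2 Wl W1 W0 c0 c1 t0 t2 sn0 snt hsc; apply/andP; split.
  by rewrite subr_ge0; apply: le_trans snt; rewrite -mulrA ler_piMr// mulr_ile1.
have q0 : 0 <= 1 - 4 / 3 * x ^+ 2 by clear -x2; lra.
have q1 : 0 <= 1 - 2 / 3 * t ^+ 2 by clear -x2 t2; lra.
have h1 : t * (1 - 2 / 3 * t ^+ 2) * (1 - 4 / 3 * x ^+ 2) <= sn * c * W.
  by apply: ler_pM => //; rewrite mulr_ge0// ltW.
have h2 : t * (1 - 4 / 3 * x ^+ 2 - 2 / 3 * t ^+ 2) <=
    t * (1 - 2 / 3 * t ^+ 2) * (1 - 4 / 3 * x ^+ 2).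
  rewrite -[leRHS]mulrA ler_pM2l//.
  have : 0 <= t ^+ 2 * x ^+ 2 by rewrite mulr_ge0 ?sqr_ge0.
  by clear; lra.
have h3 : t * (1 - 34 / 25 * x ^+ 2) <= t * (1 - 4 / 3 * x ^+ 2 - 2 / 3 * t ^+ 2).
  by rewrite ler_pM2l//; clear -t2; lra.
have := le_trans h3 (le_trans h2 h1); clear; lra.
Qed.

Lemma near_kernel (R : realType) (S x : R) : 0 < x -> x ^+ 2 <= 49 / 100 -> 0 <= S ->
  S <= 1 - 29 / 200 * x ^+ 2 -> 1 - x ^+ 2 / 6 <= S ->
  [/\ 0 <= S ^+ 8, S ^+ 8 <= 1 - 87 / 100 * x ^+ 2, S ^+ 8 <= 1 &
      1 - 4 / 3 * x ^+ 2 <= S ^+ 8].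
Proof.
move=> x0 x2 S0 Su Sl; have x20 : 0 < x ^+ 2 by rewrite exprn_gt0.
set w := x ^+ 2 in x2 x20 Su Sl *.
have Wu : S ^+ 8 <= 1 - 87 / 100 * w.
  apply: (@le_trans _ _ ((1 - 29 / 200 * w) ^+ 8)).
    by rewrite lerXn2r ?nnegrE// (le_trans S0).
  have z0 : 0 <= 29 / 200 * w by clear -x20; lra.
  have z1 : 29 / 200 * w <= 1 by clear -x2; lra.
  by apply: le_trans (pow8_ub z0 z1) _; clear -x2 x20; nra.
split; rewrite ?exprn_ge0//; first by clear -Wu x20; lra.
have z0 : 0 <= w / 6 by clear -x20; lra.
have z1 : w / 6 <= 1 / 4 by clear -x2; lra.
by have := pow8_lb z0 z1 Sl; clear; lra.
Qed.

Lemma near_arith (R : realType) (s al m W c x t sn Rm S : R) : (s = 1 \/ s = -1) ->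
  `|al - s| <= 27 / 1000 -> 0 < x -> x <= 7 / 10 -> W = S ^+ 8 -> 0 <= S ->
  S <= 1 - 29 / 200 * x ^+ 2 -> 1 - x ^+ 2 / 6 <= S -> 0 <= c -> c <= 1 ->
  0 < t -> t ^+ 2 <= x ^+ 2 / 25 -> `|m| * t <= 3 / 25 * x ->
  0 <= sn -> sn <= t -> t * (1 - 2 / 3 * t ^+ 2) <= sn * c ->
  `|Rm| <= 117 / 200 * x ^+ 2 ->
  `|c * (al * c + m * sn) * W + (s - al - m * t + Rm)| < 1.
Proof.
move=> hs hal x0 x7 WE S0 Su Sl c0 c1 t0 t2 hm sn0 snt hsc hR.
have x2 : x ^+ 2 <= 49 / 100 by clear -x0 x7; nra.
have x20 : 0 < x ^+ 2 by rewrite exprn_gt0.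
have [] := near_kernel x0 x2 S0 Su Sl; rewrite -WE => W0 Wu W1 Wl.
have cc : 0 <= c * c <= 1 by rewrite mulr_ge0// mulr_ile1.
have /andP[h0 hub] := near_tangent x0 x2 Wl W1 W0 c0 c1 t0 t2 sn0 snt hsc.
have F0 : 0 <= c * c * W by rewrite mulr_ge0//; case/andP: cc.
have FW : c * c * W <= W by rewrite ler_piMl//; case/andP: cc.
have mh : `|m * (t - sn * c * W)| <= 23 / 200 * x ^+ 2.
  rewrite normrM (ger0_norm h0).
  apply: (@le_trans _ _ (`|m| * (t * (34 / 25 * x ^+ 2)))).
    by rewrite ler_wpM2l.
  rewrite mulrA; apply: (@le_trans _ _ (3 / 25 * x * (34 / 25 * x ^+ 2))).
    by rewrite ler_wpM2r//; clear -x20; lra.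
  have : x * x ^+ 2 <= 7 / 10 * x ^+ 2 by rewrite ler_wpM2r// ltW.
  by clear -x20; lra.
have -> : c * (al * c + m * sn) * W + (s - al - m * t + Rm) =
    s - al * (1 - c * c * W) - m * (t - sn * c * W) + Rm by ring.
apply: near_final hs hal _ _ x20 x2 mh hR; first by clear -FW Wu; lra.
by clear -F0; lra.
Qed.

Lemma scaled_sin_ge (R : realType) (N : R) : 5 <= N -> 257 / 200 <= N * sin (13 / 10 / N).
Proof.
move=> N5; have N0 : 0 < N by apply: lt_le_trans N5.
set z : R := 13 / 10 / N; have z0 : 0 <= z by rewrite divr_ge0 ?(ltW N0)// divr_ge0.
have hz : z - z ^+ 3 / 6 <= sin z by apply: sin_ge_taylor3.
have nz : N * z = 13 / 10 by rewrite /z; field; rewrite gt_eqF.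
have z5 : z ^+ 2 <= 169 / 2500.
  have : z <= 13 / 50 by rewrite ler_pdivrMr//; clear -N5; lra.
  by move: z0; clear; nra.
have : N * (z - z ^+ 3 / 6) <= N * sin z by rewrite ler_pM2l.
rewrite (exprS z 2) (_ : N * _ = N * z * (1 - z ^+ 2 / 6)); last by field.
by rewrite nz; move: z5; clear; lra.
Qed.

(** * The strict bound near the nodes and away from them *)

Section NearFar.
Variables (R : realType) (M n : nat) (P : 'I_M -> 'rV[R]_4) (Delta : R).
Hypotheses (n5 : (5 <= n)%N) (P1 : forall i, dot (P i) (P i) = 1)
  (D0 : 0 < Delta) (D1 : Delta <= 6 / 7) (nD : 30 / 7 <= n%:R * Delta)
  (sep : forall i j, i != j -> `|dot (P i) (P j)| <= cos Delta).
Implicit Types (p u e : 'rV[R]_4) (g : 'M[R]_(M, 4)).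

Let N0 : 0 < n%:R :> R. Proof. by rewrite ltr0n (leq_trans _ n5). Qed.
Let N5 : 5 <= n%:R :> R. Proof. by rewrite ler_nat. Qed.

Lemma is_derive_bigsum (J : pred 'I_M) (F : 'I_M -> R -> R) (dF : 'I_M -> R) (t : R) :
  (forall j, is_derive t (1 : R) (F j) (dF j)) ->
  is_derive t (1 : R) (fun s => \sum_(j | J j) F j s) (\sum_(j | J j) dF j).
Proof.
move=> dFj.
have -> : (fun s => \sum_(j | J j) F j s) = \sum_(j < M) (if J j then F j else cst 0).
  apply/boolp.funext => s; rewrite fct_sumE big_mkcond; apply: eq_bigr => j _.
  by case: ifP.
rewrite [X in is_derive _ _ _ X]big_mkcond; apply: (@is_derive_sum R R R M (fun j => if J j then F j else cst 0) t 1
  (fun j => if J j then dF j else 0)) => j; case: ifP => // _.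
exact: is_derive_cst.
Qed.

Variables (g : 'M[R]_(M, 4)).
Hypotheses (hA : forall i, `|coefA P g i| <= 1027 / 1000)
  (hE : forall i, dot (coefE P g i) (coefE P g i) <= (n%:R * (3 / 25)) ^+ 2).

Lemma coefE_bound i u : dot u u = 1 -> `|dot (coefE P g i) u| <= n%:R * (3 / 25).
Proof.
move=> u1; have nB : 0 <= n%:R * (3 / 25) :> R by rewrite mulr_ge0 ?(ltW N0)//; lra.
rewrite -ler_sqr ?nnegrE// real_normK ?num_real//.
by have := dot_cauchy (coefE P g i) u; rewrite u1 mulr1 => /le_trans; apply.
Qed.

(* The terms [j != i] are expanded to second order along the geodesic from
   [P i]: the interpolation conditions replace their values and first
   derivatives by those of the term [j = i]. *)
Lemma near_bound i u (t s : R) : (s = 1 \/ s = -1) -> `|coefA P g i - s| <= 27 / 1000 ->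
  certificate n P g (P i) = s -> certificate' n P g (P i) u = 0 ->
  dot u u = 1 -> dot u (P i) = 0 -> 0 < t -> n%:R * t <= 7 / 10 ->
  `|certificate n P g (cos t *: P i + sin t *: u)| < 1.
Proof.
move=> hs hAs Qs Q'0 u1 uP t0 nt.
have Pu : dot (P i) u = 0 by rewrite dotC.
pose K j (r : R) := kterm n (geo (dot (P j) (P i)) (dot (P j) u) r)
   (geo (dot (row j g) (P i)) (dot (row j g) u) r).
pose K' j (r : R) := kterm' n (geo (dot (P j) (P i)) (dot (P j) u) r)
   (geo (dot (P j) u) (- dot (P j) (P i)) r)
   (geo (dot (row j g) (P i)) (dot (row j g) u) r)
   (geo (dot (row j g) u) (- dot (row j g) (P i)) r).
pose K'' j (r : R) := kterm'' n (geo (dot (P j) (P i)) (dot (P j) u) r)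
   (geo (dot (P j) u) (- dot (P j) (P i)) r)
   (geo (dot (row j g) (P i)) (dot (row j g) u) r)
   (geo (dot (row j g) u) (- dot (row j g) (P i)) r).
have dgeo v r : dot v (cos r *: P i + sin r *: u) = geo (dot v (P i)) (dot v u) r.
  by rewrite dotDr !dotZr /geo ![_ * dot _ _]mulrC.
have dgeo' v r : dot v (- sin r *: P i + cos r *: u) = geo (dot v u) (- dot v (P i)) r.
  by rewrite dotDr !dotZr /geo; ring.
have tl : t <= Delta.
  rewrite -(@ler_pM2l _ n%:R)//; move: (nD); lra.
have K''b r : 0 <= r <= t -> `|\sum_(j | j != i) K'' j r| <= n%:R ^+ 2 * (117 / 100).
  move=> /andP[r0 rt]; rewrite (le_trans (ler_norm_sum _ _ _))//.
  have y00 : 0 < 8 / 25 :> R by lra.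
  have A0 : 0 <= 1027 / 1000 :> R by lra.
  have B0 : 0 <= 3 / 25 :> R by lra.
  have cs := cos2Dsin2 r.
  have p1 : dot (cos r *: P i + sin r *: u) (cos r *: P i + sin r *: u) = 1.
    rewrite !(dotDl, dotDr, dotZl, dotZr) P1 u1 uP Pu; lra.
  have q1 : dot (- sin r *: P i + cos r *: u) (- sin r *: P i + cos r *: u) = 1.
    rewrite !(dotDl, dotDr, dotZl, dotZr) P1 u1 uP Pu; lra.
  have pq : dot (cos r *: P i + sin r *: u) (- sin r *: P i + cos r *: u) = 0.
    rewrite !(dotDl, dotDr, dotZl, dotZr) P1 u1 uP Pu; lra.
  have sp j : j != i -> 1 <= n%:R ^+ 2 * (8 / 25) ^+ 2 *
      (1 - dot (P j) (cos r *: P i + sin r *: u) ^+ 2).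
    move=> ji; apply: (geodesic_sep n5 P1 D0 D1 sep) => //.
    - by rewrite eq_sym.
    - exact: le_trans rt tl.
    have : n%:R * r <= n%:R * t by rewrite ler_pM2l.
    by move: (nD) nt; set a := n%:R * _; set b := n%:R * _; set c := n%:R * _; lra.
  have [_ _] := far_sums n5 P1 D0 D1 nD sep p1 q1 pq y00 A0 hA B0 hE sp.
  under eq_bigr do rewrite !dgeo !dgeo'.
  move=> /le_trans; apply; rewrite -mulrA ler_pM2l ?exprn_gt0//.
  exact: near_const.
have := taylor2_bound (ltW t0)
  (fun r => is_derive_bigsum _ (fun j => is_derive_kterm n _ _ _ _ r))
  (fun r => is_derive_bigsum _ (fun j => is_derive_kterm' n _ _ _ _ r)) K''b.
have mE : dot (row i g) u = dot (coefE P g i) u by rewrite (coef_dot P g i u) Pu mulr0 add0r.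
set m := dot (row i g) u in mE *.
under [X in `|_ - X - _|]eq_bigr do rewrite !geo0.
under [X in `|_ - _ - X * _|]eq_bigr do rewrite !geo0.
have -> : \sum_(j | j != i) kterm n (dot (P j) (P i)) (dot (row j g) (P i)) = s - coefA P g i.
  by rewrite -Qs /certificate [in RHS](bigD1 i)//= P1 kterm_own// addrAC subrr add0r.
have -> : \sum_(j | j != i) kterm' n (dot (P j) (P i)) (dot (P j) u) (dot (row j g) (P i))
    (dot (row j g) u) = - m.
  move: Q'0; rewrite /certificate' (bigD1 i)//= P1 Pu kterm'_own// => /eqP.
  by rewrite addrC addr_eq0 => /eqP.
set rest := \sum_(j | j != i) _ => hrest.
have -> : certificate n P g (cos t *: P i + sin t *: u) =
    cos t * (coefA P g i * cos t + m * sin t) * (kerW R n).[cos t] +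
    (s - coefA P g i - m * t + (rest - (s - coefA P g i) - - m * t)).
  rewrite /certificate (bigD1 i)//= dgeo dgeo P1 Pu /kterm -/(coefA P g i) -/m.
  rewrite (_ : geo 1 0 t = cos t); last by rewrite /geo; ring.
  congr (_ + _); rewrite [RHS](_ : _ = rest); last by ring.
  by apply: eq_bigr => j _; rewrite !dgeo.
have x1 : n%:R * t <= 13 / 10 by apply: le_trans nt _; lra.
have [S0 Su Sl] := kerS_bounds n5 t0 x1.
have t1 : t <= 1.
  have : 5 * t <= n%:R * t by rewrite ler_pM2r.
  move: nt; set x := n%:R * t; lra.
have pih := @pihalf_ge1 R.
have c0 : 0 <= cos t by apply: cos_ge0_pihalf; move: (ltW t0); lra.
have sn0 : 0 <= sin t by apply: sin_ge0_pi; move: (ltW t0); lra.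
apply: (@near_arith R s _ m _ _ (n%:R * t) t _ _ (kerS R n).[cos t]) => //.
- exact: mulr_gt0.
- by rewrite /kerW horner_exp.
- rewrite exprMn; have h25 : 25 <= n%:R ^+ 2 :> R by move: (N5); nra.
  have : 25 * t ^+ 2 <= n%:R ^+ 2 * t ^+ 2 by rewrite ler_wpM2r// sqr_ge0.
  set a := n%:R ^+ 2 * _; lra.
- rewrite mulrA ler_wpM2r ?(ltW t0)// mE mulrC; exact: coefE_bound.
- exact: sin_le_id (ltW t0).
- have t20 : 0 <= 2 * t by move: (ltW t0); lra.
  have := sin_ge_taylor3 t20.
  rewrite (_ : 2 * t = t *+ 2); last by ring.
  rewrite sin_mulr2n => h.
  have -> : t * (1 - 2 / 3 * t ^+ 2) = ((t *+ 2) - (t *+ 2) ^+ 3 / 6) / 2 by field.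
  move: h; set a := _ - _; rewrite (mulrC (sin t)); lra.
apply: le_trans hrest _; rewrite exprMn; rewrite le_eqVlt; apply/orP; left; apply/eqP; by field.
Qed.

(** [P i] is the nearest node up to sign, and its term is small by the decay of the kernel beyond
    [7 / (10 n)]. By [pair_far] every other node is at least [Delta / 2] away. *)
Lemma far_bound i p : dot p p = 1 -> (forall j, `|dot (P j) p| <= `|dot (P i) p|) ->
  `|dot (P i) p| <= cos (7 / 10 / n%:R) -> `|certificate n P g p| < 1.
Proof.
move=> p1 hmax hfar.
have u1 : dot (frame 0 p) (frame 0 p) = 1 by rewrite frame_unit.
have pu : dot p (frame 0 p) = 0 by rewrite dotC frame_orth.
have y00 : 0 < 301 / 625 :> R by lra.
have A0 : 0 <= 1027 / 1000 :> R by lra.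
have B0 : 0 <= 3 / 25 :> R by lra.
have sp j : j != i -> 1 <= n%:R ^+ 2 * (301 / 625) ^+ 2 * (1 - dot (P j) p ^+ 2).
  move=> ji; have D1' : Delta <= 1 by move: (D1); lra.
  have ij : i != j by rewrite eq_sym.
  have := pair_far p1 (P1 i) (P1 j) (ltW D0) D1' (sep ij) (hmax j).
  rewrite cos2sin2 => h; have hs := half_sin_lb n5 D0 D1 nD.
  have h1 : 1 <= n%:R * sin (Delta / 2) * (301 / 625).
    by move: hs; set z := n%:R * _; lra.
  apply: (@le_trans _ _ ((n%:R * sin (Delta / 2) * (301 / 625)) ^+ 2)).
    by rewrite exprn_ege1.
  have -> : (n%:R * sin (Delta / 2) * (301 / 625)) ^+ 2 =
    n%:R ^+ 2 * (301 / 625) ^+ 2 * sin (Delta / 2) ^+ 2 by ring.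
  rewrite ler_wpM2l ?(mulr_ge0 (sqr_ge0 _) (sqr_ge0 _))//.
  by move: h; set a := sin _ ^+ 2; set b := dot _ _ ^+ 2; lra.
have [far _ _] := far_sums n5 P1 D0 D1 nD sep p1 u1 pu y00 A0 hA B0 hE sp.
pose c := dot (P i) p; pose S := (kerS R n).[`|c|].
have c1 : c ^+ 2 <= 1 by have := dot_cauchy (P i) p; rewrite P1 p1 mulr1.
have c1' : `|c| <= 1 by apply: sqr_le1_norm.
(* Up to [n t = 13 / 10] this is the Taylor bound; beyond it, [|S| <= 1 / (n sin t)] is enough, with
   [n sin t >= 257 / 200]. *)
have S1 : `|S| <= 929 / 1000.
  have pih := @pihalf_ge1 R.
  have hc : -1 <= `|c| <= 1 by rewrite c1' andbT (le_trans (lerN10 _)).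
  pose t := acos `|c|; have ct : cos t = `|c| by rewrite acosK// in_itv.
  have t0 : 0 <= t by exact: acos_ge0.
  have tpi : t <= pi by exact: acos_lepi.
  have [nt|nt] := leP (n%:R * t) (13 / 10).
    have tl : 7 / 10 / n%:R <= t.
      rewrite leNgt; apply/negP => tlt; move: hfar; rewrite -/c -ct leNgt.
      have n7 : 0 <= 7 / 10 / n%:R :> R by rewrite divr_ge0 ?(ltW N0)//; lra.
      have n8 : 7 / 10 / n%:R <= pi :> R.
        rewrite ler_pdivrMr//; move: (N5); nra.
      by rewrite ltr_cos ?tlt// in_itv/= ?t0 ?tpi ?n7 ?n8.
    have tp : 0 < t by apply: lt_le_trans tl; rewrite divr_gt0//; lra.
    have [S0 Su _] := kerS_bounds n5 tp nt.
    rewrite /S -ct ger0_norm//; apply: le_trans Su _.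
    have : 7 / 10 <= n%:R * t by rewrite [leRHS]mulrC -ler_pdivrMr.
    set x := n%:R * t; nra.
  have pyt := kerS_pythagoras n5 `|c|; rewrite -/S in pyt.
  have t13 : 0 <= 13 / 10 / n%:R :> R by rewrite divr_ge0 ?(ltW N0)//; lra.
  have cl : `|c| <= cos (13 / 10 / n%:R).
    rewrite -ct; apply: ler_cos_pi => //.
    by rewrite ler_pdivrMr// [leRHS]mulrC ltW.
  have c2 : c ^+ 2 <= cos (13 / 10 / n%:R) ^+ 2.
    by rewrite -[leLHS]real_normK ?num_real// lerXn2r ?nnegrE// (le_trans _ cl).
  have s2 : 257 / 200 <= n%:R * sin (13 / 10 / n%:R) :> R.
    exact: scaled_sin_ge N5.
  have s3 : (257 / 200) ^+ 2 * S ^+ 2 <= 1.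
    apply: le_trans pyt; rewrite real_normK ?num_real//.
    have -> : (n%:R * S) ^+ 2 * (1 - c ^+ 2) = n%:R ^+ 2 * (1 - c ^+ 2) * S ^+ 2 by ring.
    rewrite ler_wpM2r ?sqr_ge0//.
    apply: (@le_trans _ _ ((n%:R * sin (13 / 10 / n%:R)) ^+ 2)).
      have q0 : 0 <= 257 / 200 :> R by rewrite divr_ge0 ?ler0n.
      have q1 := le_trans q0 s2; apply: lerXn2r s2; rewrite nnegrE; first exact: q0.
      exact: q1.
    rewrite exprMn ler_wpM2l ?sqr_ge0// sin2cos2; move: c2; lra.
  have q0 : 0 <= 929 / 1000 :> R by rewrite divr_ge0 ?ler0n.
  by rewrite -(ler_sqr _ q0) ?nnegrE ?normr_ge0// real_normK ?num_real//; move: s3; lra.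
have own : `|kterm n c (dot (row i g) p)| <= 1027 / 1000 * `|S| ^+ 8 + 3 / 25 * `|S| ^+ 7.
  rewrite /kterm -kerW_norm /kerW horner_exp -/S (coef_dot P g i p) -/c.
  (* One factor [|S|] compensates the size [n sin t] of the tangential part, since
     [n |S| sin t <= 1]; seven factors are left. *)
  have hb : `|dot (coefE P g i) p| * `|S| <= 3 / 25.
    have := dot_tangent (P1 i) p1 (coefE_orth P1 g i); rewrite -/c => hb.
    have pyt := kerS_pythagoras n5 `|c|; rewrite -/S real_normK ?num_real// in pyt.
    rewrite -ler_sqr ?nnegrE ?mulr_ge0// exprMn !real_normK ?num_real//.
    apply: (@le_trans _ _ ((n%:R * (3 / 25)) ^+ 2 * (1 - c ^+ 2) * S ^+ 2)).
      rewrite ler_wpM2r ?sqr_ge0//; apply: le_trans hb _.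
      by rewrite ler_wpM2r ?subr_ge0.
    have -> : (n%:R * (3 / 25)) ^+ 2 * (1 - c ^+ 2) * S ^+ 2 =
      (3 / 25) ^+ 2 * ((n%:R * S) ^+ 2 * (1 - c ^+ 2)) by ring.
    by rewrite ler_piMr ?sqr_ge0.
  have S8 : `|S ^+ 8| = `|S| ^+ 8 by rewrite normrX.
  rewrite normrM S8.
  apply: (@le_trans _ _ ((1027 / 1000 + `|dot (coefE P g i) p|) * `|S| ^+ 8)).
    rewrite ler_wpM2r ?exprn_ge0// normrM.
    apply: (@le_trans _ _ `|coefA P g i * c + dot (coefE P g i) p|).
      by rewrite ler_piMl.
    rewrite (le_trans (ler_normD _ _))// lerD2r normrM.
    by apply: le_trans (hA i); rewrite ler_piMr.
  rewrite mulrDl lerD2l exprS mulrA ler_wpM2r// exprn_ge0//.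
have S0 : 0 <= `|S| by [].
have monoS k : `|S| ^+ k <= (929 / 1000) ^+ k.
  by apply: lerXn2r; [rewrite nnegrE normr_ge0|rewrite nnegrE; lra|exact: S1].
have p8 : `|S| ^+ 8 <= (929 / 1000) ^+ 8 by apply: monoS.
have p7 : `|S| ^+ 7 <= (929 / 1000) ^+ 7 by apply: monoS.
rewrite /certificate (bigD1 i)//= -/c (le_lt_trans (ler_normD _ _))//.
apply: le_lt_trans (lerD own (le_trans (ler_norm_sum _ _ _) far)) _.
exact: (far_const p8 p7).
Qed.

End NearFar.

(** * Existence of the certificates *)

Section DualCertificate.
Variables (R : realType) (M n : nat) (P : 'I_M -> 'rV[R]_4) (Delta : R).
Hypotheses (n5 : (5 <= n)%N) (P1 : forall i, dot (P i) (P i) = 1)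
  (D0 : 0 < Delta) (D1 : Delta <= 6 / 7) (nD : 30 / 7 <= n%:R * Delta)
  (sep : forall i j, i != j -> `|dot (P i) (P j)| <= cos Delta).
Implicit Types (p u e : 'rV[R]_4) (g : 'M[R]_(M, 4)).

Let N0 : 0 < n%:R :> R. Proof. by rewrite ltr0n (leq_trans _ n5). Qed.

(** The a priori estimate [system_bound] at [V = 0] leaves only the zero matrix. *)
Lemma interp_inj : injective (interp n P).
Proof.
suff ker0 g : interp n P g = 0 -> g = 0.
  by move=> g h e; apply/eqP; rewrite -subr_eq0; apply/eqP/ker0; rewrite linearB /= e subrr.
move=> g0; have Q0 i : certificate n P g (P i) = 0.
  by have := congr1 (fun m : 'M[R]_(M, 4) => m i ord0) g0; rewrite !mxE unlift_none.
have Q'0 i u : dot u (P i) = 0 -> certificate' n P g (P i) u = 0.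
  apply: certificate'_frame => // k.
  by have := congr1 (fun m : 'M[R]_(M, 4) => m i (lift ord0 k)) g0; rewrite !mxE liftK.
have v0 (i : 'I_M) : `|0 : R| <= 0 by rewrite normr0.
apply/row_matrixP => i; rewrite row0.
have [h1 _ h2] := system_bound n5 P1 D0 D1 nD sep (lexx 0) v0 Q0 Q'0 i.
move: h1 h2; rewrite !mulr0 expr0n /= normr_le0 => /eqP a0 e0.
have E0 : coefE P g i = 0 by apply: dot_eq0; apply/eqP; rewrite eq_le e0 dot_ge0.
by move: E0; rewrite /coefE a0 scale0r subr0.
Qed.

Lemma certificateN g p : certificate n P g (- p) = certificate n P g p.
Proof.
apply: eq_bigr => j _; rewrite !dotNr /kterm kerW_even; ring.
Qed.

Theorem dual_certificate (v : 'I_M -> R) : exists g,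
  (forall i, certificate n P g (P i) = v i) /\
  ((forall i, v i = 1 \/ v i = -1) -> forall p, dot p p = 1 ->
   (forall i, dot (P i) p ^+ 2 != 1) -> `|certificate n P g p| < 1).
Proof.
have [g hg] := interp_solve interp_inj v; exists g; split; first by move=> i; case: (hg i).
move=> hv p p1 pP.
have v1 i : `|v i| <= 1 by case: (hv i) => ->; rewrite ?normrN normr1.
have Q'0 i u : dot u (P i) = 0 -> certificate' n P g (P i) u = 0.
  by case: (hg i) => _ /(_ (P1 i)) h /h.
have sb := system_bound n5 P1 D0 D1 nD sep ler01 v1 (fun i => (hg i).1) Q'0.
have hA i : `|coefA P g i| <= 1027 / 1000 by case: (sb i) => + _ _; rewrite mulr1.
have hV i : `|coefA P g i - v i| <= 27 / 1000 by case: (sb i) => _ + _; rewrite mulr1.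
have hE i : dot (coefE P g i) (coefE P g i) <= (n%:R * (3 / 25)) ^+ 2.
  by case: (sb i) => _ _ +; rewrite mulr1.
(* A nearest node exists unless [M = 0], and then the certificate is zero. *)
have [[i hmax]|noI] := pselect (exists i : 'I_M, forall j, `|dot (P j) p| <= `|dot (P i) p|); last first.
  rewrite /certificate big1 ?normr0// => i; exfalso; apply: noI.
  exists [arg max_(j > i) `|dot (P j) p|]%O; case: Order.TotalTheory.arg_maxP => // k _ hk j.
  exact: hk.
have [hfar|hnear] := leP `|dot (P i) p| (cos (7 / 10 / n%:R)).
  exact: (far_bound n5 P1 D0 D1 nD sep hA hE p1 hmax hfar).
have near q : dot q q = 1 -> 0 <= dot (P i) q -> dot (P i) q ^+ 2 != 1 ->
    cos (7 / 10 / n%:R) < dot (P i) q -> `|certificate n P g q| < 1.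
  move=> q1 q0 qP hq; set c := dot (P i) q in q0 qP hq.
  have c2 : c ^+ 2 <= 1 by have := dot_cauchy (P i) q; rewrite P1 q1 mulr1.
  have c2' : c ^+ 2 < 1 by rewrite lt_neqAle qP.
  have c1 : c <= 1 by have := sqr_le1_norm c2; rewrite ler_norml => /andP[].
  have hc : -1 <= c <= 1 by rewrite c1 andbT (le_trans (lerN10 _)).
  pose t := acos c; have ct : cos t = c by rewrite acosK// in_itv.
  have st : sin t = Num.sqrt (1 - c ^+ 2) by rewrite sin_acos.
  have st0 : 0 < sin t by rewrite st sqrtr_gt0 subr_gt0.
  have st2 : sin t ^+ 2 = 1 - c ^+ 2 by rewrite st sqr_sqrtr// subr_ge0.
  have t0 : 0 < t.
    rewrite lt_def acos_ge0// andbT; apply: contraTneq st0 => ->.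
    by rewrite sin0 ltxx.
  (* Unit tangent at [P i] towards [q], which puts [q] at parameter [t] of a geodesic. *)
  pose u := (sin t)^-1 *: (q - c *: P i).
  have qE : q = cos t *: P i + sin t *: u.
    by rewrite /u scalerA mulfV ?gt_eqF// scale1r ct addrC subrK.
  have uP : dot u (P i) = 0.
    by rewrite /u dotZl dotDl dotNl dotZl P1 (dotC q) -/c mulr1 subrr mulr0.
  have u1 : dot u u = 1.
    rewrite /u dotZl dotZr !(dotDl, dotDr, dotNl, dotNr, dotZl, dotZr) P1 q1 (dotC q) -/c.
    rewrite (_ : 1 - c * c + _ = sin t ^+ 2); last by rewrite st2; ring.
    by field; rewrite gt_eqF.
  have nt : n%:R * t <= 7 / 10.
    rewrite mulrC -ler_pdivlMr// leNgt; apply/negP => tl; move: hq; rewrite -ct ltNge.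
    have n7 : 0 <= 7 / 10 / n%:R :> R by rewrite divr_ge0 ?(ltW N0)//; lra.
    by rewrite ler_cos_pi ?(ltW tl)//; apply: acos_lepi.
  rewrite qE; apply: (near_bound n5 P1 D0 D1 nD sep hA hE (hv i) (hV i) _ _ u1 uP t0 nt).
    by case: (hg i).
  exact: Q'0.
(* [p] and [- p] are the same rotation; the sign is chosen so that the point lies in the hemisphere
   around [P i]. *)
have [q0|q0] := leP 0 (dot (P i) p).
  by apply: near => //; rewrite ger0_norm in hnear.
rewrite -certificateN; apply: near; rewrite ?dotNr ?dotNl ?opprK//.
- by rewrite oppr_ge0 ltW.
- by rewrite sqrrN.
by rewrite ltr0_norm in hnear.
Qed.

End DualCertificate.

(** * Rotations as unit quaternions *)

Section Rotations.
Variable R : realType.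
Implicit Types (p q : 'rV[R]_4) (x y : SO3 R).

Lemma mx3_ind (Q : 'M[R]_3 -> Prop) :
  (forall a b c d e f g h i, Q (mx3 a b c d e f g h i)) -> forall x : 'M[R]_3, Q x.
Proof.
move=> H x; pose o0 : 'I_3 := 0; pose o1 : 'I_3 := lift 0 0; pose o2 : 'I_3 := lift 0 (lift 0 0).
have -> // : x = mx3 (x o0 o0) (x o0 o1) (x o0 o2) (x o1 o0) (x o1 o1) (x o1 o2)
   (x o2 o0) (x o2 o1) (x o2 o2).
by apply/matrixP => -[[|[|[|//]]] i] [[|[|[|//]]] j]; rewrite mxE /=; congr (x _ _); exact: val_inj.
Qed.

Lemma mx3_mul (a b c d e f g h i a' b' c' d' e' f' g' h' i' : R) :
  mx3 a b c d e f g h i *m mx3 a' b' c' d' e' f' g' h' i' =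
  mx3 (a * a' + b * d' + c * g') (a * b' + b * e' + c * h') (a * c' + b * f' + c * i')
      (d * a' + e * d' + f * g') (d * b' + e * e' + f * h') (d * c' + e * f' + f * i')
      (g * a' + h * d' + i * g') (g * b' + h * e' + i * h') (g * c' + h * f' + i * i').
Proof.
apply/matrixP => -[[|[|[|//]]] r] [[|[|[|//]]] s];
by rewrite !mxE !big_ord_recr big_ord0 /= !mxE /= add0r.
Qed.

Lemma mx3_tr (a b c d e f g h i : R) :
  (mx3 a b c d e f g h i)^T = mx3 a d g b e h c f i.
Proof. by apply/matrixP => -[[|[|[|//]]] r] [[|[|[|//]]] s]; rewrite !mxE. Qed.

Lemma mx3_1 : 1%:M = mx3 1 0 0 0 1 0 0 0 1 :> 'M[R]_3.
Proof. by apply/matrixP => -[[|[|[|//]]] r] [[|[|[|//]]] s]; rewrite !mxE. Qed.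

Lemma mx3_trace (a b c d e f g h i : R) : \tr (mx3 a b c d e f g h i) = a + e + i.
Proof. by rewrite /mxtrace !big_ord_recr big_ord0 /= !mxE /= add0r. Qed.

Lemma mx3_det (a b c d e f g h i : R) : \det (mx3 a b c d e f g h i) =
  a * (e * i - f * h) - b * (d * i - f * g) + c * (d * h - e * g).
Proof.
rewrite (expand_det_row _ 0) !big_ord_recr big_ord0 /= /cofactor.
rewrite !(expand_det_row _ 0) !big_ord_recr !big_ord0 /= /cofactor !det_mx11.
by rewrite !mxE /= /bump /=; ring.
Qed.

Lemma mx3_inj (a b c d e f g h i a' b' c' d' e' f' g' h' i' : R) :
  mx3 a b c d e f g h i = mx3 a' b' c' d' e' f' g' h' i' ->
  [/\ [/\ a = a', b = b' & c = c'], [/\ d = d', e = e' & f = f'] & [/\ g = g', h = h' & i = i']].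
Proof.
move=> E; pose o0 : 'I_3 := 0; pose o1 : 'I_3 := lift 0 0; pose o2 : 'I_3 := lift 0 (lift 0 0).
have H r s := congr1 (fun m : 'M[R]_3 => m r s) E.
by move: (H o0 o0) (H o0 o1) (H o0 o2) (H o1 o0) (H o1 o1) (H o1 o2) (H o2 o0) (H o2 o1) (H o2 o2);
   rewrite !mxE /= => -> -> -> -> -> -> -> -> ->.
Qed.

Definition rotq q : 'M[R]_3 :=
  let: (a, b, c, d) := (q 0 0, q 0 (lift 0 0), q 0 (lift 0 (lift 0 0)),
    q 0 (lift 0 (lift 0 (lift 0 0)))) in
  mx3 (a ^+ 2 + b ^+ 2 - c ^+ 2 - d ^+ 2) (2 * (b * c - a * d)) (2 * (b * d + a * c))
      (2 * (b * c + a * d)) (a ^+ 2 - b ^+ 2 + c ^+ 2 - d ^+ 2) (2 * (c * d - a * b))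
      (2 * (b * d - a * c)) (2 * (c * d + a * b)) (a ^+ 2 - b ^+ 2 - c ^+ 2 + d ^+ 2).

Lemma rotq_v4 a b c d : rotq (v4 a b c d) =
  mx3 (a ^+ 2 + b ^+ 2 - c ^+ 2 - d ^+ 2) (2 * (b * c - a * d)) (2 * (b * d + a * c))
      (2 * (b * c + a * d)) (a ^+ 2 - b ^+ 2 + c ^+ 2 - d ^+ 2) (2 * (c * d - a * b))
      (2 * (b * d - a * c)) (2 * (c * d + a * b)) (a ^+ 2 - b ^+ 2 - c ^+ 2 + d ^+ 2).
Proof. by rewrite /rotq !mxE. Qed.

Lemma rotqN q : rotq (- q) = rotq q.
Proof. by rewrite /rotq !mxE; congr mx3; ring. Qed.

Lemma rotq_trace p q : \tr ((rotq p)^T *m rotq q) = 4 * dot p q ^+ 2 - dot p p * dot q q.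
Proof.
elim/v4_ind: p => a b c d; elim/v4_ind: q => a' b' c' d'.
by rewrite !rotq_v4 mx3_tr mx3_mul mx3_trace !dot_v4; ring.
Qed.

(** Product of the half-angle quaternions of the three factors of [euler_mx]. *)
Definition euler_quat (abg : R * R * R) : 'rV[R]_4 :=
  let: (a, b, g) := abg in
  v4 (cos (b / 2) * cos ((a + g) / 2)) (sin (b / 2) * cos ((a - g) / 2))
     (sin (b / 2) * sin ((a - g) / 2)) (cos (b / 2) * sin ((a + g) / 2)).

Lemma euler_quat_unit abg : dot (euler_quat abg) (euler_quat abg) = 1.
Proof.
case: abg => -[a b] g; rewrite /euler_quat dot_v4.
transitivity (cos (b / 2) ^+ 2 * (cos ((a + g) / 2) ^+ 2 + sin ((a + g) / 2) ^+ 2) +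
  sin (b / 2) ^+ 2 * (cos ((a - g) / 2) ^+ 2 + sin ((a - g) / 2) ^+ 2)); first by ring.
by rewrite !cos2Dsin2 !mulr1 cos2Dsin2.
Qed.

Lemma half_angle (t : R) : cos t = cos (t / 2) ^+ 2 - sin (t / 2) ^+ 2 /\
  sin t = 2 * (sin (t / 2) * cos (t / 2)).
Proof. by rewrite {1 4}(splitr t) cosD sinD; split; ring. Qed.

Lemma RotZ_rotq t : RotZ t = rotq (v4 (cos (t / 2)) 0 0 (sin (t / 2))).
Proof.
have [c s] := half_angle t; have e := cos2Dsin2 (t / 2).
by rewrite /RotZ rotq_v4 c s; congr mx3; first [by ring | by rewrite -[LHS]e; ring].
Qed.

Lemma RotX_rotq t : RotX t = rotq (v4 (cos (t / 2)) (sin (t / 2)) 0 0).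
Proof.
have [c s] := half_angle t; have e := cos2Dsin2 (t / 2).
by rewrite /RotX rotq_v4 c s; congr mx3; first [by ring | by rewrite -[LHS]e; ring].
Qed.

Lemma euler_mx_rotq abg : euler_mx abg = rotq (euler_quat abg).
Proof.
case: abg => -[a b] g; rewrite /euler_mx RotZ_rotq RotX_rotq RotZ_rotq /=.
have -> : (a + g) / 2 = a / 2 + g / 2 by field.
have -> : (a - g) / 2 = a / 2 - g / 2 by field.
rewrite (cosD (a / 2) (g / 2)) (sinD (a / 2) (g / 2)) (cosB (a / 2)) (sinB (a / 2)) !rotq_v4 !mx3_mul; congr mx3; ring.
Qed.

End Rotations.

Section EulerAngles.
Variable R : realType.
Implicit Types (p q : 'rV[R]_4).

Lemma angle_exists (a b : R) : a ^+ 2 + b ^+ 2 = 1 -> exists t, cos t = a /\ sin t = b.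
Proof.
move=> e; have a1 : -1 <= a <= 1.
  by rewrite -ler_norml; apply: sqr_le1_norm; have := sqr_ge0 b; lra.
have sa : sin (acos a) = `|b|.
  by rewrite sin_acos// (_ : 1 - a ^+ 2 = b ^+ 2) ?sqrtr_sqr// -e; ring.
have [b0|b0] := leP 0 b.
  by exists (acos a); rewrite acosK ?in_itv// sa ger0_norm.
exists (- acos a); rewrite cosN sinN acosK ?in_itv// sa ltr0_norm ?opprK//.
Qed.

Lemma is_SO3_mul (x y : 'M[R]_3) : is_SO3 x -> is_SO3 y -> is_SO3 (x *m y).
Proof.
move=> /andP[/eqP x1 /eqP x2] /andP[/eqP y1 /eqP y2]; apply/andP; split; apply/eqP.
  by rewrite trmx_mul -mulmxA (mulmxA _ x y) x1 mul1mx.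
by rewrite det_mulmx x2 y2 mulr1.
Qed.

Lemma is_SO3_RotZ (t : R) : is_SO3 (RotZ t).
Proof.
have e := cos2Dsin2 t; apply/andP; split; apply/eqP.
  by rewrite /RotZ mx3_tr mx3_mul mx3_1; congr mx3; first [by ring | by rewrite -[RHS]e; ring].
by rewrite /RotZ mx3_det -[RHS]e; ring.
Qed.

Lemma is_SO3_RotX (t : R) : is_SO3 (RotX t).
Proof.
have e := cos2Dsin2 t; apply/andP; split; apply/eqP.
  by rewrite /RotX mx3_tr mx3_mul mx3_1; congr mx3; first [by ring | by rewrite -[RHS]e; ring].
by rewrite /RotX mx3_det -[RHS]e; ring.
Qed.

Lemma RotZK (t : R) (x : 'M[R]_3) : RotZ t *m (RotZ (- t) *m x) = x.
Proof.
have e := cos2Dsin2 t; rewrite mulmxA (_ : RotZ t *m _ = 1%:M) ?mul1mx//.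
by rewrite /RotZ mx3_mul mx3_1 cosN sinN; congr mx3; first [by ring | by rewrite -[RHS]e; ring].
Qed.

Lemma RotXK (t : R) (x : 'M[R]_3) : RotX t *m (RotX (- t) *m x) = x.
Proof.
have e := cos2Dsin2 t; rewrite mulmxA (_ : RotX t *m _ = 1%:M) ?mul1mx//.
by rewrite /RotX mx3_mul mx3_1 cosN sinN; congr mx3; first [by ring | by rewrite -[RHS]e; ring].
Qed.

Lemma RotZN_mul (t a b c d e f g h i : R) : RotZ (- t) *m mx3 a b c d e f g h i =
  mx3 (cos t * a + sin t * d) (cos t * b + sin t * e) (cos t * c + sin t * f)
      (cos t * d - sin t * a) (cos t * e - sin t * b) (cos t * f - sin t * c) g h i.
Proof. by rewrite /RotZ mx3_mul cosN sinN; congr mx3; ring. Qed.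

Lemma RotXN_mul (t a b c d e f g h i : R) : RotX (- t) *m mx3 a b c d e f g h i =
  mx3 a b c (cos t * d + sin t * g) (cos t * e + sin t * h) (cos t * f + sin t * i)
      (cos t * g - sin t * d) (cos t * h - sin t * e) (cos t * i - sin t * f).
Proof. by rewrite /RotX mx3_mul cosN sinN; congr mx3; ring. Qed.

Lemma SO3_fix_e3 (a b d e g h : R) : is_SO3 (mx3 a b 0 d e 0 g h 1) ->
  exists t, mx3 a b 0 d e 0 g h 1 = RotZ t.
Proof.
move=> /andP[/eqP + /eqP]; rewrite mx3_tr mx3_mul mx3_1 mx3_det.
move=> /mx3_inj[[h1 h2 h3] [_ _ h4] _] hd.
have g0 : g = 0 by lra.
have k0 : h = 0 by lra.
rewrite g0 k0 in h1 h2 hd *.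
have [t [ct st]] : exists t, cos t = a /\ sin t = d by apply: angle_exists; lra.
exists t; rewrite /RotZ ct st.
have bd : b = - d.
  transitivity (b * (a * a + d * d + 0 * 0)); first by rewrite h1 mulr1.
  transitivity (a * (a * b + d * e + 0 * 0)
     - d * (a * (e * 1 - 0 * 0) - b * (d * 1 - 0 * 0) + 0 * (d * 0 - e * 0))); first by ring.
  by rewrite h2 hd; ring.
have ea : e = a.
  transitivity (e * (a * a + d * d + 0 * 0)); first by rewrite h1 mulr1.
  transitivity (d * (a * b + d * e + 0 * 0)
     + a * (a * (e * 1 - 0 * 0) - b * (d * 1 - 0 * 0) + 0 * (d * 0 - e * 0))); first by ring.
  by rewrite h2 hd; ring.
by rewrite bd ea.
Qed.

(** Elimination on the third column: a rotation about Z clears its first entry, one about X then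
    brings it to the third unit vector, and what is left fixes that vector. *)
Lemma euler_exists (x : 'M[R]_3) : is_SO3 x -> exists abg, euler_mx abg = x.
Proof.
elim/mx3_ind: x => a b c d e f g h i xS.
have [al hal] : exists al, cos al * c + sin al * f = 0.
  have [c0|n0] := eqVneq (c ^+ 2 + f ^+ 2) 0.
    exists 0; rewrite cos0 sin0 mul0r mul1r addr0; apply/eqP; rewrite -sqrf_eq0.
    by apply/eqP; have := sqr_ge0 c; have := sqr_ge0 f; lra.
  set r2 := c ^+ 2 + f ^+ 2 in n0; have r0 : 0 < r2.
    by rewrite lt_def n0 addr_ge0 ?sqr_ge0.
  pose r := Num.sqrt r2; have rr : r ^+ 2 = r2 by rewrite sqr_sqrtr ?ltW.
  have [t [ct st]] : exists t, cos t = - f / r /\ sin t = c / r.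
    by apply: angle_exists; rewrite !expr_div_n sqrrN -mulrDl addrC -/r2 rr mulfV.
  by exists t; rewrite ct st; ring.
have := is_SO3_mul (is_SO3_RotZ (- al)) xS; have := RotZK al (mx3 a b c d e f g h i).
rewrite RotZN_mul hal; move: (cos al * a + _) (cos al * b + _) (cos al * d - _) (cos al * e - _)
  (cos al * f - _) => a1 b1 d1 e1 f1 xE yS.
have fi : i ^+ 2 + (- f1) ^+ 2 = 1.
  move: yS => /andP[/eqP + _]; rewrite mx3_tr mx3_mul mx3_1 => /mx3_inj[_ _ [_ _ h1]].
  by rewrite -h1; ring.
have [be [cb sb]] := angle_exists fi.
have := is_SO3_mul (is_SO3_RotX (- be)) yS; have := RotXK be (mx3 a1 b1 0 d1 e1 f1 g h i).
rewrite RotXN_mul (_ : cos be * f1 + sin be * i = 0); last by rewrite cb sb; ring.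
rewrite (_ : cos be * i - sin be * f1 = 1); last by rewrite cb sb -fi; ring.
move=> yE /SO3_fix_e3[ga zE].
by exists (al, be, ga); rewrite /euler_mx /= -mulmxA -zE yE xE.
Qed.

(** The lift uses the same chosen Euler angles as the Wigner functions, so that both can be compared
    as functions of these angles; its sign is arbitrary. *)
Definition quat (x : SO3 R) : 'rV[R]_4 := euler_quat (euler_angles x).

Lemma quat_unit x : dot (quat x) (quat x) = 1.
Proof. exact: euler_quat_unit. Qed.

Lemma rotq_quat x : rotq (quat x) = sval x.
Proof.
rewrite /quat -euler_mx_rotq /euler_angles.
have [abg Habg] := euler_exists (svalP x).
by have /= := @getPex _ [set abg | euler_mx abg = sval x]%classic (ex_intro _ abg Habg).
Qed.

Lemma rot_angle_quat x y : rot_angle (invmx (sval y) *m sval x) =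
  acos (2 * dot (quat y) (quat x) ^+ 2 - 1).
Proof.
have : is_SO3 (sval y) by exact: (svalP y).
move=> /andP[/eqP y1 _]; have yu : sval y \in unitmx.
  by have /mulmx1_unit[] := y1.
have -> : invmx (sval y) = (sval y)^T by rewrite -[RHS]mulmx1 -(mulmxV yu) mulmxA y1 mul1mx.
rewrite /rot_angle -!rotq_quat rotq_trace !quat_unit; congr acos.
by field.
Qed.

Lemma quat_sep x y (D : R) : 0 <= D -> 2 * D <= rot_angle (invmx (sval y) *m sval x) ->
  `|dot (quat y) (quat x)| <= cos D.
Proof.
move=> D0; rewrite rot_angle_quat; set c := dot _ _ => h.
have c1 : c ^+ 2 <= 1 by have := dot_cauchy (quat y) (quat x); rewrite !quat_unit mulr1.
have hc : -1 <= 2 * c ^+ 2 - 1 <= 1 by have c0 := sqr_ge0 c; apply/andP; split; lra.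
have api := acos_lepi hc.
have D2 : 0 <= 2 * D by lra.
have := ler_cos_pi D2 h api; rewrite acosK ?in_itv//.
rewrite (_ : 2 * D = D *+ 2); last by ring.
rewrite cos_mulr2n => hcos.
have cD0 : 0 <= cos D by apply: cos_ge0_pihalf; lra.
rewrite -ler_sqr ?nnegrE// real_normK ?num_real//; lra.
Qed.

Lemma quat_inj x y : dot (quat x) (quat y) ^+ 2 = 1 -> x = y.
Proof.
have xy0 (u v : 'rV[R]_4) : dot u u = 1 -> dot v v = 1 -> dot u v = 1 -> u = v.
  move=> u1 v1 uv; apply/eqP; rewrite -subr_eq0; apply/eqP/dot_eq0.
  by rewrite !(dotDl, dotDr, dotNl, dotNr) u1 v1 (dotC v u) uv; ring.
move=> h; apply: val_inj; rewrite /= -!rotq_quat.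
move/eqP: h; rewrite sqrf_eq1 => /orP[/eqP h|/eqP h].
  by congr rotq; apply: xy0; rewrite ?quat_unit.
rewrite -[rotq (quat y)]rotqN; congr rotq; apply: xy0; rewrite ?quat_unit//.
  by rewrite dotNl dotNr opprK quat_unit.
by rewrite dotNr h opprK.
Qed.

End EulerAngles.

(** * Wigner functions as polynomials in the quaternion *)

Section HalfAngleFunctions.
Variable R : realType.
Implicit Types (tau : R -> R) (i j l : nat) (u v k m : int).

(* For [i = |u| + 2 p] and [j = |v| + 2 q], with [tau] among [cos] and [sin], these span
   the homogeneous polynomials of degree [i + j] in the unit quaternion. *)
Definition efun tau i j u v (x : SO3 R) : R :=
  let: (a, b, g) := euler_angles x in
  cos (b / 2) ^+ i * sin (b / 2) ^+ j *
  tau (u%:~R * ((a + g) / 2) + v%:~R * ((a - g) / 2)).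

(* [tau = cos] gives the real part of a Wigner function, [tau = sin] the opposite of
   its imaginary part. *)
Definition wfun tau l k m (x : SO3 R) : R :=
  let: (a, b, g) := euler_angles x in
  tau (k%:~R * a + m%:~R * g) * wigner_d l k m b.

Record lin_closed (Pi : (SO3 R -> R) -> Prop) : Prop := LinClosed {
  lin0 : Pi (fun=> 0);
  linD : forall f g, Pi f -> Pi g -> Pi (fun x => f x + g x);
  linZ : forall a f, Pi f -> Pi (fun x => a * f x) }.

Lemma lin_sum Pi (I : finType) (J : pred I) (F : I -> SO3 R -> R) : lin_closed Pi ->
  (forall s, J s -> Pi (F s)) -> Pi (fun x => \sum_(s | J s) F s x).
Proof.
move=> [P0 PD PZ] H.
have -> : (fun x => \sum_(s | J s) F s x) = \sum_(s | J s) F s.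
  by apply/boolp.funext => x; rewrite fct_sumE.
by elim/big_ind: _ => // f g Pf Pg; exact: PD.
Qed.

Lemma efun_pythagoras tau i j u v x :
  efun tau i.+2 j u v x + efun tau i j.+2 u v x = efun tau i j u v x.
Proof.
rewrite /efun; case: (euler_angles x) => -[a b] g.
rewrite -(addn2 i) -(addn2 j) !exprD; set z := tau _; set c := cos _; set s := sin _.
transitivity ((c ^+ 2 + s ^+ 2) * (c ^+ i * s ^+ j * z)); first by ring.
by rewrite cos2Dsin2 mul1r.
Qed.

Section Triangular.
Variables (Pi : (SO3 R -> R) -> Prop) (tau : R -> R).
Hypothesis PiL : lin_closed Pi.

Let F r u v q := efun tau (absz u + 2 * (r - q)) (absz v + 2 * q) u v.

Lemma efun_alternate r u v :
  (forall q, (q < r)%N -> Pi (efun tau (absz u + 2 * (r.-1 - q)) (absz v + 2 * q) u v)) ->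
  forall q, (q <= r)%N -> Pi (fun x => F r u v q x - (-1) ^+ q * F r u v 0 x).
Proof.
move=> low; elim=> [_|q IH qr].
  have -> : (fun x => F r u v 0 x - (-1) ^+ 0 * F r u v 0 x) = fun=> 0.
    by apply/boolp.funext => x; rewrite expr0 mul1r subrr.
  exact: lin0.
have -> : (fun x => F r u v q.+1 x - (-1) ^+ q.+1 * F r u v 0 x) =
  (fun x => efun tau (absz u + 2 * (r.-1 - q)) (absz v + 2 * q) u v x
     + (-1) * (F r u v q x - (-1) ^+ q * F r u v 0 x)).
  apply/boolp.funext => x.
  rewrite -efun_pythagoras (_ : (absz u + 2 * (r.-1 - q)).+2 = (absz u + 2 * (r - q))%N); last by lia.
  rewrite {1}/F (_ : (absz v + 2 * q).+2 = (absz v + 2 * q.+1)%N); last by lia.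
  rewrite (_ : (r.-1 - q)%N = (r - q.+1)%N); last by lia.
  by rewrite -/(F r u v q x) exprS; ring.
by apply: linD => //; [exact: low|apply: linZ => //; apply: IH; exact: ltnW].
Qed.

Lemma factz_gt0 (z : int) : 0 < factz R z.
Proof. by rewrite /factz ltr0n fact_gt0. Qed.

(** All summands of Wigner's formula share the frequencies [u], [v] and the degree [2 l]; only the
    split [q] between cosines and sines varies, with alternating signs. [eps] collects the sign
    independent of the summand. For [v < 0] the admissible summands start at [|v|], hence the shift
    of [q]. *)
Lemma wfun_triangular l k m : (absz k <= l)%N -> (absz m <= l)%N ->
  let u : int := k + m in let v : int := k - m in
  let r := ((2 * l - absz u - absz v)./2)%N in
  [/\ (absz u + absz v + 2 * r = 2 * l)%N &
  exists2 w : 'I_(2 * l).+1 -> R, 0 < \sum_s w s &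
  exists eps : R, eps != 0 /\ exists q : 'I_(2 * l).+1 -> nat,
  (forall s, w s = 0 \/ (q s <= r)%N) /\
  forall x, wfun tau l k m x = eps * \sum_s w s * ((-1) ^+ q s * F r u v (q s) x)].
Proof.
move=> kl ml u v r.
have hr : (absz u + absz v + 2 * r = 2 * l)%N by rewrite /r /u /v; lia.
split=> //; move: r hr => r hr.
pose cond (s : 'I_(2 * l).+1) := [&& (0 <= l%:Z + m - s%:Z)%R, (0 <= k - m + s%:Z)%R
          & (0 <= l%:Z - k - s%:Z)%R].
pose w (s : 'I_(2 * l).+1) : R := if cond s then
  Num.sqrt (factz R (l%:Z + k) * factz R (l%:Z - k) * factz R (l%:Z + m) * factz R (l%:Z - m))
  / (factz R (l%:Z + m - s%:Z) * factz R s%:Z * factz R (k - m + s%:Z) * factz R (l%:Z - k - s%:Z))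
  else 0.
have wpos s : cond s -> 0 < w s.
  move=> cs; rewrite /w cs divr_gt0 ?sqrtr_gt0 ?mulr_gt0 ?factz_gt0//.
have w0 s : 0 <= w s by case cs : (cond s); [exact/ltW/wpos|rewrite /w cs].
exists w.
  (* The first admissible summand; its weight makes the sum positive. *)
  have s0 : ((if (0 <= v)%R then 0 else absz v) < (2 * l).+1)%N by rewrite /v; case: ifP; lia.
  rewrite (bigD1 (Ordinal s0))//= ltr_pwDl//; last by rewrite sumr_ge0.
  apply: wpos; rewrite /cond /= /v; case: ifP; lia.
exists (if (0 <= v)%R then (-1) ^+ absz v else 1); split.
  by case: ifP => _; rewrite ?oner_neq0// expf_neq0// oppr_eq0 oner_neq0.
exists (fun s : 'I_(2 * l).+1 => if (0 <= v)%R then (s : nat) else (s - absz v)%N); split.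
  move=> s; case cs : (cond s); last by left; rewrite /w cs.
  by right; move: cs hr; rewrite /cond /u /v; case: ifP; lia.
move=> x; rewrite /wfun /F /efun; case: (euler_angles x) => -[a b] g.
have -> : k%:~R * a + m%:~R * g = u%:~R * ((a + g) / 2) + v%:~R * ((a - g) / 2).
  by rewrite /u /v !intrD intrN; field.
set z := tau _; rewrite /wigner_d !mulr_sumr; apply: eq_bigr => s _.
rewrite -/(cond s) /w; case cs: (cond s); last by rewrite !(mul0r, mulr0).
have es : absz (2 * l%:Z + m - k - 2 * s%:Z)%R =
    (absz u + 2 * (r - (if (0 <= v)%R then (s : nat) else (s - absz v)%N)))%N.
  by move: cs hr; rewrite /cond /u /v; case: ifP; lia.
have fs : absz (k - m + 2 * s%:Z)%R =
    (absz v + 2 * (if (0 <= v)%R then (s : nat) else (s - absz v)%N))%N.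
  by move: cs hr; rewrite /cond /u /v; case: ifP; lia.
have sgn : (-1) ^+ absz (k - m + s%:Z)%R =
    (if (0 <= v)%R then (-1) ^+ absz v else 1) * (-1) ^+ (if (0 <= v)%R then (s : nat) else (s - absz v)%N) :> R.
  case: ifP => v0.
    rewrite -exprD (_ : absz (k - m + s%:Z)%R = (absz v + s)%N)//.
    by move: cs v0; rewrite /cond /v; lia.
  rewrite mul1r (_ : absz (k - m + s%:Z)%R = (s - absz v)%N)//.
  by move: cs v0; rewrite /cond /v; lia.
rewrite es fs sgn; ring.
Qed.

(* Modulo lower degree, [cos ^ 2 = - sin ^ 2]: this cancels the alternating signs in
   Wigner's sum, which becomes a nonzero multiple of a single monomial. *)
Lemma efun_of_wfun L :
  (forall l k m, (l <= L)%N -> (absz k <= l)%N -> (absz m <= l)%N -> Pi (wfun tau l k m)) ->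
  forall l u v p q, (l <= L)%N -> (absz u + 2 * p + (absz v + 2 * q) = 2 * l)%N ->
  Pi (efun tau (absz u + 2 * p) (absz v + 2 * q) u v).
Proof.
move=> HW; elim=> [|l IH] u v p q lL e.
  have [u0 v0 p0 q0] : [/\ u = 0, v = 0, p = 0%N & q = 0%N] by split; lia.
  have := HW 0%N 0 0 lL isT isT; rewrite u0 v0 p0 q0.
  suff -> : wfun tau 0 0 0 = efun tau (absz 0%Z + 2 * 0) (absz 0%Z + 2 * 0) 0 0 by [].
  apply/boolp.funext => x; rewrite /wfun /efun; case: (euler_angles x) => -[a b] g.
  rewrite !mul0r /wigner_d big_ord_recr big_ord0 /= /factz /= !fact0.
  by rewrite !mul1r sqrtr1 !expr0; field.
pose k := ((u + v) %/ 2)%Z; pose m := ((u - v) %/ 2)%Z.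
have uE : u = k + m by rewrite /k /m; lia.
have vE : v = k - m by rewrite /k /m; lia.
have kl : (absz k <= l.+1)%N by lia.
have ml : (absz m <= l.+1)%N by lia.
have [hr [w wpos [eps [eps0 [qs [hq wE]]]]]] := wfun_triangular kl ml.
rewrite -uE -vE in hr hq wE; set r := (_./2)%N in hr hq wE.
have rpq : r = (p + q)%N by lia.
have low s : (s < r)%N -> Pi (efun tau (absz u + 2 * (r.-1 - s)) (absz v + 2 * s) u v).
  by move=> sr; apply: IH; [exact: ltnW|lia].
have alt := efun_alternate low.
have F0 : Pi (F r u v 0).
  have -> : F r u v 0 = fun x => (eps * \sum_s w s)^-1 * (wfun tau l.+1 k m x +
     (- eps) * \sum_s (w s * (-1) ^+ qs s) * (F r u v (qs s) x - (-1) ^+ qs s * F r u v 0 x)).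
    apply/boolp.funext => x; rewrite wE mulNr -mulrBr -sumrB.
    have -> : \sum_s (w s * ((-1) ^+ qs s * F r u v (qs s) x) -
      w s * (-1) ^+ qs s * (F r u v (qs s) x - (-1) ^+ qs s * F r u v 0 x)) =
      (\sum_s w s) * F r u v 0 x.
      rewrite mulr_suml; apply: eq_bigr => s _.
      transitivity (w s * ((-1) ^+ qs s * (-1) ^+ qs s) * F r u v 0 x); first by ring.
      by rewrite -expr2 sqrr_sign mulr1.
    by rewrite [eps * (_ * _)]mulrA mulKf// mulf_neq0// gt_eqF.
  apply: linZ => //; apply: linD => //; first exact: HW.
  apply: linZ => //; apply: lin_sum => // s _; case: (hq s) => [ws0|qr].
    have -> : (fun x => w s * (-1) ^+ qs s * (F r u v (qs s) x - (-1) ^+ qs s * F r u v 0 x))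
      = fun=> 0 by apply/boolp.funext => x; rewrite ws0 !mul0r.
    exact: lin0.
  by apply: linZ => //; exact: alt.
have qr : (q <= r)%N by lia.
have -> : efun tau (absz u + 2 * p) (absz v + 2 * q) u v =
  fun x => (F r u v q x - (-1) ^+ q * F r u v 0 x) + (-1) ^+ q * F r u v 0 x.
  by apply/boolp.funext => x; rewrite subrK /F; congr efun; lia.
apply: linD => //; [exact: alt|exact: linZ].
Qed.

End Triangular.
End HalfAngleFunctions.

(** * The certificate as a combination of half-angle functions *)

Section Span.
Variable R : realType.
Implicit Types (tau : R -> R) (i j l d : nat) (u v k m : int) (f : SO3 R -> R).

(** The frequencies that a product of [i] half-angle factors can have: of the parity of [i] and at
    most [i] in absolute value. *)
Definition adm i u := exists p, i = (absz u + 2 * p)%N.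

Lemma adm_succ i u : adm i u -> adm i.+1 (u + 1) /\ adm i.+1 (u - 1).
Proof.
move=> [p e]; split.
  by exists (if (0 <= u)%R then p else p.+1); case: ifP; lia.
by exists (if (0 < u)%R then p.+1 else p); case: ifP; lia.
Qed.

(** A linear span encoded as the intersection of all linearly closed classes: it applies directly to
    a predicate such as equality of two pairings, with no explicit coefficients. *)
Definition espan d f := forall Pi, lin_closed Pi ->
  (forall i j u v, adm i u -> adm j v -> (i + j = d)%N ->
     Pi (efun cos i j u v) /\ Pi (efun sin i j u v)) -> Pi f.

Lemma espan_lin d : lin_closed (espan d).
Proof.
split=> [Pi L _|f g hf hg Pi L H|a f hf Pi L H]; first exact: lin0.
  by apply: linD => //; [exact: hf|exact: hg].
by apply: linZ => //; exact: hf.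
Qed.

Lemma lin_comb Pi (L : lin_closed Pi) a b f g : Pi f -> Pi g ->
  Pi (fun x => a * f x + b * g x).
Proof. by move=> hf hg; apply: (linD L); apply: (linZ L). Qed.

(** Product-to-sum formulas. Coordinates 0 and 3 of the quaternion shift the frequency [u] by one, 1
    and 2 shift [v]; coordinates 2 and 3 contain sines of these angles and exchange [cos] and
    [sin]. *)
Lemma efun_mul (c : 'I_4) i j u v :
  exists i' j' u' v' u'' v'', (adm i u -> adm j v -> [/\ adm i' u', adm j' v', adm i' u'', adm j' v''
     & (i' + j' = (i + j).+1)%N]) /\
  exists a b a' b' : R,
  forall x : SO3 R,
    quat x 0 c * efun cos i j u v x = a * efun (if (c == 0) || (c == 1) then cos else sin) i' j' u' v' x +
      b * efun (if (c == 0) || (c == 1) then cos else sin) i' j' u'' v'' x /\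
    quat x 0 c * efun sin i j u v x = a' * efun (if (c == 0) || (c == 1) then sin else cos) i' j' u' v' x +
      b' * efun (if (c == 0) || (c == 1) then sin else cos) i' j' u'' v'' x.
Proof.
have E (A B : R) : [/\ cos A * cos B = (cos (A + B) + cos (A - B)) / 2,
    sin A * cos B = (sin (A + B) + sin (A - B)) / 2,
    cos A * sin B = (sin (A + B) - sin (A - B)) / 2 &
    sin A * sin B = (cos (A - B) - cos (A + B)) / 2].
  by rewrite cosD cosB sinD sinB; split; field.
have D1 (w : int) : (w + 1)%:~R = w%:~R + 1 :> R by rewrite intrD.
have D2 (w : int) : (w - 1)%:~R = w%:~R - 1 :> R by rewrite intrB.
case: c => -[|[|[|[|//]]]] hc.
- exists i.+1, j, (u + 1), v, (u - 1), v; split.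
    by move=> /adm_succ[? ?] ?; split=> //; rewrite addSn.
  exists (1/2), (1/2), (1/2), (1/2) => x; rewrite /quat /efun /euler_quat.
  case: (euler_angles x) => -[a b] g; rewrite !mxE /= D1 D2 !exprS.
  set A := u%:~R * _ + _; set B := (a + g) / 2.
  rewrite (_ : (u%:~R + 1) * B + _ = A + B); last by rewrite /A /B; ring.
  rewrite (_ : (u%:~R - 1) * B + _ = A - B); last by rewrite /A /B; ring.
  have [E1 E2 E3 E4] := E A B; set C := cos (b / 2); set S := sin (b / 2).
  split.
    by transitivity (C * C ^+ i * S ^+ j * (cos A * cos B)); [ring|rewrite E1; field].
  by transitivity (C * C ^+ i * S ^+ j * (sin A * cos B)); [ring|rewrite E2; field].
- exists i, j.+1, u, (v + 1), u, (v - 1); split.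
    by move=> ? /adm_succ[? ?]; split=> //; rewrite addnS.
  exists (1/2), (1/2), (1/2), (1/2) => x; rewrite /quat /efun /euler_quat.
  case: (euler_angles x) => -[a b] g; rewrite !mxE /= D1 D2 !exprS.
  set A := u%:~R * _ + v%:~R * _; set B := (a - g) / 2.
  rewrite (_ : _ + (v%:~R + 1) * B = A + B); last by rewrite /A /B; ring.
  rewrite (_ : _ + (v%:~R - 1) * B = A - B); last by rewrite /A /B; ring.
  have [E1 E2 E3 E4] := E A B; set C := cos (b / 2); set S := sin (b / 2).
  split.
    by transitivity (C ^+ i * (S * S ^+ j) * (cos A * cos B)); [ring|rewrite E1; field].
  by transitivity (C ^+ i * (S * S ^+ j) * (sin A * cos B)); [ring|rewrite E2; field].
- exists i, j.+1, u, (v + 1), u, (v - 1); split.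
    by move=> ? /adm_succ[? ?]; split=> //; rewrite addnS.
  exists (1/2), (-1/2), (-1/2), (1/2) => x; rewrite /quat /efun /euler_quat.
  case: (euler_angles x) => -[a b] g; rewrite !mxE /= D1 D2 !exprS.
  set A := u%:~R * _ + v%:~R * _; set B := (a - g) / 2.
  rewrite (_ : _ + (v%:~R + 1) * B = A + B); last by rewrite /A /B; ring.
  rewrite (_ : _ + (v%:~R - 1) * B = A - B); last by rewrite /A /B; ring.
  have [E1 E2 E3 E4] := E A B; set C := cos (b / 2); set S := sin (b / 2).
  split.
    by transitivity (C ^+ i * (S * S ^+ j) * (cos A * sin B)); [ring|rewrite E3; field].
  by transitivity (C ^+ i * (S * S ^+ j) * (sin A * sin B)); [ring|rewrite E4; field].
exists i.+1, j, (u + 1), v, (u - 1), v; split.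
  by move=> /adm_succ[? ?] ?; split=> //; rewrite addSn.
exists (1/2), (-1/2), (-1/2), (1/2) => x; rewrite /quat /efun /euler_quat.
case: (euler_angles x) => -[a b] g; rewrite !mxE /= D1 D2 !exprS.
set A := u%:~R * _ + _; set B := (a + g) / 2.
rewrite (_ : (u%:~R + 1) * B + _ = A + B); last by rewrite /A /B; ring.
rewrite (_ : (u%:~R - 1) * B + _ = A - B); last by rewrite /A /B; ring.
have [E1 E2 E3 E4] := E A B; set C := cos (b / 2); set S := sin (b / 2).
split.
  by transitivity (C * C ^+ i * S ^+ j * (cos A * sin B)); [ring|rewrite E3; field].
by transitivity (C * C ^+ i * S ^+ j * (sin A * sin B)); [ring|rewrite E4; field].
Qed.

Lemma espan_coord d f (c : 'I_4) : espan d f -> espan d.+1 (fun x => quat x 0 c * f x).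
Proof.
(* The span is tested on the class of functions that land in [Pi] after multiplication by the
   coordinate. *)
move=> hf Pi L H; apply: (hf (fun h => Pi (fun x => quat x 0 c * h x))).
  split=> [|h1 h2 P1 P2|a h1 P1].
  - rewrite (_ : (fun _ => _) = fun=> 0); first exact: lin0.
    by apply/boolp.funext => x; rewrite mulr0.
  - rewrite (_ : (fun _ => _) = fun x => quat x 0 c * h1 x + quat x 0 c * h2 x).
      exact: linD.
    by apply/boolp.funext => x; rewrite mulrDr.
  rewrite (_ : (fun _ => _) = fun x => a * (quat x 0 c * h1 x)); first exact: linZ.
  by apply/boolp.funext => x; rewrite mulrCA.
move=> i j u v iu jv ijd.
have [i' [j' [u' [v' [u'' [v'' [hadm [a [b [a' [b' hE]]]]]]]]]]] := efun_mul c i j u v.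
have [i1 j1 i2 j2 hij] := hadm iu jv; rewrite ijd in hij.
have [C1 S1] := H _ _ _ _ i1 j1 hij; have [C2 S2] := H _ _ _ _ i2 j2 hij.
split.
  rewrite (_ : (fun _ => _) = fun x => a * efun (if (c == 0) || (c == 1) then cos else sin) i' j' u' v' x +
      b * efun (if (c == 0) || (c == 1) then cos else sin) i' j' u'' v'' x).
    by case: ifP => _; apply: lin_comb.
  by apply/boolp.funext => x; case: (hE x).
rewrite (_ : (fun _ => _) = fun x => a' * efun (if (c == 0) || (c == 1) then sin else cos) i' j' u' v' x +
      b' * efun (if (c == 0) || (c == 1) then sin else cos) i' j' u'' v'' x).
  by case: ifP => _; apply: lin_comb.
by apply/boolp.funext => x; case: (hE x).
Qed.

Lemma espan_dot d f (p : 'rV[R]_4) : espan d f -> espan d.+1 (fun x => dot p (quat x) * f x).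
Proof.
move=> hf; rewrite (_ : (fun _ => _) = fun x => \sum_(c < 4) p 0 c * (quat x 0 c * f x)).
  apply: (lin_sum (espan_lin _)) => c _; apply: (linZ (espan_lin _)); exact: espan_coord.
by apply/boolp.funext => x; rewrite /dot mulr_suml; apply: eq_bigr => c _; rewrite mulrA.
Qed.

(** Multiplication by the squared norm of [quat], which is 1, raises the degree by two. *)
Lemma espan_raise d f : espan d f -> espan d.+2 f.
Proof.
move=> hf; rewrite (_ : f = fun x => \sum_(c < 4) (quat x 0 c * (quat x 0 c * f x))).
  by apply: (lin_sum (espan_lin _)) => c _; do 2 apply: espan_coord.
apply/boolp.funext => x; rewrite -[LHS]mul1r -(quat_unit x) /dot mulr_suml.
by apply: eq_bigr => c _; rewrite mulrA.
Qed.

Lemma espan1 : espan 0 (fun=> 1).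
Proof.
move=> Pi L H; have [|||h _] := H 0%N 0%N 0 0 _ _ _ => //; try by exists 0%N.
rewrite (_ : (fun=> 1) = efun cos 0 0 0 0)//; apply/boolp.funext => x.
by rewrite /efun; case: (euler_angles x) => -[a b] g; rewrite !mul0r addr0 cos0 !expr0 !mulr1.
Qed.

(** Degrees are exact, so the constant in [1 - 'X ^ 2] is homogenised by [espan_raise]. The second
    component has degree [n - 1]; the condition on [d'] avoids truncated subtraction when [n = 0],
    where that component is 0. *)
Lemma espan_cheb (p : 'rV[R]_4) n : forall d f, espan d f ->
  espan (d + n) (fun x => (chebT R n).[dot p (quat x)] * f x) /\
  (forall d', (d' .+1 = d + n)%N -> espan d' (fun x => (chebU R n).[dot p (quat x)] * f x)).
Proof.
pose hE := (hornerD, hornerN, hornerX, hornerXn, horner_one, horner_exp, hornerM).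
elim: n => [|n IH] d f hf.
  rewrite addn0; split=> [|d' _].
    rewrite (_ : (fun _ => _) = f)//; apply/boolp.funext => x.
    by rewrite /chebT /= horner_one mul1r.
  rewrite (_ : (fun _ => _) = fun=> 0); first exact: (lin0 (espan_lin _)).
  by apply/boolp.funext => x; rewrite /chebU /= horner0 mul0r.
have [hT hU] := IH d f hf.
split; last first.
  move=> d'; rewrite addnS => -[->]; rewrite (_ : (fun _ => _) = fun x =>
    dot p (quat x) * ((chebU R n).[dot p (quat x)] * f x) + (chebT R n).[dot p (quat x)] * f x).
    apply: (linD (espan_lin _)) => //.
    case dn : (d + n)%N => [|d'']; last by apply: espan_dot; apply: hU.
    have -> : n = 0%N by lia.
    rewrite (_ : (fun _ => _) = fun=> 0); first exact: (lin0 (espan_lin _)).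
    by apply/boolp.funext => x; rewrite /chebU /= horner0 mul0r mulr0.
  by apply/boolp.funext => x; rewrite chebUS !hE; ring.
rewrite addnS (_ : (fun _ => _) = fun x =>
  dot p (quat x) * ((chebT R n).[dot p (quat x)] * f x) +
  ((-1) * ((chebU R n).[dot p (quat x)] * f x) +
   dot p (quat x) * (dot p (quat x) * ((chebU R n).[dot p (quat x)] * f x)))).
  apply: (linD (espan_lin _)); first exact: espan_dot.
  case dn : (d + n)%N => [|d''].
    have -> : n = 0%N by lia.
    rewrite (_ : (fun _ => _) = fun=> 0); first exact: (lin0 (espan_lin _)).
    by apply/boolp.funext => x; rewrite /chebU /= horner0 mul0r !mulr0 addr0.
  have hU' := hU d'' (esym dn).
  apply: (linD (espan_lin _)); first by apply: (linZ (espan_lin _)); exact: espan_raise.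
  by do 2 apply: espan_dot.
by apply/boolp.funext => x; rewrite chebTS !hE; ring.
Qed.

(** Eight kernel factors of degree [n], the index being [n.+1], and two linear factors. *)
Lemma espan_certificate M n (P : 'I_M -> 'rV[R]_4) (g : 'M[R]_(M, 4)) :
  espan (8 * n + 2) (fun x => certificate n.+1 P g (quat x)).
Proof.
apply: (lin_sum (espan_lin _)) => j _.
have hU d f : espan d f -> espan (d + n)%N (fun x => (chebU R n.+1).[dot (P j) (quat x)] * f x).
  by move=> hf; apply: (espan_cheb (P j) n.+1 hf).2; rewrite addnS.
rewrite /kterm /kerW /kerS.
pose C x := dot (P j) (quat x); pose L x := dot (row j g) (quat x).
pose U x := (chebU R n.+1).[dot (P j) (quat x)].
rewrite (_ : (fun _ => _) = fun x => (n.+1%:R ^- 8) * (C x * (L x *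
  (U x * (U x * (U x * (U x * (U x * (U x * (U x * (U x * 1))))))))))).
  have -> : (8 * n + 2 = (0 + n + n + n + n + n + n + n + n).+2)%N by lia.
  apply: (linZ (espan_lin _)); do 2 apply: espan_dot; do 8 apply: (hU).
  exact: espan1.
apply/boolp.funext => x; rewrite horner_exp hornerZ -/(U x) -/(C x) -/(L x) exprMn exprVn.
ring.
Qed.

End Span.

(** * Measurability and charges *)

Local Open Scope classical_set_scope.
Local Open Scope ring_scope.

Section Measurability.
Variable R : realType.
Implicit Types (tau : R -> R) (l : nat) (k m : int).

Lemma measurable_entry (r s : 'I_3) : measurable_fun setT (fun x : SO3B R => sval x r s).
Proof.
apply: (measurability _ (RGenOpens.measurableE R)) => _ [_ [a [b ->]] <-].
apply: sub_sigma_algebra; rewrite setTI.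
exists ((fun y : 'M[R]_3 => y r s) @^-1` `]a, b[%classic) => //.
apply: open_comp => [y _|]; [exact: coord_continuous|exact: interval_open].
Qed.

Let q (c : 'I_4) (x : SO3B R) : R := quat x 0 c.

(** For a unit quaternion [(a, b, c, d)] of a rotation [x] these products are affine in the entries
    of [x], for instance [4 a ^ 2 = 1 + tr x] and [4 a b = x_21 - x_12], with indices from 0. *)
Lemma measurable_quat2 (c c' : 'I_4) : measurable_fun setT (fun x => q c x * q c' x).
Proof.
pose y (x : SO3B R) (r s : nat) : R := sval x (inord r) (inord s).
have my r s : measurable_fun setT (fun x => y x r s) by exact: measurable_entry.
have mlin (e : R) (e1 e2 e3 : R) r1 s1 r2 s2 r3 s3 :
  measurable_fun setT (fun x => e + e1 * y x r1 s1 + e2 * y x r2 s2 + e3 * y x r3 s3).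
  have mM (e0 : R) r s : measurable_fun setT (fun x => e0 * y x r s).
    by apply: measurable_funM; [exact: measurable_cst|exact: my].
  by do 3 (apply: measurable_funD; last exact: mM); exact: measurable_cst.
have q2 x : exists a b c d, [/\ [/\ q 0 x = a, q (lift 0 0) x = b, q (lift 0 (lift 0 0)) x = c &
     q (lift 0 (lift 0 (lift 0 0))) x = d], 1 = a ^+ 2 + b ^+ 2 + c ^+ 2 + d ^+ 2 &
   sval x = mx3 (a ^+ 2 + b ^+ 2 - c ^+ 2 - d ^+ 2) (2 * (b * c - a * d)) (2 * (b * d + a * c))
      (2 * (b * c + a * d)) (a ^+ 2 - b ^+ 2 + c ^+ 2 - d ^+ 2) (2 * (c * d - a * b))
      (2 * (b * d - a * c)) (2 * (c * d + a * b)) (a ^+ 2 - b ^+ 2 - c ^+ 2 + d ^+ 2)].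
  have := quat_unit x; have := rotq_quat x; rewrite /q.
  elim/v4_ind: (quat x) => a b c0 d; rewrite rotq_v4 dot_v4 => h1 h2.
  by exists a, b, c0, d; rewrite !mxE; split=> //; rewrite -h2; ring.
have yE (x : SO3B R) r s : (r < 3)%N -> (s < 3)%N -> forall a b c0 d e f g h i : R, sval x = mx3 a b c0 d e f g h i ->
    y x r s = nth 0 (nth [::] [:: [:: a; b; c0]; [:: d; e; f]; [:: g; h; i]] r) s.
  by move=> r3 s3 a b c0 d e f g h i e0; rewrite /y e0 mxE !inordK.
have main (e e1 e2 e3 : R) r1 s1 r2 s2 r3 s3 : (forall x, q c x * q c' x =
    e + e1 * y x r1 s1 + e2 * y x r2 s2 + e3 * y x r3 s3) ->
    measurable_fun setT (fun x => q c x * q c' x).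
  by move=> /boolp.funext ->; exact: mlin.
have sol (e e1 e2 e3 : R) r1 s1 r2 s2 r3 s3 :
    (r1 < 3)%N -> (s1 < 3)%N -> (r2 < 3)%N -> (s2 < 3)%N -> (r3 < 3)%N -> (s3 < 3)%N ->
    (forall a b c0 d : R, 1 = a ^+ 2 + b ^+ 2 + c0 ^+ 2 + d ^+ 2 ->
      let N r s := nth 0 (nth [::] [::
        [:: a ^+ 2 + b ^+ 2 - c0 ^+ 2 - d ^+ 2; 2 * (b * c0 - a * d); 2 * (b * d + a * c0)];
        [:: 2 * (b * c0 + a * d); a ^+ 2 - b ^+ 2 + c0 ^+ 2 - d ^+ 2; 2 * (c0 * d - a * b)];
        [:: 2 * (b * d - a * c0); 2 * (c0 * d + a * b); a ^+ 2 - b ^+ 2 - c0 ^+ 2 + d ^+ 2]] r) s in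
      nth 0 [:: a; b; c0; d] c * nth 0 [:: a; b; c0; d] c' =
      e + e1 * N r1 s1 + e2 * N r2 s2 + e3 * N r3 s3) ->
    measurable_fun setT (fun x => q c x * q c' x).
  move=> r1l s1l r2l s2l r3l s3l H; apply: (main e e1 e2 e3 r1 s1 r2 s2 r3 s3) => x.
  have [a [b [c0 [d [[qa qb qc qd] h1 h2]]]]] := q2 x.
  rewrite (yE x _ _ r1l s1l _ _ _ _ _ _ _ _ _ h2) (yE x _ _ r2l s2l _ _ _ _ _ _ _ _ _ h2).
  rewrite (yE x _ _ r3l s3l _ _ _ _ _ _ _ _ _ h2) -(H _ _ _ _ h1).
  have qn (k : 'I_4) : q k x = nth 0 [:: a; b; c0; d] k.
    case: k => -[|[|[|[|//]]]] hk /=; [rewrite -qa|rewrite -qb|rewrite -qc|rewrite -qd];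
      congr (q _ x); exact: val_inj.
  by rewrite !qn.
clear main mlin.
case: c sol => -[|[|[|[|//]]]] hc sol; case: c' sol => -[|[|[|[|//]]]] hc' sol.
- apply: (sol (1/4) (1/4) (1/4) (1/4) 0%N 0%N 1%N 1%N 2%N 2%N) => // a b c0 d h /=; move: h; lra.
- apply: (sol 0 (1/4) (-(1/4)) 0 2%N 1%N 1%N 2%N 0%N 0%N) => // a b c0 d h /=; move: h; lra.
- apply: (sol 0 (1/4) (-(1/4)) 0 0%N 2%N 2%N 0%N 0%N 0%N) => // a b c0 d h /=; move: h; lra.
- apply: (sol 0 (1/4) (-(1/4)) 0 1%N 0%N 0%N 1%N 0%N 0%N) => // a b c0 d h /=; move: h; lra.
- apply: (sol 0 (1/4) (-(1/4)) 0 2%N 1%N 1%N 2%N 0%N 0%N) => // a b c0 d h /=; move: h; lra.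
- apply: (sol (1/4) (1/4) (-(1/4)) (-(1/4)) 0%N 0%N 1%N 1%N 2%N 2%N) => // a b c0 d h /=; move: h; lra.
- apply: (sol 0 (1/4) (1/4) 0 0%N 1%N 1%N 0%N 0%N 0%N) => // a b c0 d h /=; move: h; lra.
- apply: (sol 0 (1/4) (1/4) 0 0%N 2%N 2%N 0%N 0%N 0%N) => // a b c0 d h /=; move: h; lra.
- apply: (sol 0 (1/4) (-(1/4)) 0 0%N 2%N 2%N 0%N 0%N 0%N) => // a b c0 d h /=; move: h; lra.
- apply: (sol 0 (1/4) (1/4) 0 0%N 1%N 1%N 0%N 0%N 0%N) => // a b c0 d h /=; move: h; lra.
- apply: (sol (1/4) (-(1/4)) (1/4) (-(1/4)) 0%N 0%N 1%N 1%N 2%N 2%N) => // a b c0 d h /=; move: h; lra.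
- apply: (sol 0 (1/4) (1/4) 0 1%N 2%N 2%N 1%N 0%N 0%N) => // a b c0 d h /=; move: h; lra.
- apply: (sol 0 (1/4) (-(1/4)) 0 1%N 0%N 0%N 1%N 0%N 0%N) => // a b c0 d h /=; move: h; lra.
- apply: (sol 0 (1/4) (1/4) 0 0%N 2%N 2%N 0%N 0%N 0%N) => // a b c0 d h /=; move: h; lra.
- apply: (sol 0 (1/4) (1/4) 0 1%N 2%N 2%N 1%N 0%N 0%N) => // a b c0 d h /=; move: h; lra.
- apply: (sol (1/4) (-(1/4)) (-(1/4)) (1/4) 0%N 0%N 1%N 1%N 2%N 2%N) => // a b c0 d h /=; move: h; lra.
Qed.


Lemma efun_succL (b : bool) i j u v (x : SO3 R) :
  efun cos i.+1 j (u + (-1) ^+ b) v x =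
    quat x 0 0 * efun cos i j u v x - (-1) ^+ b * quat x 0 3 * efun sin i j u v x /\
  efun sin i.+1 j (u + (-1) ^+ b) v x =
    quat x 0 0 * efun sin i j u v x + (-1) ^+ b * quat x 0 3 * efun cos i j u v x.
Proof.
rewrite /efun /quat /euler_quat; case: (euler_angles x) => -[al be] ga; rewrite !mxE /= !exprS.
set A := u%:~R * _ + _; set B := (al + ga) / 2.
have -> : (u + (-1) ^+ b)%:~R * B + v%:~R * ((al - ga) / 2) = A + (-1) ^+ b * B.
  by rewrite intrD rmorph_sign /A /B; ring.
move: A B => A B; case: b => /=; rewrite ?expr1 ?expr0 ?mulN1r ?mul1r ?mulNr cosD sinD ?cosN ?sinN; split; ring.
Qed.

Lemma efun_succR (b : bool) i j u v (x : SO3 R) :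
  efun cos i j.+1 u (v + (-1) ^+ b) x =
    quat x 0 1 * efun cos i j u v x - (-1) ^+ b * quat x 0 2 * efun sin i j u v x /\
  efun sin i j.+1 u (v + (-1) ^+ b) x =
    quat x 0 1 * efun sin i j u v x + (-1) ^+ b * quat x 0 2 * efun cos i j u v x.
Proof.
rewrite /efun /quat /euler_quat; case: (euler_angles x) => -[al be] ga; rewrite !mxE /= !exprS.
set A := u%:~R * _ + v%:~R * _; set B := (al - ga) / 2.
have -> : u%:~R * ((al + ga) / 2) + (v + (-1) ^+ b)%:~R * B = A + (-1) ^+ b * B.
  by rewrite intrD rmorph_sign /A /B; ring.
move: A B => A B; case: b => /=; rewrite ?expr1 ?expr0 ?mulN1r ?mul1r ?mulNr cosD sinD ?cosN ?sinN; split; ring.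
Qed.

(* [quat] depends on a choice of Euler angles, hence is only controlled up to sign:
   only products of an even number of its coordinates are known to be measurable. *)
Definition meas_parity (d : nat) (f : SO3B R -> R) :=
  if odd d then forall c, measurable_fun setT (fun x => q c x * f x)
  else measurable_fun setT f.

Lemma meas_parity_coord d f c : meas_parity d f -> meas_parity d.+1 (fun x => q c x * f x).
Proof.
rewrite /meas_parity /=; case: (odd d) => /= h; first exact: h.
move=> c'; have -> : (fun x => q c' x * (q c x * f x)) = (fun x => (q c' x * q c x) * f x).
  by apply/boolp.funext => x; rewrite mulrA.
by apply: measurable_funM => //; exact: measurable_quat2.
Qed.

Lemma meas_parity_comb d (a : R) f g : meas_parity d f -> meas_parity d g ->
  meas_parity d (fun x => f x + a * g x).
Proof.
rewrite /meas_parity; case: (odd d) => [hf hg c|hf hg].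
  have -> : (fun x => q c x * (f x + a * g x)) = (fun x => q c x * f x + a * (q c x * g x)).
    by apply/boolp.funext => x; ring.
  apply: measurable_funD => //; apply: measurable_funM => //; exact: measurable_cst.
apply: measurable_funD => //; apply: measurable_funM => //; exact: measurable_cst.
Qed.

Lemma adm_pred (i : nat) (u : int) : adm i.+1 u ->
  exists b : bool, exists2 u', u = u' + (-1) ^+ b & adm i u'.
Proof.
(* The frequency moves towards zero, except that [u = 0] moves to 1 at the expense of [p], which is
   positive there because [i.+1] is. *)
move=> [p e]; exists (u <= 0)%R; exists (u - (-1) ^+ (u <= 0)%R); first by rewrite subrK.
have [u0|u0] := leP u 0; rewrite ?expr0 ?expr1.
  by exists (if (u == 0)%R then p.-1 else p); case: eqP; lia.
by exists p; lia.
Qed.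

Lemma efun_meas_parity (i j : nat) (u v : int) : adm i u -> adm j v ->
  meas_parity (i + j) (efun cos i j u v) /\ meas_parity (i + j) (efun sin i j u v).
Proof.
elim: i j u v => [|i IH] j u v.
  elim: j u v => [|j IH] u v iu.
    move=> [p e]; have [p' e'] := iu.
    have -> : u = 0 by lia.
    have -> : v = 0 by lia.
    have E (tau : R -> R) : efun tau 0 0 0 0 = fun=> tau 0.
      apply/boolp.funext => x; rewrite /efun; case: (euler_angles x) => -[a b] g.
      by rewrite !mul0r addr0 !expr0 !mul1r.
    by rewrite !E /meas_parity /=; split; exact: measurable_cst.
  move=> /adm_pred[b [v' -> jv]]; have [hc hs] := IH u v' iu jv.
  rewrite addnS; split.
    have -> : efun cos 0 j.+1 u (v' + (-1) ^+ b) = fun x =>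
      q 1 x * efun cos 0 j u v' x + (- (-1) ^+ b) * (q 2 x * efun sin 0 j u v' x).
      by apply/boolp.funext => x; rewrite (efun_succR b 0 j u v' x).1 /q; ring.
    by apply: meas_parity_comb; exact: meas_parity_coord.
  have -> : efun sin 0 j.+1 u (v' + (-1) ^+ b) = fun x =>
    q 1 x * efun sin 0 j u v' x + (-1) ^+ b * (q 2 x * efun cos 0 j u v' x).
    by apply/boolp.funext => x; rewrite (efun_succR b 0 j u v' x).2 /q; ring.
  by apply: meas_parity_comb; exact: meas_parity_coord.
move=> /adm_pred[b [u' -> iu]] jv; have [hc hs] := IH j u' v iu jv.
rewrite addSn; split.
  have -> : efun cos i.+1 j (u' + (-1) ^+ b) v = fun x =>
    q 0 x * efun cos i j u' v x + (- (-1) ^+ b) * (q 3 x * efun sin i j u' v x).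
    by apply/boolp.funext => x; rewrite (efun_succL b i j u' v x).1 /q; ring.
  by apply: meas_parity_comb; exact: meas_parity_coord.
have -> : efun sin i.+1 j (u' + (-1) ^+ b) v = fun x =>
  q 0 x * efun sin i j u' v x + (-1) ^+ b * (q 3 x * efun cos i j u' v x).
  by apply/boolp.funext => x; rewrite (efun_succL b i j u' v x).2 /q; ring.
by apply: meas_parity_comb; exact: meas_parity_coord.
Qed.

(** Such functions are integrable for every finite measure, so one class serves both parts of every
    Jordan decomposition. *)
Definition bounded_measurable d (T : measurableType d) (f : T -> R) :=
  measurable_fun setT f /\ exists C, forall x, `|f x| <= C.

Local Notation bdm := (@bounded_measurable _ (SO3B R)).

Lemma bounded_measurable_lin : lin_closed bdm.
Proof.
split=> [|f g [mf [C hC]] [mg [D hD]]|a f [mf [C hC]]].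
- by split; [exact: measurable_cst|exists 0 => x; rewrite normr0].
- split; first exact: measurable_funD.
  by exists (C + D) => x; rewrite (le_trans (ler_normD _ _))// lerD.
split; first by apply: measurable_funM => //; exact: measurable_cst.
by exists (`|a| * C) => x; rewrite normrM ler_wpM2l.
Qed.

Lemma efun_bounded_measurable (i j : nat) (u v : int) : adm i u -> adm j v -> ~~ odd (i + j) ->
  bdm (efun cos i j u v) /\ bdm (efun sin i j u v).
Proof.
move=> iu jv ev; have [] := efun_meas_parity iu jv; rewrite /meas_parity (negbTE ev) => mc ms.
have B (tau : R -> R) : (forall t, `|tau t| <= 1) -> forall x, `|efun tau i j u v x| <= 1.
  move=> ht x; rewrite /efun; case: (euler_angles x) => -[a b] g.
  rewrite !normrM !normrX mulr_ile1// ?mulr_ge0 ?exprn_ge0//.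
  by rewrite mulr_ile1 ?exprn_ge0 ?exprn_ile1// (cos_max, sin_max).
by split; split=> //; exists 1; apply: B => t; rewrite (cos_max, sin_max).
Qed.

Lemma wfun_bounded_measurable l k m : (absz k <= l)%N -> (absz m <= l)%N ->
  bdm (wfun cos l k m) /\ bdm (wfun sin l k m).
Proof.
move=> kl ml; have L := bounded_measurable_lin.
have main (tau : R -> R) : (forall p p', let u := k + m in let v := k - m in
    (absz u + 2 * p + (absz v + 2 * p') = 2 * l)%N ->
    bdm (efun tau (absz u + 2 * p) (absz v + 2 * p') u v)) ->
  bdm (wfun tau l k m).
  move=> H; have [hr [w _ [eps [_ [qs [hq wE]]]]]] := wfun_triangular tau kl ml.
  rewrite (boolp.funext wE); apply: (linZ L); apply: (lin_sum L) => s _.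
  case: (hq s) => [w0|qr].
    rewrite (_ : (fun _ => _) = fun=> 0); first exact: (lin0 L).
    by apply/boolp.funext => x; rewrite w0 mul0r.
  by apply: (linZ L); apply: (linZ L); apply: H; lia.
have bm p p' : let u := k + m in let v := k - m in
    (absz u + 2 * p + (absz v + 2 * p') = 2 * l)%N ->
    bdm (efun cos (absz u + 2 * p) (absz v + 2 * p') u v) /\
    bdm (efun sin (absz u + 2 * p) (absz v + 2 * p') u v).
  move=> u v e; apply: efun_bounded_measurable; [by exists p|by exists p'|].
  by rewrite e oddM.
by split; apply: main => p p' u v e; case: (bm p p' e).
Qed.

End Measurability.

(** * Integration against finite measures and charges *)

Section FiniteMeasure.
Context d (T : measurableType d) (R : realType).
Variable m : {finite_measure set T -> \bar R}.
Implicit Types (f g : T -> R) (A S : set T).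

Lemma bounded_measurable_integrable f : bounded_measurable f ->
  m.-integrable [set: T] (EFin \o f).
Proof.
move=> [mf [C hC]]; apply: measurable_bounded_integrable => //.
  by rewrite -ge0_fin_numE ?fin_num_measure.
exists C; split; first exact: num_real.
by move=> B CB x _; exact: le_trans (hC x) (ltW CB).
Qed.

Lemma bounded_measurable_indic A : measurable A -> bounded_measurable (\1_A : T -> R).
Proof.
move=> mA; split; first exact: measurable_indic.
by exists 1 => x; rewrite indicE; case: (x \in A); rewrite ?normr1 ?normr0.
Qed.

Lemma Rintegral_indicT A : measurable A -> \int[m]_x (\1_A x) = fine (m A).
Proof. by move=> mA; rewrite /Rintegral integral_indic// setIT. Qed.

Lemma Rintegral_null S f g : measurable S -> m (~` S) = 0%E ->
  bounded_measurable f -> bounded_measurable g -> (forall x, S x -> f x = g x) ->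
  \int[m]_x f x = \int[m]_x g x.
Proof.
move=> mS mS0 [mf _] [mg _] fg; rewrite /Rintegral; congr fine.
apply: ae_eq_integral => //; [exact/measurable_EFinP|exact/measurable_EFinP|].
exists (~` S); split=> //; first exact: measurableC.
by move=> x /= h Sx; apply: h => _; rewrite fg.
Qed.

Lemma Rintegral_eq0_null S g : measurable S -> bounded_measurable g ->
  (forall x, 0 <= g x) -> (forall x, ~ S x -> g x != 0) ->
  \int[m]_x g x = 0 -> m (~` S) = 0%E.
Proof.
move=> mS bg g0 gS h0; have ig := bounded_measurable_integrable bg.
have h : (\int[m]_x `|(EFin \o g) x|)%E = 0%E.
  have -> : (\int[m]_x `|(EFin \o g) x|)%E = (\int[m]_x (g x)%:E)%E.
    by apply: eq_integral => x _ /=; rewrite ger0_norm.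
  by rewrite -[LHS]fineK ?integrable_fin_num//; congr EFin.
have [mg _] := bg.
have [N [mN N0 sub]] : ae_eq m setT (EFin \o g) (cst 0%E).
  by apply/ae_eq_integral_abs => //; exact/measurable_EFinP.
apply/eqP; rewrite -measure_le0 -N0 le_measure ?inE//; first exact: measurableC.
move=> x /= Sx; apply: sub => /= /(_ I) [] /eqP; exact/negP/gS.
Qed.

End FiniteMeasure.

Section Pairing.
Context d (T : measurableType d) (R : realType).
Variable nu : {charge set T -> \bar R}.
Implicit Types (f g : T -> R) (A S : set T).

Let mp : {finite_measure set T -> \bar R} := jordan_pos (hahn_setsP nu).
Let mn : {finite_measure set T -> \bar R} := jordan_neg (hahn_setsP nu).

Lemma charge_pairingD f g : bounded_measurable f -> bounded_measurable g ->
  charge_pairing nu (fun x => f x + g x) = charge_pairing nu f + charge_pairing nu g.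
Proof.
move=> bf bg; rewrite /charge_pairing !RintegralD//;
  try exact: bounded_measurable_integrable.
by ring.
Qed.

Lemma charge_pairingZ a f : bounded_measurable f ->
  charge_pairing nu (fun x => a * f x) = a * charge_pairing nu f.
Proof.
move=> bf; rewrite /charge_pairing !RintegralZl//; try exact: bounded_measurable_integrable.
by ring.
Qed.

Lemma charge_pairing_indic A : measurable A -> charge_pairing nu \1_A = fine (nu A).
Proof.
move=> mA; rewrite /charge_pairing !Rintegral_indicT//.
rewrite (jordan_decomp (hahn_setsP nu) mA) /cadd /= /cscale /= mulN1e.
by rewrite fineB ?fin_num_measure.
Qed.

Definition total_variation : R := fine (mp setT) + fine (mn setT).

Lemma jordan_hahn_sets A : measurable A ->
  mp A = nu (A `&` (hahn_sets nu).1) /\ mn A = (- nu (A `&` (hahn_sets nu).2))%E.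
Proof.
move=> mA; have -> : mp A = jordan_pos (hahn_setsP nu) A by [].
have -> : mn A = jordan_neg (hahn_setsP nu) A by [].
rewrite jordan_posE jordan_negE charge.cjordan_posE charge.cjordan_negE.
by rewrite /crestr0 /crestr mem_set.
Qed.

(** The two Hahn sets form a partition, and on it the sum equals [total_variation]. *)
Lemma total_variation_le : (total_variation%:E <= TV_norm nu)%E.
Proof.
have [[mP _] [mN _] PN PN0] := hahn_setsP nu.
have [hp hn] := jordan_hahn_sets (@measurableT _ T).
rewrite !setTI in hp hn.
apply: ereal_sup_ubound.
exists 2%N, (fun i : 'I_2 => if i == 0 then (hahn_sets nu).1 else (hahn_sets nu).2); split.
- by move=> j; case: ifP => _.
- move=> i j ij; case: (i =P 0) ij => [->|i0]; case: (j =P 0) => [->|j0] //.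
    by rewrite setIC.
  case: i j i0 j0 => -[|[|//]] hi [[|[|//]] hj] i0 j0;
    by [case: i0; exact: val_inj|case: j0; exact: val_inj|move=> /eqP[]; exact: val_inj].
- rewrite -PN; apply/seteqP; split=> x.
    by move=> [i _]; case: ifP => _ h; [left|right].
  by move=> [h|h]; [exists ord0|exists (lift ord0 ord0)].
rewrite big_ord_recl big_ord_recl big_ord0 /= adde0 -hp.
rewrite (_ : nu _ = - mn setT)%E; last by rewrite hn oppeK.
rewrite abseN !gee0_abs ?measure_ge0//.
by rewrite /total_variation EFinD !fineK ?fin_num_measure.
Qed.

(** The defect is the integral of [1 - g] over the positive part plus that of [1 + g] over the
    negative part. As an identity it also serves the case of equality, where both integrals must
    vanish. *)
Lemma charge_pairing_le g : bounded_measurable g -> (forall x, `|g x| <= 1) ->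
  total_variation - charge_pairing nu g =
    \int[mp]_x (1 + (- 1) * g x) + \int[mn]_x (1 + g x) /\
  charge_pairing nu g <= total_variation.
Proof.
move=> bg g1.
have b1 : bounded_measurable (fun _ : T => 1 : R).
  by split; [exact: measurable_cst|exists 1 => _; rewrite normr1].
have bN : bounded_measurable (fun x : T => (-1) * g x).
  have [mg [C hC]] := bg; split; first by apply: measurable_funM.
  by exists C => x; rewrite mulN1r normrN.
suff E : total_variation - charge_pairing nu g =
    \int[mp]_x (1 + (- 1) * g x) + \int[mn]_x (1 + g x).
  split=> //; rewrite -subr_ge0 E addr_ge0// Rintegral_ge0// => x _;
    by have := g1 x; rewrite ler_norml; lra.
rewrite !RintegralD//; try exact: bounded_measurable_integrable.
rewrite RintegralZl//; last exact: bounded_measurable_integrable.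
by rewrite !Rintegral_cst// /total_variation /charge_pairing !mul1r -/mp -/mn; ring.
Qed.

Lemma charge_pairing_eq_null g S : bounded_measurable g -> (forall x, `|g x| <= 1) ->
  measurable S -> (forall x, ~ S x -> `|g x| < 1) ->
  charge_pairing nu g = total_variation -> mp (~` S) = 0%E /\ mn (~` S) = 0%E.
Proof.
move=> bg g1 mS gS e; have [E _] := charge_pairing_le bg g1.
have g1' x : - 1 <= g x <= 1 by rewrite -ler_norml.
have gS' x : ~ S x -> - 1 < g x < 1 by move=> /gS; rewrite ltr_norml.
have p0 : 0 <= \int[mp]_x (1 + (- 1) * g x).
  by apply: Rintegral_ge0 => x _; have := g1' x; lra.
have n0 : 0 <= \int[mn]_x (1 + g x).
  by apply: Rintegral_ge0 => x _; have := g1' x; lra.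
have [mg _] := bg.
split.
  apply: (Rintegral_eq0_null (g := fun x => 1 + (- 1) * g x)) => //.
  - split; first by apply: measurable_funD => //; exact: measurable_funM.
    by exists 2 => x; have := g1' x; rewrite ler_norml; lra.
  - by move=> x; have := g1' x; lra.
  - by move=> x /gS'; lra.
  by move: E p0 n0; rewrite e; lra.
apply: (Rintegral_eq0_null (g := fun x => 1 + g x)) => //.
- split; first by apply: measurable_funD.
  by exists 2 => x; have := g1' x; rewrite ler_norml; lra.
- by move=> x; have := g1' x; lra.
- by move=> x /gS'; lra.
by move: E p0 n0; rewrite e; lra.
Qed.

Variables (M : nat) (x : 'I_M -> T).
Hypothesis x_inj : injective x.
Hypothesis mx : forall i, measurable [set x i].

Lemma measurable_range : measurable (range x).
Proof.
rewrite (_ : range x = \bigcup_(i in [set: 'I_M]) [set x i]).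
  by apply: fin_bigcup_measurable => //; exact: finite_finset.
by apply/seteqP; split=> [_ [i _ <-]|t [i _ ->]]; exists i.
Qed.

Lemma discrete_pairing f : mp (~` range x) = 0%E -> mn (~` range x) = 0%E ->
  bounded_measurable f ->
  charge_pairing nu f = \sum_(i < M) f (x i) * fine (nu [set x i]).
Proof.
(* [f] agrees with this simple function on the nodes, which carry both parts of [nu]. *)
move=> hp hn bf; pose g t := \sum_(i < M) f (x i) * \1_[set x i] t.
have S (J : seq 'I_M) : bounded_measurable (fun t => \sum_(i <- J) f (x i) * \1_[set x i] t) /\
   charge_pairing nu (fun t => \sum_(i <- J) f (x i) * \1_[set x i] t) =
   \sum_(i <- J) f (x i) * fine (nu [set x i]).
  elim: J => [|i J [[mJ [C hC]] IH]].
    under [fun t => _]boolp.funext do rewrite big_nil.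
    split; first by split; [exact: measurable_cst|exists 0 => _; rewrite normr0].
    by rewrite big_nil /charge_pairing !Rintegral_cst// !mul0r subrr.
  under [fun t => _]boolp.funext do rewrite big_cons.
  have [mi [D hD]] := bounded_measurable_indic R (mx i).
  have bi : bounded_measurable (fun t => f (x i) * \1_[set x i] t).
    split; first by apply: measurable_funM.
    by exists (`|f (x i)| * D) => t; rewrite normrM ler_wpM2l.
  split.
    have [mi' [D' hD']] := bi.
    split; first exact: measurable_funD.
    by exists (D' + C) => t; rewrite (le_trans (ler_normD _ _))// lerD.
  rewrite charge_pairingD//; last by split=> //; exists C.
  by rewrite charge_pairingZ ?charge_pairing_indic ?IH ?big_cons//; split=> //; exists D.
have [bg <-] := S (index_enum 'I_M).
have fg t : range x t -> f t = g t.
  move=> [i _ <-]; rewrite /g (bigD1 i)//= indicE mem_set// mulr1 big1 ?addr0// => j ji.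
  by rewrite indicE memNset ?mulr0//= => /x_inj e; rewrite e eqxx in ji.
have mr := measurable_range; rewrite /charge_pairing; congr (_ - _).
  exact: (Rintegral_null (m := mp) mr hp bf bg fg).
exact: (Rintegral_null (m := mn) mr hn bf bg fg).
Qed.

End Pairing.

Section DiscreteCharge.
Context d (T : measurableType d) (R : realType).
Variables (M : nat) (c : 'I_M -> R) (x : 'I_M -> T).
Variable nu : {charge set T -> \bar R}.
Hypothesis x_inj : injective x.
Hypothesis mx : forall i, measurable [set x i].
Hypothesis nuE : forall A, measurable A -> nu A = (\sum_(i < M) c i * (x i \in A)%:R)%:E.

Lemma discrete_charge_pairing f : bounded_measurable f ->
  charge_pairing nu f = \sum_(i < M) f (x i) * c i.
Proof.
move=> bf; have mr := measurable_range mx; have mrC := measurableC mr.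
have [[mP _] [mN _] _ _] := hahn_setsP nu.
have [hp hn] := jordan_hahn_sets nu mrC.
have z (B : set T) : measurable B -> nu (~` range x `&` B) = 0%E.
  move=> mB; rewrite nuE; last exact: measurableI.
  rewrite big1// => i _; rewrite memNset ?mulr0// => -[h _]; apply: h; by exists i.
rewrite (discrete_pairing x_inj mx)//; last 2 first.
- by rewrite hp z.
- by rewrite hn z ?oppe0.
apply: eq_bigr => i _; rewrite nuE//= (bigD1 i)//= mem_set// mulr1 big1 ?addr0// => j ji.
by rewrite memNset ?mulr0//= => /x_inj e; rewrite e eqxx in ji.
Qed.

(** Each node lies in at most one set of a partition. *)
Lemma discrete_TV_le : (TV_norm nu <= (\sum_(i < M) `|c i|)%:E)%E.
Proof.
apply: ge_ereal_sup => _ [n [B [mB dB _ ->]]].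
under eq_bigr do rewrite nuE// abse_EFin.
rewrite sumEFin lee_fin.
apply: (@le_trans _ _ (\sum_(j < n) \sum_(i < M) `|c i| * (x i \in B j)%:R)).
  apply: ler_sum => j _; apply: le_trans (ler_norm_sum _ _ _) _.
  by apply: ler_sum => i _; rewrite normrM normr_nat.
rewrite exchange_big /=; apply: ler_sum => i _; rewrite -mulr_sumr ler_piMr//.
have [[j xj]|h] := pselect (exists j, x i \in B j).
  rewrite (bigD1 j)//= xj big1 ?addr0// => k kj; case xk: (x i \in B k) => //.
  by have : (B k `&` B j) (x i) by [split; exact: set_mem]; rewrite dB.
by rewrite big1// => j _; case xj: (x i \in B j) => //; case: h; exists j; rewrite xj.
Qed.

End DiscreteCharge.

Lemma dual_certificate_uniqueness d (T : measurableType d) (R : realType) (M : nat)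
    (c : 'I_M -> R) (x : 'I_M -> T) (nu mu : {charge set T -> \bar R}) :
  injective x -> (forall i, measurable [set x i]) ->
  (forall A, measurable A -> nu A = (\sum_(i < M) c i * (x i \in A)%:R)%:E) ->
  (forall v : 'I_M -> R, exists g : T -> R,
    [/\ bounded_measurable g, charge_pairing mu g = charge_pairing nu g,
        forall i, g (x i) = v i &
        (forall i, v i = 1 \/ v i = -1) -> forall t, ~ range x t -> `|g t| < 1]) ->
  (TV_norm nu <= TV_norm mu)%E /\
  (TV_norm mu = TV_norm nu -> forall A, measurable A -> mu A = nu A).
Proof.
(* A zero weight gets the value 1: the strict bound off the nodes is available only for values 1 and
   -1. *)
move=> x_inj mx nuE cert; pose s i : R := if 0 <= c i then 1 else -1.
have s1 i : s i = 1 \/ s i = -1 by rewrite /s; case: ifP; [left|right].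
have [g [bg pg gx g1]] := cert s; have gS := g1 s1.
have mr := measurable_range mx.
have gle t : `|g t| <= 1.
  have [[i _ <-]|/gS/ltW//] := pselect (range x t).
  by rewrite gx; case: (s1 i) => ->; rewrite ?normrN normr1.
have pE : charge_pairing mu g = \sum_(i < M) `|c i|.
  rewrite pg (discrete_charge_pairing x_inj mx nuE)//; apply: eq_bigr => i _.
  rewrite gx /s; case: (lerP 0 (c i)) => ci; first by rewrite mul1r ger0_norm.
  by rewrite mulN1r ltr0_norm.
have [_ ple] := charge_pairing_le mu bg gle; rewrite pE in ple.
have TVnu := discrete_TV_le nuE.
have TVmu := total_variation_le mu.
split; first by apply: le_trans TVnu (le_trans _ TVmu); rewrite lee_fin.
move=> TVeq A mA.
have e : charge_pairing mu g = total_variation mu.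
  apply/eqP; rewrite eq_le pE ple /= -lee_fin.
  by apply: le_trans TVmu _; rewrite TVeq.
have [hp hn] := charge_pairing_eq_null bg gle mr gS e.
have ci i : fine (mu [set x i]) = c i.
  (* Values 1 at [x i] and 0 at the other nodes isolate the weight of [mu] at [x i]. *)
  have [f [bf pf fx _]] := cert (fun j => (j == i)%:R).
  move: pf; rewrite (discrete_pairing x_inj mx hp hn bf).
  rewrite (discrete_charge_pairing x_inj mx nuE)//.
  rewrite (bigD1 i)//= big1 => [|j /negPf ji]; last by rewrite fx ji mul0r.
  rewrite [RHS](bigD1 i)//= big1 => [|j /negPf ji]; last by rewrite fx ji mul0r.
  by rewrite !addr0 fx eqxx !mul1r.
rewrite nuE// -[LHS]fineK ?fin_num_measure//; congr EFin.
rewrite -charge_pairing_indic// (discrete_pairing x_inj mx hp hn); last exact: bounded_measurable_indic.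
by apply: eq_bigr => i _; rewrite ci indicE mulrC.
Qed.

Lemma measurable_SO3_set1 (R : realType) (x : SO3B R) : measurable [set x].
Proof.
rewrite (_ : [set x] = \bigcap_(r in [set: 'I_3]) \bigcap_(s in [set: 'I_3])
    ((fun y : SO3B R => sval y r s) @^-1` [set sval x r s])).
  apply: fin_bigcap_measurable => [|r _]; first exact: finite_finset.
  apply: fin_bigcap_measurable => [|s _]; first exact: finite_finset.
  by rewrite -[X in measurable X]setTI; exact: measurable_entry.
apply/seteqP; split=> [_ -> r _ s _ //|y /= h].
by apply: val_inj; apply/matrixP => r s; exact: h.
Qed.

(** The linearly closed class consists of the bounded measurable functions with equal pairings;
    measurability belongs to it because additivity of the pairing depends on it. *)
Lemma moments_certificate (R : realType) (N q : nat) (mu nu : {charge set SO3B R -> \bar R}) :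
  (4 * q < N)%N ->
  (forall (l : nat) (k m : int), (`|k| <= l%:Z)%R -> (`|m| <= l%:Z)%R -> (l <= N)%N ->
     charge_pairing mu (wignerD_re l k m) = charge_pairing nu (wignerD_re l k m) /\
     charge_pairing mu (wignerD_im l k m) = charge_pairing nu (wignerD_im l k m)) ->
  forall M (P : 'I_M -> 'rV[R]_4) (g : 'M[R]_(M, 4)),
    let Q : SO3B R -> R := fun x => certificate q.+1 P g (quat x) in
    bounded_measurable Q /\ charge_pairing mu Q = charge_pairing nu Q.
Proof.
move=> qN H M P g; pose Pi (f : SO3 R -> R) :=
  bounded_measurable (f : SO3B R -> R) /\
  charge_pairing mu (f : SO3B R -> R) = charge_pairing nu (f : SO3B R -> R).
have [b0 bD bZ] := @bounded_measurable_lin R.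
have L : lin_closed Pi.
  split=> [|f h [bf pf] [bh ph]|a f [bf pf]].
  - by split=> //; rewrite /charge_pairing !Rintegral_cst// !mul0r.
  - by split; [exact: bD|rewrite !charge_pairingD// pf ph].
  by split; [exact: bZ|rewrite !charge_pairingZ// pf].
have W l k m : (l <= N)%N -> (absz k <= l)%N -> (absz m <= l)%N ->
    Pi (wfun cos l k m) /\ Pi (wfun sin l k m).
  move=> lN kl ml; have [bc bs] := wfun_bounded_measurable R kl ml.
  have [||hre him] := H l k m _ _ lN; [by lia|by lia|].
  split; split=> //; apply: (can_inj (mulKf (_ : -1 != 0 :> R))).
    by rewrite oppr_eq0 oner_neq0.
  rewrite -!charge_pairingZ//.
  rewrite (_ : (fun _ => _) = wignerD_im l k m)//; apply/boolp.funext => x.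
  by rewrite /wfun /wignerD_im; case: (euler_angles x) => -[a b] c; rewrite mulN1r mulNr.
apply: (espan_certificate P g L) => i j u v [p ->] [p' ->] e.
split.
  (* The certificate has degree [8 q + 2 = 2 (4 q + 1)], and [4 q + 1 <= N]. *)
  by apply: (efun_of_wfun L (L := N) _ (l := 4 * q + 1)); [move=> l k m lN kl ml; case: (W l k m lN kl ml)|lia|lia].
by apply: (efun_of_wfun L (L := N) _ (l := 4 * q + 1)); [move=> l k m lN kl ml; case: (W l k m lN kl ml)|lia|lia].
Qed.

Theorem theorem2p1 (R : realType) (N M : nat) (c : 'I_M -> R)
    (x : 'I_M -> SO3 R)
    (mustar : {charge set SO3B R -> \bar R}) :
  (20 <= N)%N ->
  injective x ->
  (forall i j : 'I_M, i != j ->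
     36 / (N.+1)%:R <= rot_angle (invmx (sval (x j)) *m sval (x i))) ->
  (forall A : set (SO3B R), measurable A ->
     mustar A = (\sum_(i < M) c i * (x i \in A)%:R)%:E) ->
  forall mu : {charge set SO3B R -> \bar R},
    (forall (l : nat) (k m : int), (`|k| <= l%:Z)%R -> (`|m| <= l%:Z)%R ->
       (l <= N)%N ->
       charge_pairing mu (wignerD_re l k m) = charge_pairing mustar (wignerD_re l k m)
       /\ charge_pairing mu (wignerD_im l k m)
          = charge_pairing mustar (wignerD_im l k m)) ->
    (TV_norm mustar <= TV_norm mu)%E /\
    (TV_norm mu = TV_norm mustar ->
       forall A : set (SO3B R), measurable A -> mu A = mustar A).
Proof.
move=> N20 x_inj sep mustarE mu H.
apply: (dual_certificate_uniqueness (x := x : 'I_M -> SO3B R) x_inj _ mustarE).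
  by move=> i; exact: measurable_SO3_set1.
(* [n = q.+1] is the largest index for which the degree [8 q + 2] stays within [2 N]. *)
move=> v; pose q := ((N - 1) %/ 4)%N; pose D : R := 18 / N.+1%:R.
have N1 : 21 <= N.+1%:R :> R by rewrite (ler_nat R 21).
have N0 : 0 < N.+1%:R :> R by exact: lt_le_trans N1.
have n5 : (5 <= q.+1)%N by rewrite /q; lia.
have qN : (4 * q < N)%N by rewrite /q; lia.
have D0 : 0 < D by rewrite divr_gt0.
have D1 : D <= 6 / 7 by rewrite /D ler_pdivrMr//; lra.
have nD : 30 / 7 <= q.+1%:R * D.
  rewrite /D mulrA ler_pdivlMr//.
  (* [n >= N / 4] and [N >= 20] give [n / (N + 1) >= 5 / 21], with equality at [N = 20]. *)
  have : (5 * N.+1)%:R <= (21 * q.+1)%:R :> R by rewrite ler_nat /q; lia.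
  by rewrite !natrM; lra.
have sepP i j : i != j -> `|dot (quat (x i)) (quat (x j))| <= cos D.
  move=> ij; rewrite dotC; apply: quat_sep; first exact: ltW.
  by apply: le_trans (sep i j ij); rewrite /D mulrA -natrM.
have [g [gx g1]] := dual_certificate n5 (fun i => quat_unit (x i)) D0 D1 nD sepP v.
have [bQ pQ] := moments_certificate qN H (fun i => quat (x i)) g.
exists (fun y => certificate q.+1 (fun i => quat (x i)) g (quat y)); split=> // s1 t xt.
apply: g1 => //; first exact: quat_unit.
move=> i; apply/eqP => e; apply: xt; exists i => //; exact: quat_inj e.
Qed.
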